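(* Let $0<\alpha<4$. Let $A_n=(a_{ij})_{1\le i\le n,\,1\le j\le p}$ be an $n\times p$ random matrix, $p=p(n)$, with i.i.d. real entries satisfying $\bar F(x)=1-F(x)=\mathbb{P}(|a_{ij}|>x)=L(x)x^{-\alpha}$ for $x>0$, where $L$ is slowly varying at infinity (the distribution of the entries not depending on $n$). If $2\le\alpha<4$, assume in addition that $\mathbb{E}(a_{ij})=0$. Assume $\lim_{n\to\infty}\frac{p}{n}=\gamma$ for some constant $\gamma\ge1$. Let $\lambda_1\ge\dots\ge\lambda_n$ be the eigenvalues of $A_nA_n^t$ and $b_{np}=\inf\{x: 1-F(x)\le\frac{1}{np}\}$. Then the point process $$\mathcal{P}_n=\sum_{i}\delta_{b_{np}^{-2}\lambda_i}$$ considered on $(0,\infty)$ converges in distribution, as $p$ goes to infinity, to the Poisson point process $\mathcal{P}$ on $(0,\infty)$ with intensity $\rho(x)=\frac{\alpha}{2x^{1+\alpha/2}}$.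
   Context: A function $L$ is slowly varying if $\lim_{x\to\infty}L(tx)/L(x)=1$ for all $t>0$. $F$ denotes the distribution function of $|a_{ij}|$. $A_n^t$ is the transpose of $A_n$. *)

(* Defs.v *)
From HB Require Import structures.
From mathcomp Require Import all_boot all_order all_algebra.
From mathcomp Require Import all_classical all_reals all_analysis.
From mathcomp Require Import measurable_realfun.
Import Order.TTheory GRing.Theory Num.Theory.
Import numFieldNormedType.Exports.

Set Implicit Arguments.
Unset Strict Implicit.
Unset Printing Implicit Defensive.

Local Open Scope classical_set_scope.
Local Open Scope ring_scope.

Definition slowly_varying (R : realType) (L : R -> R) : Prop :=
  forall t : R, 0 < t -> L (t * x) / L x @[x --> +oo] --> (1 : R).

(* The product rule over all families of measurable sets contains the product
   rule over subfamilies: take [B i = setT] for the indices left out. *)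
Definition mutually_independent (R : realType) (d : measure_display)
    (T : measurableType d) (P : probability T R) (d' : measure_display)
    (U : measurableType d') (I : finType) (X : I -> T -> U) : Prop :=
  forall B : I -> set U, (forall i, measurable (B i)) ->
    P (\bigcap_(i in [set: I]) (X i @^-1` B i)) =
    (\prod_(i : I) P (X i @^-1` B i))%E.

(* Distribution function of |a| when a has law mu. *)
Definition abs_cdf (R : realType) (mu : probability R R) (x : R) : R :=
  fine (mu [set y : R | `|y| <= x]).

Definition tail_quantile (R : realType) (F : R -> R) (m : nat) : R :=
  inf [set x : R | 1 - F x <= m%:R^-1].

(* [lam] lists the eigenvalues of [M], with multiplicity, in nonincreasing
   order. *)
Definition ordered_eigenvalues (R : realType) (n : nat) (M : 'M[R]_n)
    (lam : 'I_n -> R) : Prop :=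
  char_poly M = \prod_(i < n) ('X - (lam i)%:P) /\
  (forall i j : 'I_n, (i <= j)%N -> lam j <= lam i).

(* Locally finite, integer-valued measures on (0, +oo), represented as measures
   on the line that do not charge the complement. *)
Record point_measure (R : realType) := PointMeasure {
  pm_measure :> {measure set R -> \bar R} ;
  pm_support : pm_measure (~` `]0, +oo[) = 0%E ;
  pm_locally_finite : forall K : set R, compact K -> K `<=` `]0, +oo[ ->
    (pm_measure K < +oo)%E ;
  pm_integer : forall B : set R, measurable B -> (pm_measure B < +oo)%E ->
    exists k : nat, pm_measure B = k%:R%:E }.

HB.instance Definition _ (R : realType) := gen_eqMixin (point_measure R).
HB.instance Definition _ (R : realType) := gen_choiceMixin (point_measure R).

(* Continuous functions with compact support on (0, +oo), extended by 0. *)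
Record test_function (R : realType) := TestFunction {
  test_fun :> R -> R ;
  test_continuous : continuous test_fun ;
  test_support : exists K : set R, [/\ compact K, K `<=` `]0, +oo[ &
    forall x, ~ K x -> test_fun x = 0] }.

HB.instance Definition _ (R : realType) := gen_eqMixin (test_function R).
HB.instance Definition _ (R : realType) := gen_choiceMixin (test_function R).

Definition test_pairing (R : realType) (mu : point_measure R) :
    {ptws test_function R -> R} :=
  fun f => \int[mu]_x f x.

(* Point measures with the vague topology: the coarsest one that makes
   mu |-> \int f dmu continuous for every test function f.  A library measure
   also carries values on non-measurable sets; two point measures that differ
   only there are topologically indistinguishable, so continuous functionals
   agree on them. *)
Definition vague (R : realType) : topologicalType :=
  initial_topology (@test_pairing R).

(* Weak convergence of the laws of xi n (under P n) to the law of eta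
   (under Q) on the space of point measures with the vague topology. *)
Definition cvg_in_distribution (R : realType)
    (d : nat -> measure_display) (T : forall n, measurableType (d n))
    (P : forall n, probability (T n) R)
    (xi : forall n, T n -> point_measure R)
    (d' : measure_display) (T' : measurableType d') (Q : probability T' R)
    (eta : T' -> point_measure R) : Prop :=
  forall g : vague R -> R, continuous g ->
    (exists C : R, forall mu : vague R, `|g mu| <= C) ->
    ('E_(P n)[fun w => g (xi n w)] @[n --> \oo] --> 'E_Q[fun w => g (eta w)])%E.

(* The Poisson probabilities are written out because [poisson_pmf] is 1, for
   every k, at rate 0. *)
Definition poisson_point_process (R : realType) (d : measure_display)
    (T : measurableType d) (Q : probability T R)
    (Lambda : set R -> \bar R) (eta : T -> point_measure R) : Prop :=
  [/\ (forall B : set R, measurable B ->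
         measurable_fun [set: T] (fun w => eta w B)),
      (forall B : set R, measurable B -> B `<=` `]0, +oo[ ->
         (Lambda B < +oo)%E -> forall k : nat,
         Q [set w | eta w B = k%:R%:E] =
         (expR (- fine (Lambda B)) * fine (Lambda B) ^+ k / k`!%:R)%:E),
      (forall B : set R, measurable B -> B `<=` `]0, +oo[ ->
         Lambda B = +oo%E -> Q [set w | eta w B = +oo%E] = 1%E) &
      (forall (k : nat) (B : 'I_k -> set R),
         (forall i, measurable (B i)) -> (forall i, B i `<=` `]0, +oo[) ->
         trivIset [set: 'I_k] B ->
         mutually_independent Q (fun i w => eta w (B i)))].

Definition intensity_measure (R : realType) (rho : R -> R) (B : set R) :
    \bar R :=
  (\int[lebesgue_measure]_(x in B) (rho x)%:E)%E.

Section SumOfDiracs.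
Variables (R : realType) (n : nat) (x : 'I_n -> R).
Local Open Scope ereal_scope.

Definition sum_dirac : {measure set R -> \bar R} :=
  mrestr (msum (fun k => \d_((codom x)`_k)%R) n)
    (measurable_itv `]0%R, +oo[ : measurable (`]0%R, +oo[ : set R)).

Lemma sum_diracE (B : set R) :
  sum_dirac B = \sum_(i < n) \d_(x i) (B `&` `]0%R, +oo[).
Proof.
rewrite /sum_dirac /mrestr /= /msum; apply: eq_bigr => i _.
rewrite (nth_map i) ?size_enum_ord // nth_ord_enum //.
Qed.

Lemma sum_dirac_nat (B : set R) : exists k : nat, sum_dirac B = k%:R%:E.
Proof.
rewrite sum_diracE; elim/big_ind: _ => [|_ _ [k ->] [l ->]|i _].
- by exists 0%N.
- by exists (k + l)%N; rewrite natrD EFinD.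
- by exists (x i \in B `&` `]0%R, +oo[) => /=; rewrite diracE.
Qed.

Lemma sum_dirac_support : sum_dirac (~` `]0%R, +oo[) = 0.
Proof. by rewrite sum_diracE big1 // => i _; rewrite setICl measure0. Qed.

(* The point process of the x i, those that lie in (0, +oo) only. *)
Definition point_measure_of : point_measure R :=
  @PointMeasure R sum_dirac sum_dirac_support
    (fun K _ _ => let: ex_intro _ e := sum_dirac_nat K in
       eq_ind_r (fun y => y < +oo) (ltry _) e)
    (fun B _ _ => sum_dirac_nat B).

End SumOfDiracs.

(* Main.v *)
Require Import Defs.
From HB Require Import structures.
From mathcomp Require Import all_boot all_order all_algebra.
From mathcomp Require Import all_classical all_reals all_analysis.
From mathcomp Require Import measurable_realfun.
From mathcomp Require Import ring lra.
Import Order.TTheory GRing.Theory Num.Theory.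
Import numFieldNormedType.Exports.

Set Implicit Arguments.
Unset Strict Implicit.
Unset Printing Implicit Defensive.

Local Open Scope classical_set_scope.
Local Open Scope ring_scope.

(* Write each entry as a small part, truncated at [K = n ^ kappa], plus a large
   part, with [K] much smaller than [b n].  With high probability no two large
   entries share a row or a column, so the large part has singular values equal
   to the moduli of its entries; and the small part has norm at most
   [delta * b n], by the moment method for the centered truncated entries and a
   direct estimate for their mean.  By the min-max principle the number of
   eigenvalues above [(x * b n) ^ 2] then equals the number of entries of modulus
   above [x * b n], unless an entry has modulus close to [x * b n].  The counts
   of entries in disjoint cells are multinomial and converge to independent
   Poisson variables, since [n p * P (|a_ij| > x * b n)] tends to
   [x ^ (- alpha)].

   Counts on dyadic cells suffice for the vague topology: if two point measures
   have equal counts on a fine grid, they are close on test functions.  For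
   bounded continuous [g >= 0], the infimum of [g] over the measures with the
   same counts on the grid bounds [g] from below, so Fatou's lemma gives
   [liminf E g (xi_n) >= E g (eta)]; applying this to [C + g] and [C - g] gives
   the limit, without a tightness argument. *)

(** * Spectral counting for sparse perturbations *)

(** The bound 4 on [alpha] comes from the noise. Up to slowly varying factors [b n] is
    [n ^ (2 / alpha)]. Two large entries share a line with probability about [n ^ 3] times the
    squared tail at [K], which forces [kappa] above [3 / (2 * alpha)]. The bound on the centered
    truncated part grows at least like [sqrt n], which is below [n ^ (2 / alpha)] exactly when
    [alpha < 4]. The mean of the truncated entries fills a rank-one matrix of norm about [n] times
    that mean: it is negligible for [alpha < 2] because [n] is below [n ^ (2 / alpha)], and for
    [alpha >= 2] because centering makes the mean itself small. Every comparison leaves a power of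
    [n] to spare, so one fixed trace moment is enough and the count of walks may be as crude as a
    factorial.

    Measurability is the second obstacle: only the entries and the values of [eta] on Borel sets are
    given as measurable. The ordered eigenvalues and the continuous functionals of the point
    processes have to be shown measurable, the latter as limits of functions of finitely many
    counts. *)

Definition sqnorm (R : pzRingType) (n : nat) (u : 'rV[R]_n) : R := (u *m u^T) 0 0.

Lemma sqnormE (R : pzRingType) (n : nat) (u : 'rV[R]_n) :
  sqnorm u = \sum_i u 0 i ^+ 2.
Proof. by rewrite /sqnorm mxE; apply: eq_bigr => i _; rewrite mxE expr2. Qed.

Lemma sqnorm_ge0 (R : realDomainType) (n : nat) (u : 'rV[R]_n) : 0 <= sqnorm u.
Proof. by rewrite sqnormE sumr_ge0 // => i _; rewrite sqr_ge0. Qed.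

Lemma sqnorm_eq0 (R : realDomainType) (n : nat) (u : 'rV[R]_n) :
  (sqnorm u == 0) = (u == 0).
Proof.
rewrite sqnormE psumr_eq0 => [|i _]; last exact: sqr_ge0.
apply/allP/eqP => [u0|-> i _]; last by rewrite mxE expr0n eqxx.
apply/rowP => i; rewrite mxE; apply/eqP.
by have := u0 i (mem_index_enum i); rewrite sqrf_eq0.
Qed.

Lemma mulmx_trmx_swap (R : comPzRingType) (n : nat) (u v : 'rV[R]_n) :
  (u *m v^T) 0 0 = (v *m u^T) 0 0.
Proof. by rewrite !mxE; apply: eq_bigr => i _; rewrite !mxE mulrC. Qed.

Lemma sqnorm_orthogonal (R : comPzRingType) (m n : nat) (U : 'M[R]_(m, n))
    (u : 'rV[R]_m) : U *m U^T = 1%:M -> sqnorm (u *m U) = sqnorm u.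
Proof. by move=> UU; rewrite /sqnorm trmx_mul mulmxA -(mulmxA u) UU mulmx1. Qed.

(** The Householder reflection along [w = u - e_0] is symmetric, squares to the identity and
    exchanges [e_0] with [u]; if [u] is already [e_0], the identity serves. *)
Lemma exists_orthogonal_row (R : rcfType) (n : nat) (u : 'rV[R]_n.+1) :
  sqnorm u = 1 -> exists2 Q : 'M[R]_n.+1, Q *m Q^T = 1%:M & row 0 Q = u.
Proof.
move=> u1; pose w := u - delta_mx 0 0.
have [w0|w_neq0] := eqVneq w 0.
  exists 1%:M; rewrite ?mulmx1 ?trmx1 ?mulmx1 // row1.
  by apply/esym/eqP; rewrite -subr_eq0 -/w w0.
have ww_neq0 : sqnorm w != 0 by rewrite sqnorm_eq0.
pose c := 2 / sqnorm w; pose Q : 'M[R]_n.+1 := 1%:M - c *: (w^T *m w).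
have QT : Q^T = Q by rewrite linearB /= trmx1 linearZ /= trmx_mul trmxK.
have wwww : w^T *m w *m (w^T *m w) = sqnorm w *: (w^T *m w).
  by rewrite mulmxA -(mulmxA w^T) [w *m w^T]mx11_scalar mul_mx_scalar -scalemxAl.
exists Q.
  rewrite QT /Q mulmxBr mulmx1 mulmxBl mul1mx -scalemxAl -scalemxAr wwww.
  rewrite !scalerA opprB.
  have -> : c * c * sqnorm w = c + c by rewrite /c; field.
  rewrite scalerDl; move: (c *: _) => X.
  by rewrite addrK subrK.
have e_w : (delta_mx 0 0 *m w^T : 'M[R]_1) 0 0 = u 0 0 - 1.
  by rewrite -rowE !mxE eqxx.
have ww : sqnorm w = 2 * (1 - u 0 0).
  move: u1; rewrite !sqnormE !big_ord_recl !mxE eqxx mulr1n => u1.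
  rewrite (eq_bigr (fun i => u 0 (lift ord0 i) ^+ 2)) => [|i _]; last first.
    by rewrite !mxE mulr0n subr0.
  by move: u1; move: (\sum_(i < n) _) => S u1; lra.
rewrite rowE mulmxBr mulmx1 -scalemxAr mulmxA.
rewrite [delta_mx 0 0 *m w^T]mx11_scalar e_w mul_scalar_mx scalerA.
have -> : c * (u 0 0 - 1) = -1.
  rewrite /c ww; move: ww_neq0; rewrite ww => h.
  by field; move: h; rewrite mulf_eq0 negb_or => /andP[].
by rewrite scaleN1r opprK /w addrC subrK.
Qed.

Lemma char_poly_conj_orthogonal (R : comNzRingType) (n : nat) (Q M : 'M[R]_n) :
  Q *m Q^T = 1%:M -> char_poly (Q *m M *m Q^T) = char_poly M.
Proof.
move=> QQ; rewrite /char_poly.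
pose Qp := map_mx polyC Q.
have QpQp : Qp *m Qp^T = 1%:M by rewrite map_trmx -map_mxM QQ map_mx1.
have -> : char_poly_mx (Q *m M *m Q^T) = Qp *m char_poly_mx M *m Qp^T.
  rewrite /char_poly_mx mulmxBr mulmxBl !map_mxM -map_trmx -/Qp.
  by rewrite scalar_mxC -(mulmxA 'X%:M) QpQp mulmx1.
by rewrite !det_mulmx mulrAC -det_mulmx QpQp det1 mul1r.
Qed.

(** Deflation: a unit eigenvector for [lam 0] is completed to an orthogonal basis, which splits off
    a block of size 1. The characteristic polynomial is given in split form, so the real eigenvalues
    come for free and the diagonal keeps the order of [lam]. *)
Lemma symmetric_diagonalization (R : rcfType) (n : nat) (M : 'M[R]_n)
    (lam : 'I_n -> R) : M^T = M ->
    char_poly M = \prod_(i < n) ('X - (lam i)%:P) ->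
  exists2 U : 'M[R]_n, U *m U^T = 1%:M & U *m M *m U^T = diag_mx (\row_i lam i).
Proof.
elim: n M lam => [|n IHn] M lam MT charM.
  by exists 1%:M; apply/matrixP => -[].
have /eigenvalueP[v vM v0] : eigenvalue M (lam 0).
  by rewrite eigenvalue_root_char charM rootE horner_prod big_ord_recl !hornerE
             subrr mul0r.
pose u := (Num.sqrt (sqnorm v))^-1 *: v.
have sv_gt0 : 0 < sqnorm v by rewrite lt_def sqnorm_eq0 v0 sqnorm_ge0.
have u1 : sqnorm u = 1.
  rewrite /sqnorm linearZ /= -scalemxAl -scalemxAr scalerA mxE -/(sqnorm v).
  rewrite -invfM -expr2 sqr_sqrtr ?ltW // mulVf //.
  by rewrite gt_eqF.
have uM : u *m M = lam 0 *: u by rewrite -scalemxAl vM !scalerA mulrC.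
have [Q QQ Q0] := exists_orthogonal_row u1.
have [M1 M1def] : exists M1, M1 = Q *m M *m Q^T by eexists.
have M1T : M1^T = M1 by rewrite M1def !trmx_mul trmxK MT mulmxA.
have row0 : row 0 M1 = lam 0 *: delta_mx 0 0.
  by rewrite M1def !row_mul Q0 uM -scalemxAl -Q0 -row_mul QQ row1.
have M1_0 (i : 'I_n.+1) : M1 0 i = lam 0 *+ (i == 0).
  by have /rowP/(_ i) := row0; rewrite !mxE eqxx /= mulr_natr.
have ls0 (i : 'I_1) : lshift n i = 0 :> 'I_n.+1 by rewrite ord1; apply: val_inj.
pose M2 : 'M[R]_n := \matrix_(i, j) M1 (lift 0 i) (lift 0 j).
have M1E : M1 = block_mx (lam 0)%:M 0 0 M2 :> 'M[R]_(1 + n).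
  apply/matrixP => i j; rewrite !mxE.
  case: (@split_ordP 1 n i) => i' ->; rewrite !mxE; case: (@split_ordP 1 n j) => j' ->; rewrite !mxE.
  - by rewrite !ls0 M1_0 !ord1.
  - by rewrite ls0 M1_0.
  - by rewrite -M1T mxE ls0 M1_0.
  - by rewrite !rshift1.
have M2T : M2^T = M2 by apply/matrixP => i j; rewrite !mxE -{1}M1T mxE.
have charM2 : char_poly M2 = \prod_(i < n) ('X - (lam (lift 0 i))%:P).
  have nz : 'X - (lam 0)%:P != 0 by rewrite polyXsubC_eq0.
  apply: (mulfI nz); have := charM; rewrite big_ord_recl => <-.
  rewrite -(char_poly_conj_orthogonal M QQ) -M1def M1E.
  suff -> : @char_poly R (1 + n) (block_mx (lam 0)%:M 0 0 M2) =
      ('X - (lam 0)%:P) * char_poly M2 by [].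
  rewrite {1}/char_poly char_block_diag_mx det_ublock -/(char_poly M2).
  by rewrite /char_poly_mx map_scalar_mx -raddfB /= det_scalar1.
have [U UU UM] := IHn M2 _ M2T charM2.
pose V : 'M[R]_(1 + n) := block_mx 1%:M 0 0 U.
have VT : V^T = block_mx 1%:M 0 0 U^T by rewrite tr_block_mx trmx1 !trmx0.
have VV : V *m V^T = 1%:M.
  by rewrite VT mulmx_block !(mulmx0, mul0mx, addr0, add0r, mulmx1) UU scalar_mx_block.
exists (V *m Q : 'M[R]_n.+1).
  by rewrite trmx_mul mulmxA -(mulmxA V) QQ mulmx1 VV.
have VM1 : V *m block_mx (lam 0)%:M 0 0 M2 *m V^T =
    block_mx (lam 0)%:M 0 0 (diag_mx (\row_i lam (lift 0 i))).
  rewrite VT !mulmx_block !(mulmx0, mul0mx, addr0, add0r, mulmx1, mul1mx).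
  by rewrite UM.
rewrite trmx_mul !mulmxA -(mulmxA V) -(mulmxA V) -M1def M1E.
transitivity (block_mx (lam 0)%:M 0 0 (diag_mx (\row_i lam (lift 0 i))) : 'M[R]_(1 + n)).
  exact: VM1.
apply/matrixP => i j; rewrite !mxE.
case: (@split_ordP 1 n i) => i' ->; rewrite !mxE;
  case: (@split_ordP 1 n j) => j' ->; rewrite !mxE.
- by rewrite -[lshift n i' == _]val_eqE ls0 !ord1.
- by rewrite -[lshift n i' == _]val_eqE !ord1.
- by rewrite -[rshift 1 i' == _]val_eqE !ord1.
- by rewrite -[rshift 1 i' == _]val_eqE /= eqn_add2l !rshift1.
Qed.

(** With [d] the inner product, the squared norm of [sqnorm v *: u - d *: v] expands to [sqnorm v]
    times the difference of the two sides. *)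
Lemma Cauchy_Schwarz_rV (R : realFieldType) (n : nat) (u v : 'rV[R]_n) :
  ((u *m v^T) 0 0) ^+ 2 <= sqnorm u * sqnorm v.
Proof.
have [->|v0] := eqVneq v 0.
  by rewrite /sqnorm trmx0 !mulmx0 !mxE expr0n /= mulr0.
have vv : 0 < sqnorm v by rewrite lt_def sqnorm_eq0 v0 sqnorm_ge0.
rewrite -subr_ge0 -(pmulr_rge0 _ vv).
set d := (u *m v^T) 0 0.
suff -> : sqnorm v * (sqnorm u * sqnorm v - d ^+ 2) =
    sqnorm (sqnorm v *: u - d *: v) by exact: sqnorm_ge0.
transitivity (sqnorm v ^+ 2 * sqnorm u + d ^+ 2 * sqnorm v - 2 * sqnorm v * d * d).
  by ring.
have dE : d = \sum_i u 0 i * v 0 i.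
  by rewrite /d mxE; apply: eq_bigr => i _; rewrite mxE.
rewrite [X in _ - _ * X]dE [sqnorm (_ - _)]sqnormE [sqnorm u in LHS]sqnormE.
rewrite [X in _ + _ * X - _]sqnormE !mulr_sumr -big_split -sumrB /=.
by apply: eq_bigr => i _; rewrite !mxE; ring.
Qed.

Lemma sqnormD_le (R : rcfType) (n : nat) (u v : 'rV[R]_n) (a b : R) :
  0 <= a -> 0 <= b -> sqnorm u <= a ^+ 2 -> sqnorm v <= b ^+ 2 ->
  sqnorm (u + v) <= (a + b) ^+ 2.
Proof.
move=> a0 b0 ua vb.
have uv : (u *m v^T) 0 0 <= a * b.
  apply: le_trans (ler_norm _) _.
  rewrite -(@ler_pXn2r _ 2) ?nnegrE ?mulr_ge0 // real_normK ?num_real //.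
  apply: le_trans (Cauchy_Schwarz_rV u v) _.
  by rewrite exprMn ler_pM ?sqnorm_ge0.
have -> : sqnorm (u + v) = sqnorm u + 2 * (u *m v^T) 0 0 + sqnorm v.
  rewrite /sqnorm linearD /= mulmxDr !mulmxDl mxE [X in X + _]mxE [X in _ + X]mxE.
  by rewrite (mulmx_trmx_swap v u); ring.
by rewrite sqrrD -mulr_natl; nra.
Qed.

(** A dimension count: [#|J|] linear conditions on [#|I|] free coordinates leave a nonzero solution.
    For [U] an eigenbasis this is the intersection of subspaces behind the min-max principle. *)
Lemma exists_supported_rV (F : fieldType) (n : nat) (U : 'M[F]_n)
    (I J : {set 'I_n}) : (#|J| < #|I|)%N ->
  exists v : 'rV[F]_n, [/\ v != 0, forall i, i \notin I -> v 0 i = 0 &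
    forall l, l \in J -> (v *m U^T) 0 l = 0].
Proof.
move=> JI.
pose E : 'M[F]_(#|I|, n) := \matrix_(k, i) (enum_val k == i)%:R.
pose D : 'M[F]_(#|I|, #|J|) := \matrix_(k, l) (E *m U^T) k (enum_val l).
have : kermx D != 0.
  rewrite -mxrank_eq0 mxrank_ker -lt0n subn_gt0.
  exact: leq_ltn_trans (rank_leq_col _) JI.
case/rowV0Pn => c /sub_kermxP cD c0.
exists (c *m E); split.
- apply: contra_neq c0 => cE; apply/rowP => k; rewrite mxE.
  have /rowP/(_ (enum_val k)) := cE; rewrite !mxE (bigD1 k) //= mxE eqxx mulr1.
  rewrite big1 ?addr0 // => k' k'k; rewrite mxE; case: eqP => [/enum_val_inj e|_].
    by rewrite e eqxx in k'k.
  by rewrite mulr0.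
- move=> i iI; rewrite mxE big1 // => k _; rewrite mxE; case: eqP => [e|_].
    by move: iI; rewrite -e enum_valP.
  by rewrite mulr0.
- move=> l lJ; rewrite -mulmxA.
  have /rowP/(_ (enum_rank_in lJ l)) := cD.
  rewrite mxE [in RHS]mxE => <-; rewrite mxE.
  by apply: eq_bigr => k _; rewrite [D _ _]mxE enum_rankK_in.
Qed.

Section EigenvalueCounting.
Variables (R : rcfType) (n : nat) (M : 'M[R]_n) (lam : 'I_n -> R).
Hypotheses (MT : M^T = M) (charM : char_poly M = \prod_(i < n) ('X - (lam i)%:P)).

Lemma quadratic_form_diagonal : exists2 U : 'M[R]_n,
  (forall v : 'rV_n, sqnorm v = \sum_i (v *m U^T) 0 i ^+ 2) &
  (forall v : 'rV_n, (v *m M *m v^T) 0 0 = \sum_i lam i * (v *m U^T) 0 i ^+ 2).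
Proof.
have [U UU UM] := symmetric_diagonalization MT charM.
have UtU : U^T *m U = 1%:M by apply: mulmx1C.
exists U => v; rewrite -?sqnormE.
  by rewrite sqnorm_orthogonal // trmxK.
have -> : v *m M *m v^T = (v *m U^T) *m diag_mx (\row_i lam i) *m (v *m U^T)^T.
  rewrite -UM trmx_mul trmxK !mulmxA -[in RHS](mulmxA v) UtU mulmx1.
  by rewrite -[in RHS](mulmxA (v *m M)) UtU mulmx1.
rewrite mxE; apply: eq_bigr => i _.
by rewrite mul_mx_diag !mxE mulrAC mulrC -expr2.
Qed.

(** If fewer than [#|I|] eigenvalues exceeded [x], some nonzero vector supported in [I] would be
    orthogonal to all their eigenvectors, and the form would be at most [x] times its squared norm
    there. *)
Lemma card_eigenvalue_gt_ge (I : {set 'I_n}) (x : R) :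
  (forall v : 'rV[R]_n, v != 0 -> (forall i, i \notin I -> v 0 i = 0) ->
     x * sqnorm v < (v *m M *m v^T) 0 0) ->
  (#|I| <= #|[set i | (x < lam i)%R]%SET|)%N.
Proof.
move=> hI; rewrite leqNgt; apply/negP => lt_I.
have [U Us Uq] := quadratic_form_diagonal.
have [v [v0 vI vJ]] := exists_supported_rV U lt_I.
have := hI v v0 vI; rewrite ltNge => /negP; apply.
rewrite Us Uq mulr_sumr ler_sum // => i _.
have [xi|xi] := ltP x (lam i).
  by rewrite vJ ?inE // expr0n /= !mulr0.
by rewrite ler_wpM2r ?sqr_ge0.
Qed.

(** The dual count: otherwise the coordinates outside [I] outnumber the eigenvalues that are at most
    [x], so a nonzero vector supported outside [I] lies in the span of the eigenvectors above [x],
    where the form is strictly larger. *)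
Lemma card_eigenvalue_gt_le (I : {set 'I_n}) (x : R) :
  (forall v : 'rV[R]_n, (forall i, i \in I -> v 0 i = 0) ->
     (v *m M *m v^T) 0 0 <= x * sqnorm v) ->
  (#|[set i | (x < lam i)%R]%SET| <= #|I|)%N.
Proof.
move=> hI; rewrite leqNgt; apply/negP => lt_I.
have [U Us Uq] := quadratic_form_diagonal.
have lt_C : (#|~: [set i | (x < lam i)%R]%SET| < #|~: I|)%N.
  rewrite -(ltn_add2l #|I|) cardsC -(cardsC [set i | (x < lam i)%R]%SET).
  by rewrite ltn_add2r.
have [v [v0 vI vJ]] := exists_supported_rV U lt_C.
have : (v *m M *m v^T) 0 0 <= x * sqnorm v.
  by apply: hI => i iI; rewrite vI // inE iI.
apply/negP; rewrite -ltNge Us Uq mulr_sumr.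
have [l vl] : exists l, (v *m U^T) 0 l != 0.
  apply/existsP; rewrite -negb_forall; apply: contra v0 => /forallP h.
  rewrite -sqnorm_eq0 Us big1 // => i _; have /eqP -> := h i.
  by rewrite expr0n.
have term i : x * (v *m U^T) 0 i ^+ 2 <= lam i * (v *m U^T) 0 i ^+ 2.
  have [xi|xi] := ltP x (lam i); first by rewrite ler_wpM2r ?sqr_ge0 // ltW.
  by rewrite vJ ?expr0n ?mulr0 // !inE -leNgt.
rewrite (bigD1 l) //= [ltRHS](bigD1 l) //= ltr_leD ?ler_sum //.
rewrite ltr_pM2r; last by rewrite lt_def sqrf_eq0 vl sqr_ge0.
by apply: contraNT vl; rewrite -leNgt => xl; rewrite vJ // !inE -leNgt.
Qed.

End EigenvalueCounting.

(** * Matrices whose large entries share no row or column *)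

Section SparseLargeEntries.
Variables (R : rcfType) (n p : nat) (A : 'M[R]_(n, p)) (K : R).
Hypotheses (K0 : 0 <= K)
  (sparse : forall i j i' j', K < `|A i j| -> K < `|A i' j'| ->
     (i == i') || (j == j') -> (i, j) = (i', j')).

Definition large_part : 'M[R]_(n, p) :=
  \matrix_(i, j) (if K < `|A i j| then A i j else 0).

(** Sparsity leaves at most one nonzero entry in each column, so the rows of [large_part] are
    pairwise orthogonal and their Gram matrix is diagonal. *)
Lemma sqnorm_large_part (v : 'rV[R]_n) :
  sqnorm (v *m large_part) = \sum_i v 0 i ^+ 2 * \sum_j large_part i j ^+ 2.
Proof.
rewrite sqnormE.
transitivity (\sum_j \sum_i v 0 i ^+ 2 * large_part i j ^+ 2); last first.
  by rewrite exchange_big; apply: eq_bigr => i _; rewrite mulr_sumr.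
apply: eq_bigr => j _; rewrite mxE.
have [[i Ki]|noi] := altP (@existsP _ (fun i => K < `|A i j|)).
  have C0 k : k != i -> large_part k j = 0.
    move=> ki; rewrite mxE; case: ifP => // Kk; case/eqP: ki.
    by have [] := sparse Kk Ki (introT orP (or_intror (eqxx j))).
  rewrite (bigD1 i) //= big1 => [|k ki]; last by rewrite C0 ?mulr0.
  rewrite addr0 [RHS](bigD1 i) //= big1 => [|k ki]; last first.
    by rewrite C0 // expr0n mulr0.
  by rewrite addr0 exprMn.
have C0 k : large_part k j = 0.
  by rewrite mxE ifN //; apply: contra noi => h; apply/existsP; exists k.
rewrite !big1 ?expr0n // => k _; first by rewrite C0 expr0n mulr0.
by rewrite C0 mulr0.
Qed.

Variables (y : R).
Hypothesis Ky : K <= y.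

Let rows : {set 'I_n} := [set i | [exists j, y < `|A i j|]]%SET.

Lemma card_large_rows :
  #|rows| = #|[set ij : 'I_n * 'I_p | y < `|A ij.1 ij.2|]%SET|.
Proof.
have -> : rows = [set ij.1 | ij in [set ij : 'I_n * 'I_p | y < `|A ij.1 ij.2|]]%SET.
  apply/setP => i; rewrite inE; apply/existsP/imsetP => [[j yj]|[[i' j] + ->]].
    by exists (i, j); rewrite ?inE.
  by rewrite inE /= => ?; exists j.
apply: card_in_imset => -[i j] [i2 j2]; rewrite !inE /= => h h2 e.
by apply: sparse; rewrite ?(le_lt_trans Ky h) ?(le_lt_trans Ky h2) // e eqxx.
Qed.

Lemma large_part_row_gt (i : 'I_n) : i \in rows ->
  y ^+ 2 < \sum_j large_part i j ^+ 2.
Proof.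
rewrite inE => /existsP[j yj].
rewrite (bigD1 j) //= ltr_wpDr ?sumr_ge0 // => [k _|]; first exact: sqr_ge0.
rewrite mxE (le_lt_trans Ky yj) -[ltRHS]real_normK ?num_real //.
by rewrite ltr_pXn2r ?nnegrE // (le_trans K0).
Qed.

(** By sparsity a row holds at most one entry of modulus above [K], so the sum reduces to a single
    square or to 0. *)
Lemma large_part_row_le (i : 'I_n) : i \notin rows ->
  \sum_j large_part i j ^+ 2 <= y ^+ 2.
Proof.
rewrite inE => /existsPn no.
have [[j Kj]|noj] := altP (@existsP _ (fun j => K < `|A i j|)).
  rewrite (bigD1 j) //= big1 ?addr0 => [|k kj]; last first.
    rewrite mxE; case: ifP => [Kk|_]; last by rewrite expr0n.
    by case/eqP: kj; have [] := sparse Kk Kj (introT orP (or_introl (eqxx i))).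
  rewrite mxE Kj -[leLHS]real_normK ?num_real //.
  by rewrite ler_pXn2r ?nnegrE // ?(le_trans K0) // leNgt.
rewrite big1 ?sqr_ge0 // => k _; rewrite mxE ifN ?expr0n //.
by apply: contra noj => h; apply/existsP; exists k.
Qed.

Variables (rho : R) (lam : 'I_n -> R).
Hypotheses (rho0 : 0 <= rho)
  (small : forall v : 'rV[R]_n,
     sqnorm (v *m (A - large_part)) <= rho ^+ 2 * sqnorm v)
  (charA : char_poly (A *m A^T) = \prod_(i < n) ('X - (lam i)%:P)).

Let ASym : (A *m A^T)^T = A *m A^T.
Proof. by rewrite trmx_mul trmxK. Qed.

Let quadA (v : 'rV[R]_n) : (v *m (A *m A^T) *m v^T) 0 0 = sqnorm (v *m A).
Proof. by rewrite /sqnorm trmx_mul !mulmxA. Qed.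

Let small' (v : 'rV[R]_n) :
  sqnorm (v *m (A - large_part)) <= (rho * Num.sqrt (sqnorm v)) ^+ 2.
Proof. by rewrite exprMn sqr_sqrtr ?sqnorm_ge0. Qed.

(** A vector vanishing on [rows] is stretched by at most [y] under the large part and by at most
    [rho] under the remainder; sparsity makes [rows] as numerous as the large entries. *)
Lemma card_eigenvalue_le_large :
  (#|[set i | ((y + rho) ^+ 2 < lam i)%R]%SET| <=
   #|[set ij : 'I_n * 'I_p | (y < `|A ij.1 ij.2|)%R]%SET|)%N.
Proof.
rewrite -card_large_rows; apply: (card_eigenvalue_gt_le ASym charA) => v v0.
have y0 : 0 <= y by apply: le_trans Ky.
rewrite quadA -(sqr_sqrtr (sqnorm_ge0 v)) -exprMn mulrDl.
rewrite -[A in leLHS](subrK large_part) addrC mulmxDr.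
apply: sqnormD_le; rewrite ?mulr_ge0 ?sqrtr_ge0 //.
rewrite exprMn sqr_sqrtr ?sqnorm_ge0 // sqnorm_large_part [in leRHS]sqnormE mulr_sumr.
apply: ler_sum => i _; rewrite mulrC.
have [/v0 ->|/large_part_row_le h] := boolP (i \in rows).
  by rewrite expr0n /= !mulr0.
by rewrite ler_wpM2r ?sqr_ge0.
Qed.

(** On vectors supported in [rows] the large part stretches by more than [y], and the remainder
    takes back at most [rho]. The triangle inequality is applied to
    [large_part = A + (large_part - A)], with [y - rho] as a nonnegative bound for the first
    term. *)
Lemma card_large_le_eigenvalue : rho <= y ->
  (#|[set ij : 'I_n * 'I_p | (y < `|A ij.1 ij.2|)%R]%SET| <=
   #|[set i | ((y - rho) ^+ 2 < lam i)%R]%SET|)%N.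
Proof.
move=> rho_y; rewrite -card_large_rows.
apply: (card_eigenvalue_gt_ge ASym charA) => v v0 vI.
have y0 : 0 <= y by apply: le_trans Ky.
rewrite quadA ltNge; apply/negP => h.
set s := Num.sqrt (sqnorm v).
have h' : sqnorm (v *m A) <= ((y - rho) * s) ^+ 2.
  by rewrite exprMn sqr_sqrtr ?sqnorm_ge0.
have hC : sqnorm (v *m large_part) <= (y * s) ^+ 2.
  have -> : y * s = (y - rho) * s + rho * s by rewrite -mulrDl subrK.
  have -> : large_part = A + (large_part - A) by rewrite addrC subrK.
  rewrite mulmxDr; apply: sqnormD_le;
    rewrite ?mulr_ge0 ?sqrtr_ge0 ?subr_ge0 //.
  rewrite -opprB mulmxN /sqnorm linearN /= mulNmx mulmxN opprK.
  exact: small'.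
move: hC; apply/negP; rewrite -ltNge exprMn sqr_sqrtr ?sqnorm_ge0 //.
rewrite sqnorm_large_part [in ltLHS]sqnormE mulr_sumr.
have term i : y ^+ 2 * v 0 i ^+ 2 <= v 0 i ^+ 2 * \sum_j large_part i j ^+ 2.
  rewrite mulrC; have [iI|/vI ->] := boolP (i \in rows).
    by rewrite ler_wpM2l ?sqr_ge0 // ltW // large_part_row_gt.
  by rewrite expr0n /= !mul0r.
have [l vl] : exists l, v 0 l != 0.
  apply/existsP; rewrite -negb_forall; apply: contra v0 => /forallP h0.
  by apply/eqP/rowP => i; rewrite mxE; apply/eqP.
rewrite (bigD1 l) //= [ltRHS](bigD1 l) //= ltr_leD ?ler_sum //.
rewrite mulrC ltr_pM2l; last by rewrite lt_def sqrf_eq0 vl sqr_ge0.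
apply: large_part_row_gt; by apply: contraNT vl => /vI ->.
Qed.

End SparseLargeEntries.

(** * Traces of powers and walks *)

(** The Frobenius norm dominates the operator norm, by Cauchy-Schwarz on each column. *)
Lemma sqnorm_mulmx_le_trace (R : realFieldType) (n m : nat) (u : 'rV[R]_n)
    (G : 'M[R]_(n, m)) : sqnorm (u *m G) <= sqnorm u * \tr (G *m G^T).
Proof.
rewrite sqnormE mxtrace_mulC /mxtrace mulr_sumr; apply: ler_sum => j _.
have -> : (u *m G) 0 j = (u *m (row j G^T)^T) 0 0.
  by rewrite !mxE; apply: eq_bigr => i _; rewrite !mxE.
apply: le_trans (Cauchy_Schwarz_rV _ _) _.
rewrite ler_wpM2l ?sqnorm_ge0 // sqnormE mxE le_eqVlt; apply/orP; left.
by apply/eqP/eq_bigr => i _; rewrite !mxE expr2.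
Qed.

(** Repeated squaring: [sqnorm (u *m H)] is the inner product of [u] with [u *m H ^+ 2], so
    Cauchy-Schwarz passes from [H] to [H ^+ 2]. Trace moments are reached without a spectral
    decomposition, at the price of exponents that are powers of two. *)
Lemma sqnorm_mulmx_exp_le (R : realFieldType) (n m : nat) (u : 'rV[R]_n)
    (H : 'M[R]_n) : H^T = H ->
  sqnorm (u *m H) ^+ (2 ^ m) <= sqnorm u ^+ (2 ^ m) * \tr (H ^+ (2 ^ m.+1)).
Proof.
elim: m H => [|m IHm] H HT.
  by have := sqnorm_mulmx_le_trace u H; rewrite HT expn0 expn1 !expr1 expr2.
have H2E : H ^+ 2 = H *m H by rewrite expr2.
have H2T : (H ^+ 2)^T = H ^+ 2 by rewrite H2E trmx_mul HT.
have uH : sqnorm (u *m H) = (u *m (u *m H ^+ 2)^T) 0 0.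
  by rewrite trmx_mul H2T H2E /sqnorm trmx_mul HT !mulmxA.
rewrite expnS exprM.
have le2 : sqnorm (u *m H) ^+ 2 <= sqnorm u * sqnorm (u *m H ^+ 2).
  by rewrite uH Cauchy_Schwarz_rV.
apply: (le_trans (lerXn2r (2 ^ m) _ _ le2)); rewrite ?nnegrE ?exprn_ge0 ?mulr_ge0 ?sqnorm_ge0 //.
rewrite exprMn mul2n -addnn exprD -mulrA ler_wpM2l ?exprn_ge0 ?sqnorm_ge0 //.
by apply: le_trans (IHm _ H2T) _; rewrite -exprM -expnS.
Qed.

Section Walks.
Variables (R : realFieldType) (V : finType).

Fixpoint walks (l : nat) : seq (seq V) :=
  if l is l'.+1 then [seq x :: s | x <- enum V, s <- walks l'] else [:: [::]].

Fixpoint walk_weight (h : V -> V -> R) (x : V) (s : seq V) : R :=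
  if s is y :: s' then h x y * walk_weight h y s' else 1.

Lemma size_walks (l : nat) (s : seq V) : s \in walks l -> size s = l.
Proof.
elim: l s => [|l IHl] s /=; first by rewrite inE => /eqP ->.
by case/allpairsP => -[x t] /= [_ /IHl <- ->].
Qed.

Lemma sum_walksS (l : nat) (F : seq V -> R) :
  \sum_(s <- walks l.+1) F s = \sum_x \sum_(s <- walks l) F (x :: s).
Proof. by rewrite /= big_allpairs_dep /= big_enum. Qed.

Variables (E : eqType) (ed : V -> V -> option E).

Definition walk_edges (x : V) (s : seq V) : seq (option E) := pairmap ed x s.

(** [None] stands for a pair of vertices without an edge, where the matrix entry is 0, so one
    missing edge kills the weight of the walk. *)
Lemma walk_weight_prod (X : E -> R) (x : V) (s : seq V) :
  walk_weight (fun x y => oapp X 0 (ed x y)) x s =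
  if None \in walk_edges x s then 0 else \prod_(e <- pmap id (walk_edges x s)) X e.
Proof.
elim: s x => [|y s IHs] x /=; first by rewrite big_nil.
rewrite inE IHs /walk_edges; case: (ed x y) => [e|] /=; last by rewrite mul0r.
by case: ifP => _; rewrite ?mulr0 // big_cons.
Qed.

Hypothesis ed_inj : forall x y z e, ed x z = Some e -> ed y z = Some e -> x = y.
Variable N : R.
Hypotheses (N0 : 0 < N) (VN : #|V|%:R <= N).

(* Prepending a vertex to a walk of length [l] either repeats one of at most [l]
   edges, or creates a new edge, and then one of at most [N] choices of the vertex
   is paid for by the factor [N^-1]. *)
Lemma sum_walks_distinct_edges (l : nat) :
  \sum_(s <- walks l) \sum_x
    (if None \in walk_edges x s then 0 else N^-1 ^+ size (undup (walk_edges x s)))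
  <= N * l`!%:R.
Proof.
elim: l => [|l IHl].
  rewrite /= big_seq1 /= sumr_const fact0 expr0 mulr1; exact: VN.
rewrite sum_walksS exchange_big /=.
rewrite factS natrM mulrCA -[leLHS]mulr1; apply: le_trans (_ : _ <= l.+1%:R *
   \sum_(s <- walks l) \sum_x
    (if None \in walk_edges x s then 0 else N^-1 ^+ size (undup (walk_edges x s)))) _; last first.
  by rewrite ler_wpM2l.
rewrite mulr1 mulr_sumr big_seq [leRHS]big_seq; apply: ler_sum => s /size_walks sl.
rewrite mulr_sumr; apply: ler_sum => y _.
set L := walk_edges y s.
have sizeL : size L = l by rewrite size_pairmap.
have [NL|NL] := boolP (None \in L).
  by rewrite mulr0 big1 // => x _; rewrite /= inE NL orbT.
set d := N^-1 ^+ size (undup L).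
have d0 : 0 <= d by rewrite exprn_ge0 // invr_ge0 ltW.
apply: (@le_trans _ _ (\sum_x (d * (((ed x y) \in L)%:R + N^-1)))).
  apply: ler_sum => x _; rewrite /= -/(walk_edges y s) -/L inE (negPf NL) orbF.
  case: ifP => [_|_]; first by rewrite mulr_ge0 // addr_ge0 ?ler0n // invr_ge0 ltW.
  case: ifP => _ /=; last by rewrite exprSr add0r.
  by rewrite -/d mulrDr mulr1 lerDl mulr_ge0 // invr_ge0 ltW.
rewrite -mulr_sumr mulrC ler_wpM2r // big_split /= sumr_const -natr_sum.
rewrite -[l.+1]addn1 natrD lerD //.
  have -> : (\sum_x (ed x y \in L))%N = #|[pred x | ed x y \in L]|.
    by rewrite -sum1_card [RHS]big_mkcond; apply: eq_bigr => x _; rewrite inE; case: ifP.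
  rewrite ler_nat -sizeL.
  pose f x := ed x y.
  have inj : {in [pred x | ed x y \in L] &, injective f}.
    move=> x z; rewrite !inE /f => xL zL; case xe: (ed x y) xL => [e|] xL ze.
      by apply: ed_inj xe _; rewrite -ze.
    by rewrite xL in NL.
  rewrite cardE -(size_map f); apply: uniq_leq_size.
    rewrite map_inj_in_uniq ?enum_uniq // => x z.
    by rewrite !mem_enum; exact: inj.
  by move=> e /mapP[x + ->]; rewrite mem_enum inE.
by rewrite -[N^-1 *+ _]mulr_natl ler_pdivrMr ?mul1r.
Qed.

End Walks.

Lemma exprmx_walks (R : realFieldType) (n l : nat) (H : 'M[R]_n) (i j : 'I_n) :
  (H ^+ l) i j =
  \sum_(s <- walks 'I_n l) walk_weight H i s * (last i s == j)%:R.
Proof.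
elim: l i => [|l IHl] i; first by rewrite /= big_seq1 mul1r expr0 mxE.
rewrite exprS sum_walksS [_ * _]/(_ *m _) mxE; apply: eq_bigr => x _.
by rewrite IHl mulr_sumr; apply: eq_bigr => s _; rewrite mulrA.
Qed.

Lemma mxtrace_walks (R : realFieldType) (n l : nat) (H : 'M[R]_n) :
  \tr (H ^+ l) =
  \sum_(s <- walks 'I_n l) \sum_i walk_weight H i s * (last i s == i)%:R.
Proof. by rewrite exchange_big; apply: eq_bigr => i _; rewrite exprmx_walks. Qed.

(** * Independence *)

Section BoundedMeasurable.
Context (d : measure_display) (T : measurableType d) (R : realType).

Definition bounded_measurable (f : T -> R) : Prop :=
  measurable_fun [set: T] f /\ exists C : R, forall x, `|f x| <= C.

Lemma measurable_set_le (f g : T -> R) :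
  measurable_fun [set: T] f -> measurable_fun [set: T] g ->
  measurable [set x | f x <= g x].
Proof.
by move=> mf mg; rewrite -[X in measurable X]setTI; exact: measurable_fun_le.
Qed.

Lemma measurable_set_lt (f g : T -> R) :
  measurable_fun [set: T] f -> measurable_fun [set: T] g ->
  measurable [set x | f x < g x].
Proof.
move=> mf mg; rewrite (_ : [set x | _] = ~` [set x | g x <= f x]).
  by apply: measurableC; exact: measurable_set_le.
by apply/seteqP; split=> x /=; rewrite ltNge; move/negP.
Qed.

Lemma bounded_measurable_cst (c : R) : bounded_measurable (fun=> c).
Proof. by split; [exact: measurable_cst|exists `|c|]. Qed.

Lemma bounded_measurableD (f g : T -> R) :
  bounded_measurable f -> bounded_measurable g ->
  bounded_measurable (fun x => f x + g x).
Proof.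
move=> [mf [C fC]] [mg [D gD]]; split; first exact: measurable_funD.
by exists (C + D) => x; rewrite (le_trans (ler_normD _ _)) // lerD.
Qed.

Lemma bounded_measurableM (f g : T -> R) :
  bounded_measurable f -> bounded_measurable g ->
  bounded_measurable (fun x => f x * g x).
Proof.
move=> [mf [C fC]] [mg [D gD]]; split; first exact: measurable_funM.
by exists (C * D) => x; rewrite normrM ler_pM.
Qed.

Lemma bounded_measurable_indic (A : set T) : measurable A ->
  bounded_measurable (\1_A).
Proof.
move=> mA; split; first exact: measurable_indic.
by exists 1 => x; rewrite indicE; case: (_ \in _); rewrite ?normr1 ?normr0.
Qed.

Lemma bounded_measurable_sum (I : Type) (r : seq I) (f : I -> T -> R) :
  (forall i, bounded_measurable (f i)) ->
  bounded_measurable (fun x => \sum_(i <- r) f i x).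
Proof.
move=> bf; elim: r => [|i r IHr].
  by under eq_fun do rewrite big_nil; exact: bounded_measurable_cst.
by under eq_fun do rewrite big_cons; exact: bounded_measurableD.
Qed.

Lemma bounded_measurable_prod (I : Type) (r : seq I) (Q : pred I) (f : I -> T -> R) :
  (forall i, bounded_measurable (f i)) ->
  bounded_measurable (fun x => \prod_(i <- r | Q i) f i x).
Proof.
move=> bf; elim: r => [|i r IHr].
  by under eq_fun do rewrite big_nil; exact: bounded_measurable_cst.
under eq_fun do rewrite big_cons; case: (Q i) => //.
exact: bounded_measurableM.
Qed.

Variable P : probability T R.

Lemma bounded_measurable_integrable (f : T -> R) :
  bounded_measurable f -> P.-integrable [set: T] (EFin \o f).
Proof.
move=> [mf [C fC]]; apply: measurable_bounded_integrable => //.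
  by rewrite [ltLHS](probability_setT P) ltry.
by exists C; split; rewrite ?num_real // => M CM x _ /=; rewrite (le_trans (fC x)) // ltW.
Qed.

Hint Resolve bounded_measurable_integrable : core.

Lemma integral_bmD (f g : T -> R) :
  bounded_measurable f -> bounded_measurable g ->
  \int[P]_x (f x + g x) = \int[P]_x f x + \int[P]_x g x.
Proof. by move=> bf bg; rewrite RintegralD //; auto. Qed.

Lemma integral_bmZ (c : R) (f : T -> R) :
  bounded_measurable f -> \int[P]_x (c * f x) = c * \int[P]_x f x.
Proof. by move=> bf; rewrite RintegralZl //; auto. Qed.

Lemma integral_bm_sum (I : Type) (r : seq I) (f : I -> T -> R) :
  (forall i, bounded_measurable (f i)) ->
  \int[P]_x (\sum_(i <- r) f i x) = \sum_(i <- r) \int[P]_x f i x.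
Proof.
move=> bf; elim: r => [|i r IHr].
  rewrite big_nil; under eq_Rintegral do rewrite big_nil.
  by rewrite Rintegral_cst // mul0r.
rewrite big_cons -IHr -integral_bmD //; last exact: bounded_measurable_sum.
by apply: eq_Rintegral => x _; rewrite big_cons.
Qed.

Lemma integral_bm_indic (A : set T) : measurable A ->
  \int[P]_x \1_A x = fine (P A).
Proof. by move=> mA; rewrite /Rintegral integral_indic // setIT. Qed.

Lemma integral_bm_cst (c : R) : \int[P]_x c = c.
Proof. by rewrite Rintegral_cst // [X in fine X](probability_setT P) mulr1. Qed.

Lemma le_integral_bm (f g : T -> R) :
  bounded_measurable f -> bounded_measurable g -> (forall x, f x <= g x) ->
  \int[P]_x f x <= \int[P]_x g x.
Proof. by move=> bf bg fg; apply: le_Rintegral; auto. Qed.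

Lemma norm_integral_bm_le (f : T -> R) (C : R) : bounded_measurable f ->
  (forall x, `|f x| <= C) -> `|\int[P]_x f x| <= C.
Proof.
move=> bf fC; rewrite ler_norml.
rewrite -[X in X <= _]integral_bm_cst -[X in _ && (_ <= X)]integral_bm_cst.
by apply/andP; split; apply: le_integral_bm => //;
  try exact: bounded_measurable_cst;
  move=> x; have := fC x; rewrite ler_norml => /andP[].
Qed.

Lemma Markov_bm (f : T -> R) (t : R) : bounded_measurable f ->
  (forall x, 0 <= f x) -> 0 < t ->
  fine (P [set x | t <= f x]) <= t^-1 * \int[P]_x f x.
Proof.
move=> bf f0 t0; rewrite ler_pdivlMl //.
have mA : measurable [set x | t <= f x].
  by apply: measurable_set_le; [exact: measurable_cst|case: bf].
rewrite -integral_bm_indic // -integral_bmZ; last exact: bounded_measurable_indic.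
apply: le_integral_bm => //.
  apply: bounded_measurableM; [exact: bounded_measurable_cst|].
  exact: bounded_measurable_indic.
move=> x; rewrite indicE; have [/set_mem /= h|_] := boolP (x \in _).
  by rewrite mulr1.
by rewrite mulr0.
Qed.

End BoundedMeasurable.

Lemma eq0_le_div (R : archiRealFieldType) (z D : R) :
  (forall m : nat, `|z| <= D / m.+1%:R) -> z = 0.
Proof.
move=> h; apply/eqP; rewrite -normr_le0 leNgt; apply/negP => z0.
pose m := Num.truncn (D / `|z|); have := h m; apply/negP; rewrite -ltNge.
rewrite ltr_pdivrMr ?ltr0n // mulrC -ltr_pdivrMr //.
exact: Num.Theory.truncnS_gt.
Qed.

Section SimpleApproximation.
Context (d : measure_display) (U : measurableType d) (R : realType).

Lemma exists_simple_approx (phi : U -> R) (m : nat) : bounded_measurable phi ->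
  exists (M : nat) (v : 'I_M -> R) (B : 'I_M -> set U),
    (forall k, measurable (B k)) /\
    forall x, `|phi x - \sum_(k < M) v k * \1_(B k) x| <= 1 / m.+1%:R.
Proof.
move=> [mphi [C phiC]].
pose c : nat := (Num.truncn C).+1.
have phic x : `|phi x| < c%:R by apply: le_lt_trans (phiC x) _; exact: truncnS_gt.
(* Shifted by [c], [phi] is nonnegative and is rounded down to a multiple of [1 / m.+1]; the range
   from [- c] to [c] accounts for the number of levels. *)
exists (2 * c * m.+1)%N, (fun k => k%:R / m.+1%:R - c%:R).
exists (fun k => [set x | Num.truncn ((phi x + c%:R) * m.+1%:R) = k]); split.
  move=> k.
  have mpsi : measurable_fun setT (fun x => (phi x + c%:R) * m.+1%:R).
    by apply: measurable_funM => //; apply: measurable_funD.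
  rewrite (_ : [set x | _] = [set x | k%:R <= (phi x + c%:R) * m.+1%:R] `&`
    [set x | (phi x + c%:R) * m.+1%:R < k.+1%:R]).
    by apply: measurableI; [apply: measurable_set_le|apply: measurable_set_lt].
  apply/seteqP; split=> x /=; have := phic x; rewrite ltr_norml => /andP[p1 p2].
    have z0 : 0 <= (phi x + c%:R) * m.+1%:R by rewrite mulr_ge0 //; lra.
    by move=> <-; split; have /andP[] := truncn_itv z0.
  move=> [h1 h2]; apply: truncn_def; by rewrite h1 h2.
move=> x; have := phic x; rewrite ltr_norml => /andP[p1 p2].
have m0 : 0 < m.+1%:R :> R by rewrite ltr0n.
set z := (phi x + c%:R) * m.+1%:R.
have z0 : 0 <= z by rewrite mulr_ge0 //; lra.
have /andP[z1 z2] := truncn_itv z0.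
have kM : (Num.truncn z < 2 * c * m.+1)%N.
  rewrite -(ltr_nat R); apply: le_lt_trans z1 _.
  by rewrite !natrM ltr_pM2r //; lra.
rewrite (bigD1 (Ordinal kM)) //= big1 ?addr0 => [|k kz].
  rewrite indicE mem_set //= mulr1.
  have -> : phi x = z / m.+1%:R - c%:R by rewrite mulfK ?addrK // gt_eqF.
  rewrite opprB addrA subrK -mulrBl ger0_norm; last by rewrite mulr_ge0 ?subr_ge0 // invr_ge0 ltW.
  by rewrite ler_pM2r ?invr_gt0 // lerBlDl -natr1 in z2 *; rewrite ltW // addrC.
rewrite indicE memNset ?mulr0 //= => e; case/eqP: kz; apply/val_inj => /=.
by rewrite -e.
Qed.

End SimpleApproximation.

Section Independence.
Context (R : realType) (d : measure_display) (T : measurableType d).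
Variable P : probability T R.

(** Both sides are linear in [phi], continuous for the uniform norm, and agree on indicators, hence
    on simple functions. A uniform approximation within [1 / m.+1] costs at most the bound on [Y]
    plus the modulus of [c], divided by [m.+1]. *)
Lemma integral_indep_step (d' : measure_display) (U : measurableType d') (X : T -> U) (Y : T -> R) (c : R) :
  measurable_fun [set: T] X -> bounded_measurable Y ->
  (forall B : set U, measurable B ->
     \int[P]_w (\1_B (X w) * Y w) = fine (P (X @^-1` B)) * c) ->
  forall phi : U -> R, bounded_measurable phi ->
  \int[P]_w (phi (X w) * Y w) = (\int[P]_w phi (X w)) * c.
Proof.
move=> mX bY hB phi bphi.
have bX (psi : U -> R) : bounded_measurable psi -> bounded_measurable (fun w => psi (X w)).
  by move=> [mpsi [C psiC]]; split; [exact: measurableT_comp|exists C].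
have [_ [CY hCY]] := bY.
apply/eqP; rewrite -subr_eq0; apply/eqP; apply: (@eq0_le_div _ _ (CY + `|c|)) => m.
have [M [v [B [mB hv]]]] := exists_simple_approx m bphi.
set s := (fun x => \sum_(k < M) v k * \1_(B k) x) in hv.
have bZ k : bounded_measurable (fun x => v k * \1_(B k) x).
  apply: bounded_measurableM; first exact: bounded_measurable_cst.
  exact: bounded_measurable_indic.
have bs : bounded_measurable s by exact: bounded_measurable_sum.
have bd : bounded_measurable (fun x => phi x - s x).
  apply: bounded_measurableD => //.
  under eq_fun do rewrite -mulN1r; apply: bounded_measurableM => //.
  exact: bounded_measurable_cst.
have sE : \int[P]_w (s (X w) * Y w) = (\int[P]_w s (X w)) * c.
  transitivity (\int[P]_w (\sum_(k < M) v k * (\1_(B k) (X w) * Y w))).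
    by apply: eq_Rintegral => w _; rewrite mulr_suml; apply: eq_bigr => k _; rewrite mulrA.
  have b1 k : bounded_measurable (fun w => \1_(B k) (X w) * Y w).
    by apply: bounded_measurableM => //; apply: (bX (\1_(B k))); exact: bounded_measurable_indic.
  have b2 k : bounded_measurable (fun w => \1_(B k) (X w) : R).
    by apply: (bX (\1_(B k))); exact: bounded_measurable_indic.
  rewrite integral_bm_sum => [|k]; last first.
    by apply: bounded_measurableM => //; exact: bounded_measurable_cst.
  rewrite [in RHS]integral_bm_sum => [|k]; last exact: (bX _ (bZ k)).
  rewrite mulr_suml; apply: eq_bigr => k _.
  rewrite !integral_bmZ // hB // -mulrA; congr (_ * (_ * _)).
  rewrite -integral_bm_indic //.
  by rewrite -[X in measurable X]setTI; exact: mX.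
have -> : \int[P]_w (phi (X w) * Y w) - (\int[P]_w phi (X w)) * c =
    \int[P]_w ((phi (X w) - s (X w)) * Y w) - (\int[P]_w (phi (X w) - s (X w))) * c.
  have e1 : \int[P]_w (phi (X w) * Y w) = \int[P]_w ((phi (X w) - s (X w)) * Y w) + \int[P]_w (s (X w) * Y w).
    rewrite -integral_bmD.
    - by apply: eq_Rintegral => w _; ring.
    - by apply: bounded_measurableM => //; exact: bX bd.
    - by apply: bounded_measurableM => //; exact: bX bs.
  have e2 : \int[P]_w (phi (X w)) = \int[P]_w (phi (X w) - s (X w)) + \int[P]_w (s (X w)).
    rewrite -integral_bmD; [|exact: bX bd|exact: bX bs].
    by apply: eq_Rintegral => w _; ring.
  by rewrite e1 e2 sE; ring.
rewrite (le_trans (ler_normB _ _)) // normrM mulrDl lerD //.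
  apply: norm_integral_bm_le.
    by apply: bounded_measurableM => //; exact: bX bd.
  by move=> w; rewrite normrM mulrC ler_pM // -[leRHS]mul1r.
rewrite mulrC ler_pM // -[leRHS]mul1r; apply: norm_integral_bm_le => //.
exact: bX bd.
Qed.

Lemma integral_indep_prod (d' : measure_display) (U : measurableType d')
    (I : finType) (X : I -> T -> U) (phi : I -> U -> R) :
  (forall i, measurable_fun [set: T] (X i)) -> mutually_independent P X ->
  (forall i, bounded_measurable (phi i)) ->
  \int[P]_w (\prod_i phi i (X i w)) = \prod_i \int[P]_w phi i (X i w).
Proof.
move=> mX indX bphi.
have bX i (psi : U -> R) : bounded_measurable psi -> bounded_measurable (fun w => psi (X i w)).
  by move=> [mpsi [C psiC]]; split; [exact: measurableT_comp|exists C].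
(* Independence is given for indicators only. The list [J] collects the indices allowed to carry
   arbitrary bounded functions, and the induction releases one factor at a time. *)
suff : forall (J : seq I) (psi : I -> U -> R), (forall i, bounded_measurable (psi i)) ->
    (forall i, i \notin J -> exists2 B, measurable B & psi i = \1_B) ->
    \int[P]_w (\prod_i psi i (X i w)) = \prod_i \int[P]_w psi i (X i w).
  by move=> h; apply: (h (enum I)) => // i; rewrite mem_enum.
elim=> [|i J IHJ] psi bpsi hpsi.
  have /choice[B hB] : forall i, exists B, measurable B /\ psi i = \1_B.
    by move=> i; have [//|B] := hpsi i; exists B.
  have mXB i : measurable (X i @^-1` B i).
    by rewrite -[X in measurable X]setTI; apply: mX => //; case: (hB i).
  transitivity (fine (P (\bigcap_(i in [set: I]) (X i @^-1` B i)))).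
    rewrite -integral_bm_indic; last by apply: fin_bigcap_measurable => //; exact: finite_finset.
    apply: eq_Rintegral => w _; rewrite indicE.
    have [/set_mem wB|wB] := boolP (w \in _).
      by rewrite big1 // => i _; rewrite (hB i).2 indicE mem_set //; exact: wB.
    have [i iB] : exists i, ~ B i (X i w).
      by apply/existsNP => h; case/negP: wB; apply/mem_set => i _; exact: h.
    by rewrite (bigD1 i) //= (hB i).2 indicE memNset // mul0r.
  rewrite indX => [|i]; last by case: (hB i).
  rewrite (eq_bigr (fun i => (fine (P (X i @^-1` B i)))%:E)) => [|i _]; last first.
    by rewrite fineK // fin_num_measure.
  rewrite prodEFin /=; apply: eq_bigr => i _.
  by rewrite -integral_bm_indic // (hB i).2.
pose Y w := \prod_(j | j != i) psi j (X j w).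
have bY : bounded_measurable Y.
  by apply: bounded_measurable_prod => j; exact: bX.
rewrite (bigD1 i) //= -(integral_indep_step (mX i) bY _ (bpsi i)).
  by apply: eq_Rintegral => w _; rewrite (bigD1 i).
move=> B mB.
pose psi' j := if j == i then \1_B else psi j.
have psii : psi' i = \1_B by rewrite /psi' eqxx.
have psij j : j != i -> psi' j = psi j by rewrite /psi' => /negPf ->.
have := IHJ psi'; rewrite (bigD1 i) //= psii.
rewrite (eq_bigr (fun j => \int[P]_w psi j (X j w))) => [h|j ji]; last first.
  by rewrite psij.
have mXB : measurable (X i @^-1` B) by rewrite -[X in measurable X]setTI; exact: mX.
rewrite -integral_bm_indic //.
transitivity (\int[P]_w (\prod_j psi' j (X j w))).
  apply: eq_Rintegral => w _; rewrite (bigD1 i) //= psii; congr (_ * _).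
  by apply: eq_bigr => j ji; rewrite psij.
apply: h => [j|j jJ].
- by rewrite /psi'; case: ifP => // _; exact: bounded_measurable_indic.
- rewrite /psi'; case: ifPn => [_|ji]; first by exists B.
  by apply: hpsi; rewrite inE negb_or ji.
Qed.

End Independence.

(** * The moment method *)

Lemma prod_seq_count (R : comNzRingType) (E : finType) (X : E -> R) (L : seq E) :
  \prod_(e <- L) X e = \prod_(e : E) X e ^+ count_mem e L.
Proof.
elim: L => [|f L IHL]; first by rewrite big_nil big1.
rewrite big_cons IHL (bigD1 f) //= mulrA [in RHS](bigD1 f) //= eqxx exprS; congr (_ * _).
by apply: eq_bigr => e ef; rewrite eq_sym (negPf ef).
Qed.

Section MomentMethod.
Context (R : realType) (d : measure_display) (T : measurableType d).
Variable P : probability T R.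

Lemma bounded_measurableX (f : T -> R) (c : nat) :
  bounded_measurable f -> bounded_measurable (fun w => f w ^+ c).
Proof.
move=> bf; elim: c => [|c IHc].
  by under eq_fun do rewrite expr0; exact: bounded_measurable_cst.
by under eq_fun do rewrite exprS; exact: bounded_measurableM.
Qed.

(** By independence each distinct variable of [L], of multiplicity [c], contributes at most
    [r ^+ c / N]: the powers of [r] add up to [size L], and one factor [N^-1] remains per distinct
    variable. *)
Lemma norm_integral_prod_seq_le (E : finType) (X : E -> T -> R) (r N : R) (L : seq E) :
  (forall e, bounded_measurable (X e)) -> mutually_independent P X ->
  (forall e c, (0 < c)%N -> `|\int[P]_w (X e w ^+ c)| <= r ^+ c / N) ->
  `|\int[P]_w (\prod_(e <- L) X e w)| <= r ^+ size L * N^-1 ^+ size (undup L).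
Proof.
move=> bX indX hr.
under eq_Rintegral do rewrite prod_seq_count.
have mX e : measurable_fun [set: T] (X e) by case: (bX e).
have bd e : exists C : R, (forall w, `|X e w| <= C) by case: (bX e).
have /choice[C hC] := bd.
(* Powers are unbounded on the line, so the argument is first clipped to [[- C e, C e]], which
   changes nothing on the values of [X e]. *)
pose phi e (x : R) : R := Num.max (- C e) (Num.min x (C e)) ^+ count_mem e L.
have phiX e w : phi e (X e w) = X e w ^+ count_mem e L.
  rewrite /phi; have := hC e w; rewrite ler_norml => /andP[h1 h2].
  by rewrite (min_idPl h2) (max_idPr h1).
have bphi e : bounded_measurable (phi e).
  have mmm : measurable_fun [set: R] (fun x : R => Num.max (- C e) (Num.min x (C e))).
    by apply: measurable_maxr => //; apply: measurable_minr.
  split; first exact: measurable_funX.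
  exists (`|C e| ^+ count_mem e L) => x; rewrite normrX lerXn2r ?nnegrE //.
  have h1 : C e <= `|C e| by exact: ler_norm.
  have h2 : - C e <= `|C e| by rewrite -normrN ler_norm.
  by rewrite ler_norml le_max lerN2 h1 ge_max h2 ge_min h1 orbT.
under eq_Rintegral do under eq_bigr do rewrite -phiX.
rewrite integral_indep_prod // normr_prod.
have -> : r ^+ size L * N^-1 ^+ size (undup L) =
    \prod_e (if e \in L then r ^+ count_mem e L / N else 1).
  have -> : r ^+ size L = \prod_e r ^+ count_mem e L.
    rewrite -(prod_seq_count (fun=> r)); elim: (L) => [|f L' IH].
      by rewrite big_nil.
    by rewrite big_cons -IH exprS.
  have -> : N^-1 ^+ size (undup L) = \prod_e (if e \in L then N^-1 else 1).
    rewrite -big_mkcond /= prodr_const; congr (_ ^+ _).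
    by rewrite -(card_uniqP (undup_uniq L)); apply: eq_card => e; rewrite mem_undup.
  rewrite -big_split; apply: eq_bigr => e _ /=; case: ifPn => // eL.
  by rewrite (count_memPn eL) expr0 mul1r.
apply: ler_prod => e _; rewrite normr_ge0 /=.
under eq_Rintegral do rewrite phiX.
case: ifPn => [eL|eL]; first by apply: hr; rewrite -has_count has_pred1.
rewrite (count_memPn eL); under eq_Rintegral do rewrite expr0.
by rewrite integral_bm_cst normr1.
Qed.

Variables (n p : nat) (X : 'I_n * 'I_p -> T -> R) (r N : R).
Hypotheses (bX : forall e, bounded_measurable (X e)) (indX : mutually_independent P X)
  (r0 : 0 <= r) (N0 : 0 < N) (VN : (n + p)%:R <= N)
  (hr : forall e c, (0 < c)%N -> `|\int[P]_w (X e w ^+ c)| <= r ^+ c / N).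

(** The vertices are the [n] rows followed by the [p] columns, and a matrix entry is the edge
    between its row and its column; two vertices on the same side are not joined. *)
Definition bipartite_edge (x y : 'I_(n + p)) : option ('I_n * 'I_p) :=
  match fintype.split x, fintype.split y with
  | inl i, inr j => Some (i, j)
  | inr j, inl i => Some (i, j)
  | _, _ => None
  end.

Lemma bipartite_edge_inj x y z e :
  bipartite_edge x z = Some e -> bipartite_edge y z = Some e -> x = y.
Proof.
rewrite /bipartite_edge; case: (split_ordP x) => i ->; case: (split_ordP y) => j ->;
  case: (split_ordP z) => k _ //=; move=> [] <- [] //; by move=> ->.
Qed.

(** Hermitization: a rectangular matrix has no powers, so it is placed off the diagonal of a
    symmetric matrix with the same operator norm. *)
Definition bipartite_mx (w : T) : 'M[R]_(n + p) :=
  block_mx 0 (\matrix_(i, j) X (i, j) w) (\matrix_(i, j) X (i, j) w)^T 0.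

Lemma bipartite_mxE w x y :
  bipartite_mx w x y = oapp (fun e => X e w) 0 (bipartite_edge x y).
Proof.
rewrite /bipartite_edge !mxE; case: (split_ordP x) => i _; rewrite !mxE;
  by case: (split_ordP y) => j _; rewrite !mxE.
Qed.

Lemma walk_weight_bipartite (w : T) (i : 'I_(n + p)) (s : seq 'I_(n + p)) :
  walk_weight (bipartite_mx w) i s =
  if None \in walk_edges bipartite_edge i s then 0
  else \prod_(e <- pmap id (walk_edges bipartite_edge i s)) X e w.
Proof.
rewrite -walk_weight_prod; elim: s i => //= y s IHs i.
by rewrite IHs bipartite_mxE.
Qed.

Lemma bounded_measurable_walk_weight (i : 'I_(n + p)) (s : seq 'I_(n + p)) :
  bounded_measurable (fun w => walk_weight (bipartite_mx w) i s * (last i s == i)%:R).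
Proof.
apply: bounded_measurableM; last exact: bounded_measurable_cst.
have [NE|NE] := boolP (None \in walk_edges bipartite_edge i s).
  under eq_fun do rewrite walk_weight_bipartite NE.
  exact: bounded_measurable_cst.
under eq_fun do rewrite walk_weight_bipartite (negPf NE).
exact: bounded_measurable_prod.
Qed.

Lemma bounded_measurable_trace (l : nat) :
  bounded_measurable (fun w => \tr (bipartite_mx w ^+ l)).
Proof.
under eq_fun do rewrite mxtrace_walks.
apply: bounded_measurable_sum => s; apply: bounded_measurable_sum => i.
exact: bounded_measurable_walk_weight.
Qed.

(** The trace expands into closed walks, and the expectation of each is paid for by its distinct
    edges. The closing condition is merely bounded by 1, since the sum over all walks is already at
    most [N] times the factorial of [l]. *)
Lemma integral_trace_le (l : nat) :
  \int[P]_w \tr (bipartite_mx w ^+ l) <= r ^+ l * (N * l`!%:R).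
Proof.
under eq_Rintegral do rewrite mxtrace_walks.
rewrite integral_bm_sum => [|s]; last first.
  by apply: bounded_measurable_sum => i; exact: bounded_measurable_walk_weight.
have VN' : #|'I_(n + p)|%:R <= N by rewrite card_ord.
apply: le_trans (ler_wpM2l _ (sum_walks_distinct_edges bipartite_edge_inj N0 VN' l));
  last by rewrite exprn_ge0.
rewrite mulr_sumr big_seq [leRHS]big_seq; apply: ler_sum => s /size_walks sl.
rewrite integral_bm_sum => [|i]; last exact: bounded_measurable_walk_weight.
rewrite mulr_sumr; apply: ler_sum => i _.
apply: le_trans (ler_norm _) _.
have [NE|NE] := boolP (None \in walk_edges bipartite_edge i s).
  by under eq_Rintegral do rewrite walk_weight_bipartite NE mul0r; rewrite ?NE integral_bm_cst normr0 mulr0.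
under eq_Rintegral do rewrite walk_weight_bipartite (negPf NE) mulrC.
rewrite ?(negPf NE) integral_bmZ; last exact: bounded_measurable_prod.
rewrite normrM; set L := pmap _ _.
have EL : walk_edges bipartite_edge i s = map Some L.
  rewrite /L; elim: (walk_edges _ _ _) NE => //= -[e|] L' IH; rewrite inE //=.
  by move=> /IH <-.
apply: (@le_trans _ _ (`|\int[P]_w (\prod_(e <- L) X e w)|)).
  by rewrite ler_piMl //; case: (_ == _); rewrite ?normr1 ?normr0.
apply: le_trans (norm_integral_prod_seq_le L bX indX hr) _.
rewrite EL undup_map_inj ?size_map; last by move=> ? ? [].
by rewrite -sl -(size_pairmap bipartite_edge i s) -/(walk_edges _ _ _) EL size_map.
Qed.

Lemma sqnorm_mulmx_bipartite (w : T) (v : 'rV[R]_n) :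
  sqnorm (row_mx v 0 *m bipartite_mx w) = sqnorm (v *m \matrix_(i, j) X (i, j) w).
Proof.
rewrite mul_row_block !(mulmx0, mul0mx, addr0) !sqnormE big_split_ord /=.
rewrite big1 ?add0r => [|i _]; last by rewrite row_mxEl mxE expr0n.
by apply: eq_bigr => i _; rewrite row_mxEr.
Qed.

Lemma sqnorm_random_mulmx_le (w : T) (m : nat) (rho : R) (v : 'rV[R]_n) : 0 <= rho ->
  \tr (bipartite_mx w ^+ (2 ^ m.+1)) <= (rho ^+ 2) ^+ (2 ^ m) ->
  sqnorm (v *m \matrix_(i, j) X (i, j) w) <= rho ^+ 2 * sqnorm v.
Proof.
move=> rho0 htr; rewrite -sqnorm_mulmx_bipartite.
have HT : (bipartite_mx w)^T = bipartite_mx w.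
  by rewrite tr_block_mx trmxK !trmx0.
have h := sqnorm_mulmx_exp_le m (row_mx v 0) HT.
have vv : sqnorm (row_mx v (0 : 'rV_p)) = sqnorm v.
  rewrite !sqnormE big_split_ord /= [X in _ + X]big1 ?addr0.
    by apply: eq_bigr => i _; rewrite row_mxEl.
  by move=> i _; rewrite row_mxEr mxE expr0n.
rewrite vv in h.
rewrite -(@ler_pXn2r _ (2 ^ m)) ?nnegrE ?mulr_ge0 ?sqnorm_ge0 ?expn_gt0 ?sqr_ge0 //.
apply: le_trans h _; rewrite exprMn mulrC ler_wpM2r // exprn_ge0 // sqnorm_ge0 //.
Qed.

Lemma probability_trace_ge (m : nat) (rho : R) : 0 < rho ->
  fine (P [set w | (rho ^+ 2) ^+ (2 ^ m) <= \tr (bipartite_mx w ^+ (2 ^ m.+1))])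
  <= (r / rho) ^+ (2 ^ m.+1) * N * (2 ^ m.+1)`!%:R.
Proof.
move=> rho0.
apply: le_trans (Markov_bm P (bounded_measurable_trace _) _ _) _.
(* Markov's inequality asks for a nonnegative trace: the exponent is even, so the trace is a sum of
   squares of the entries of a symmetric power. *)
- move=> w; rewrite expnS mulnC exprM expr2.
  have HT : (bipartite_mx w ^+ (2 ^ m))^T = bipartite_mx w ^+ (2 ^ m).
    elim: (2 ^ m)%N => [|k IHk]; first by rewrite expr0 trmx1.
    have HT1 : (bipartite_mx w)^T = bipartite_mx w by rewrite tr_block_mx trmxK !trmx0.
    rewrite {1}exprSr [_ * _]/(_ *m _) trmx_mul IHk HT1.
    by rewrite exprS.
  rewrite -{2}HT /mxtrace sumr_ge0 // => i _; rewrite mxE sumr_ge0 // => j _.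
  by rewrite mxE -expr2 sqr_ge0.
- by rewrite exprn_gt0 // exprn_gt0.
rewrite -exprM -expnS exprMn exprVn [X in _ <= X * _ * _]mulrC -!mulrA.
by rewrite ler_wpM2l ?integral_trace_le // invr_ge0 exprn_ge0 // ltW.
Qed.

End MomentMethod.

(** * Measurability of ordered eigenvalues *)

Section MeasurableEigenvalues.
Context (R : realType) (d : measure_display) (T : measurableType d).

Definition measurable_coefs (f : T -> {poly R}) : Prop :=
  forall j, measurable_fun [set: T] (fun w => (f w)`_j).

Lemma measurable_coefs_cst (q : {poly R}) : measurable_coefs (fun=> q).
Proof. by move=> j; exact: measurable_cst. Qed.

Lemma measurable_coefsD (f g : T -> {poly R}) :
  measurable_coefs f -> measurable_coefs g -> measurable_coefs (fun w => f w + g w).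
Proof.
move=> mf mg j; under eq_fun do rewrite coefD.
exact: measurable_funD (mf j) (mg j).
Qed.

Lemma measurable_coefsM (f g : T -> {poly R}) :
  measurable_coefs f -> measurable_coefs g -> measurable_coefs (fun w => f w * g w).
Proof.
move=> mf mg j; under eq_fun do rewrite coefM.
by apply: measurable_sum => i; apply: measurable_funM; [exact: mf|exact: mg].
Qed.

Lemma measurable_coefs_sum (I : Type) (s : seq I) (f : I -> T -> {poly R}) :
  (forall i, measurable_coefs (f i)) ->
  measurable_coefs (fun w => \sum_(i <- s) f i w).
Proof.
move=> mf; elim: s => [|i s IHs] j.
  by under eq_fun do rewrite big_nil; exact: measurable_coefs_cst.
by under eq_fun do rewrite big_cons; apply: measurable_coefsD.
Qed.

Lemma measurable_coefs_prod (I : Type) (s : seq I) (f : I -> T -> {poly R}) :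
  (forall i, measurable_coefs (f i)) ->
  measurable_coefs (fun w => \prod_(i <- s) f i w).
Proof.
move=> mf; elim: s => [|i s IHs] j.
  by under eq_fun do rewrite big_nil; exact: measurable_coefs_cst.
by under eq_fun do rewrite big_cons; apply: measurable_coefsM.
Qed.

Lemma measurable_coefs_char_poly (n : nat) (M : T -> 'M[R]_n) :
  (forall i j, measurable_fun [set: T] (fun w => M w i j)) ->
  measurable_coefs (fun w => char_poly (M w)).
Proof.
move=> mM; apply: measurable_coefs_sum => s; apply: measurable_coefsM.
  exact: measurable_coefs_cst.
apply: measurable_coefs_prod => i k.
under eq_fun do rewrite !mxE coefB coefC.
apply: measurable_funB; first exact: measurable_cst.
by case: (k == 0)%N; [exact: mM|exact: measurable_cst].
Qed.

(** The shift turns the factors into ['X + (x - lam i)], whose coefficients are nonnegative if the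
    roots are at most [x]. Conversely a monic polynomial with nonnegative coefficients is positive
    on the positive half-line, so [lam i - x] cannot be a positive root of it. *)
Lemma roots_le_coefs_ge0 (I : finType) (Q : pred I) (lam : I -> R) (x : R) :
  (forall i, Q i -> lam i <= x) <->
  (forall j, (0 : R) <= ((\prod_(i | Q i) ('X - (lam i)%:P)) \Po ('X + x%:P))`_j).
Proof.
set q := \prod_(i | Q i) _.
have qE : q \Po ('X + x%:P) = \prod_(i | Q i) ('X + (x - lam i)%:P).
  rewrite rmorph_prod /=; apply: eq_bigr => i _.
  by rewrite comp_polyB comp_polyX comp_polyC polyCB addrA.
split=> [h j|h i Qi].
  rewrite qE; elim/big_ind: _ j => [j|f g f0 g0 j|i Qi j].
  - by rewrite coef1 ler0n.
  - by rewrite coefM sumr_ge0 // => m _; rewrite mulr_ge0.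
  - by rewrite coefD coefX coefC addr_ge0 ?ler0n //; case: ifP; rewrite ?subr_ge0 ?h.
rewrite leNgt; apply/negP => xi.
have : (q \Po ('X + x%:P)).[lam i - x] = 0.
  by rewrite horner_comp !hornerE subrK /q (bigD1 i) //= hornerM !hornerE subrr mul0r.
apply/eqP; rewrite gt_eqF // horner_coef.
have qm : q \Po ('X + x%:P) \is monic.
  by rewrite qE; apply: monic_prod => k _; rewrite monicE lead_coefXaddC.
have qs : (0 < size (q \Po ('X + x%:P)))%N by rewrite lt0n size_poly_eq0 monic_neq0.
move: (qs) (h) qm; rewrite monicE lead_coefE; case: (size _) => // k _ hk /eqP k1.
rewrite big_ord_recr /= ltr_wpDl ?sumr_ge0 // => [m _|].
  by rewrite mulr_ge0 ?exprn_ge0 // ltW // subr_gt0.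
by rewrite k1 mul1r exprn_gt0 // subr_gt0.
Qed.

(* The largest root of a real-rooted monic [q] is at most [x] iff [q (X + x)] has
   nonnegative coefficients, which is a measurable condition on the coefficients
   of [q]; divide this root out and repeat. *)
Lemma measurable_ordered_eigenvalues (n : nat) (M : T -> 'M[R]_n) (lam : T -> 'I_n -> R) :
  (forall i j, measurable_fun [set: T] (fun w => M w i j)) ->
  (forall w, ordered_eigenvalues (M w) (lam w)) ->
  forall i, measurable_fun [set: T] (fun w => lam w i).
Proof.
move=> mM hlam.
pose q r w : {poly R} := \prod_(i < n | (r <= i)%N) ('X - (lam w i)%:P).
suff H r : (r <= n)%N -> measurable_coefs (q r) /\
    forall i : 'I_n, (i < r)%N -> measurable_fun [set: T] (fun w => lam w i).
  by move=> i; apply: (H n (leqnn n)).2.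
elim: r => [_|r IHr rn].
  split=> // j; under eq_fun do rewrite /q -(hlam _).1.
  exact: measurable_coefs_char_poly.
have [mq mlam] := IHr (ltnW rn).
pose i0 := Ordinal rn.
have size_q s w : (size (q s w) <= n.+1)%N.
  rewrite /q -big_filter size_prod_XsubC ltnS size_filter.
  by rewrite (leq_trans (count_size _ _)) // -sum1_size sum1_card card_ord.
have lam_le w x : lam w i0 <= x <-> (forall i : 'I_n, (r <= i)%N -> lam w i <= x).
  split=> [h i ri|]; last exact.
  by apply: le_trans h; apply: (hlam w).2.
have mi0 : measurable_fun [set: T] (fun w => lam w i0).
  move=> mD; apply: (measurability _ (RGenOInfty.measurableE R)) => // _ [_ [x ->] <-] /=.
  rewrite setTI set_itvE.
  rewrite (_ : _ @^-1` _ = ~` \bigcap_j [set w | 0 <= ((q r w) \Po ('X + x%:P))`_j]).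
    apply: measurableC; apply: bigcap_measurable => // j _.
    apply: measurable_set_le; first exact: measurable_cst.
    rewrite (_ : (fun w => _) = (fun w => \sum_(k < n.+1) (q r w)`_k * (('X + x%:P) ^+ k)`_j)).
      by apply: measurable_sum => k; apply: measurable_funM; [exact: mq|exact: measurable_cst].
    apply/funext => w; rewrite coef_comp_poly.
    rewrite (big_ord_widen_cond _ xpredT (fun k => (q r w)`_k * (('X + x%:P) ^+ k)`_j) (size_q r w)) /=.
    rewrite big_mkcond; apply: eq_bigr => k _; case: ifPn => //.
    by rewrite -leqNgt => h; rewrite nth_default // mul0r.
  apply/seteqP; split=> w /=.
    move=> xw h; move: xw; apply/negP; rewrite -leNgt; apply/lam_le.
    by apply/roots_le_coefs_ge0 => j; exact: h.
  move=> h; rewrite ltNge; apply/negP => /lam_le/roots_le_coefs_ge0 h'.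
  by apply: h => j _; exact: h'.
have qE w : q r w = ('X - (lam w i0)%:P) * q r.+1 w.
  rewrite /q (bigD1 i0) //=; congr (_ * _); apply: eq_bigl => i.
  by rewrite ltn_neqAle eq_sym -val_eqE andbC.
(* Synthetic division by ['X - lam w i0] computes the coefficients of the quotient from the top
   down, hence the induction on [n.+1 - j]. *)
have qcoef w j : (q r.+1 w)`_j = (q r w)`_j.+1 + lam w i0 * (q r.+1 w)`_j.+1.
  by rewrite [in RHS]qE mulrBl coefB coefXM coefCM subrK.
split=> [j|i]; last first.
  rewrite ltnS leq_eqVlt => /predU1P[ir|/mlam //].
  by have -> : i = i0 by exact: val_inj.
have [k] := ubnP (n.+1 - j)%N; elim: k j => // k IHk j.
rewrite ltnS => jk; have [nj|jn] := leqP n.+1 j.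
  under eq_fun do rewrite nth_default ?(leq_trans (size_q _ _)) //.
  exact: measurable_cst.
under eq_fun do rewrite qcoef.
apply: measurable_funD; first exact: mq.
apply: measurable_funM => //; apply: IHk.
by apply: leq_trans jk; rewrite subSS subSn.
Qed.

End MeasurableEigenvalues.

(** * Multinomial counts and their Poisson limit *)

Lemma sum_option (R : nmodType) (I : finType) (F : option I -> R) :
  \sum_v F v = F None + \sum_i F (Some i).
Proof.
rewrite (bigD1 None) //=; congr (_ + _).
rewrite (reindex_omap Some id) /=; last by case.
by apply: eq_bigl => i; rewrite eqxx.
Qed.

Section Multinomial.
Variables (R : realFieldType) (k : nat) (q0 : R) (q : 'I_k -> R).

Let Q (v : option 'I_k) : R := oapp q q0 v.

(** A multinomial probability as a sum over words of length [M]: the letter [Some l] stands for the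
    cell [l], and [None], of weight [q0], for the complement of all cells. *)
Definition multinomial_weight (M : nat) (m : 'I_k -> nat) : R :=
  \sum_(s <- walks (option 'I_k) M)
    (\prod_(x <- s) Q x) * [forall l, count_mem (Some l) s == m l]%:R.

Definition decr (m : 'I_k -> nat) (l0 l : 'I_k) : nat := (m l - (l == l0))%N.

Lemma multinomial_weightS (M : nat) (m : 'I_k -> nat) :
  multinomial_weight M.+1 m = q0 * multinomial_weight M m +
    \sum_(l < k | (0 < m l)%N) q l * multinomial_weight M (decr m l).
Proof.
rewrite /multinomial_weight sum_walksS sum_option; congr (_ + _).
  rewrite mulr_sumr; apply: eq_bigr => s _; rewrite big_cons /= mulrA; congr (_ * _%:R).
rewrite [RHS]big_mkcond /=; apply: eq_bigr => l0 _; case: ifPn => ml0.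
  rewrite mulr_sumr; apply: eq_bigr => s _; rewrite big_cons /= mulrA; congr (_ * _%:R).
  congr nat_of_bool; apply: eq_forallb => l; rewrite /decr.
  case: (eqVneq l l0) => [->|ll0]; first by rewrite eqxx /= add1n -[in LHS](prednK ml0) eqSS subn1.
  by rewrite (inj_eq (@Some_inj _)) (eq_sym l0) (negPf ll0) subn0.
rewrite big1 // => s _; rewrite big_cons /=.
rewrite (_ : [forall l, _] = false) ?mulr0 //; apply/negP => /forallP/(_ l0).
by rewrite eqxx /= add1n; case: (m l0) ml0.
Qed.

(** Induction on the first letter. The factorials stay on the left to avoid division, and the
    falling factorial vanishes when the prescribed counts exceed [M]. *)
Lemma multinomial_weightE (M : nat) (m : 'I_k -> nat) :
  multinomial_weight M m * (\prod_l (m l)`!)%:R =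
  (M ^_ (\sum_l m l))%:R * (\prod_l q l ^+ m l) * q0 ^+ (M - \sum_l m l).
Proof.
elim: M m => [|M IHM] m.
  rewrite /multinomial_weight /= big_seq1 big_nil mul1r sub0n expr0 mulr1 /=.
  have [/forallP m0|] := boolP [forall l, 0%N == m l].
    have {}m0 l : m l = 0%N by rewrite -(eqP (m0 l)).
    have -> : (\prod_l (m l)`! = 1)%N by rewrite big1 // => l _; rewrite m0.
    have -> : (\sum_l m l = 0)%N by rewrite big1 // => l _; rewrite m0.
    have -> : \prod_l q l ^+ m l = 1 by rewrite big1 // => l _; rewrite m0.
    by rewrite ffactn0 !mulr1.
  move=> /forallPn[l ml]; rewrite mul0r ffact_small ?mul0r //.
  by rewrite (bigD1 l) //= ltn_addr // lt0n eq_sym.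
set J := (\sum_l m l)%N.
rewrite multinomial_weightS mulrDl -mulrA IHM -/J.
rewrite mulr_suml.
have termE (l : 'I_k) : (0 < m l)%N ->
   q l * multinomial_weight M (decr m l) * (\prod_l (m l)`!)%:R =
   (m l)%:R * ((M ^_ J.-1)%:R * (\prod_l q l ^+ m l) * q0 ^+ (M - J.-1)).
  move=> ml.
  have decrl : decr m l l = (m l).-1 by rewrite /decr eqxx subn1.
  have decrN i : i != l -> decr m l i = m i by rewrite /decr => /negPf ->; rewrite subn0.
  have -> : (\prod_l (m l)`! = m l * \prod_i (decr m l i)`!)%N.
    rewrite (bigD1 l) //= [in RHS](bigD1 l) //= decrl mulnA.
    have -> : ((m l)`! = m l * (m l).-1`!)%N by case: (m l) ml.
    congr (_ * _)%N.
    by apply: eq_bigr => i il; rewrite decrN.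
  have sumE : (\sum_i decr m l i)%N = J.-1.
    rewrite /J (bigD1 l) //= [in RHS](bigD1 l) //= decrl.
    rewrite -[in RHS](prednK ml) addSn /=; congr (_ + _)%N.
    by apply: eq_bigr => i il; rewrite decrN.
  have prodE : \prod_i q i ^+ m i = q l * \prod_i q i ^+ decr m l i.
    rewrite (bigD1 l) //= [in RHS](bigD1 l) //= decrl mulrA -exprS prednK //.
    by congr (_ * _); apply: eq_bigr => i il; rewrite decrN.
  rewrite natrM prodE -sumE.
  have := IHM (decr m l); set W := multinomial_weight _ _ => IH.
  transitivity (q l * (m l)%:R * (W * (\prod_i (decr m l i)`!)%:R)); first by ring.
  by rewrite IH; ring.
rewrite (eq_bigr _ termE) -mulr_suml.
have -> : \sum_(l < k | (0 < m l)%N) (m l)%:R = J%:R :> R.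
  rewrite /J natr_sum [RHS](bigID (fun l => 0 < m l)%N) /= [X in _ + X]big1 ?addr0 //.
  by move=> l; rewrite lt0n negbK => /eqP ->.
case: (J) => [|j] /=.
  by rewrite !ffactn0 mul0r addr0 !subn0 exprS; ring.
(* What remains is [M ^_ (j + 1) + (j + 1) * M ^_ j = (M + 1) ^_ (j + 1)]; the cases [j > M] and
   [j = M] are set apart because the exponent of [q0] is a truncated difference. *)
rewrite ffactSS ffactnSr !natrM.
have [jM|Mj] := leqP j M; last by rewrite ffact_small //; ring.
have [jM'|Mj] := ltnP j M.
  rewrite subSS (natrB _ (ltnW jM')) -(subnSK jM') exprS.
  by rewrite -[j.+1%:R]natr1 -[M.+1%:R]natr1; ring.
have -> : j = M by apply/eqP; rewrite eqn_leq jM Mj.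
rewrite subnn subSS subnn expr0; ring.
Qed.

End Multinomial.

Lemma mem_walks (V : finType) (l : nat) (s : seq V) :
  (s \in walks V l) = (size s == l).
Proof.
apply/idP/eqP => [/size_walks //|]; elim: l s => [|l IHl] [|x s] //= [] sl.
by apply/allpairsP; exists (x, s); rewrite mem_enum IHl.
Qed.

Lemma walks_uniq (V : finType) (l : nat) : uniq (walks V l).
Proof.
elim: l => //= l IHl; apply: allpairs_uniq => //; first exact: enum_uniq.
by move=> [x s] [y t] _ _ /= [-> ->].
Qed.

(** A function on [I] is the word of its values along [enum I], so labelings of a finite set are the
    words of length [#|I|]. *)
Lemma sum_ffun_walks (R : nmodType) (I V : finType) (F : seq V -> R) :
  \sum_(c : {ffun I -> V}) F [seq c i | i <- enum I] =
  \sum_(s <- walks V #|I|) F s.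
Proof.
rewrite -[LHS]big_enum /= -(big_map (fun c : {ffun I -> V} => [seq c i | i <- enum I]) xpredT F) /=.
apply: perm_big; apply: uniq_perm; last move=> s.
- rewrite map_inj_in_uniq ?enum_uniq // => c e _ _ ce.
  by apply/ffunP => i; move/eq_in_map: ce => -> //; rewrite mem_enum.
- exact: walks_uniq.
rewrite mem_walks; apply/mapP/eqP => [[c _ ->]|sI]; first by rewrite size_map -cardE.
have [i0 _|I0] := pickP (mem I).
  have v0 : V.
    by case: s sI => [|//] /esym/eqP; rewrite -leqn0 leqNgt => /negP[]; apply/card_gt0P; exists i0.
  exists [ffun i => nth v0 s (enum_rank i)]; first by rewrite mem_enum.
  apply: (@eq_from_nth _ v0); rewrite ?size_map -?enumT -?cardE // => j jI.
  rewrite (nth_map i0) -?enumT -?cardE -?sI // ffunE.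
  have jI' : (j < #|I|)%N by rewrite -sI.
  have -> : nth i0 (enum I) j = enum_val (Ordinal jI').
    by rewrite (enum_val_nth i0).
  by rewrite enum_valK.
(* An empty [I] is treated apart: [V] may then be empty as well and offers no default letter. *)
have eI : enum I = [::] by apply: size0nil; rewrite -cardE; apply: eq_card0 => i; exact: I0.
exists [ffun i => False_rect V (Bool.diff_true_false (I0 i))]; first by rewrite mem_enum.
by rewrite -?enumT eI; apply: size0nil; rewrite sI cardE eI.
Qed.

Section CountProbability.
Context (R : realType) (d d' : measure_display) (T : measurableType d)
  (U : measurableType d').
Variables (P : probability T R) (I : finType) (X : I -> T -> U) (k : nat)
  (B : 'I_k -> set U) (q : 'I_k -> R) (m : 'I_k -> nat).
Hypotheses (mX : forall i, measurable_fun [set: T] (X i))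
  (indX : mutually_independent P X) (mB : forall l, measurable (B l))
  (tB : trivIset [set: 'I_k] B)
  (hq : forall i l, P (X i @^-1` B l) = (q l)%:E).

(** The disjoint cells together with [None] partition the space, so that the indicator of a count
    event expands over the labelings of the variables. *)
Definition cell_label (x : U) : option 'I_k := [pick l | x \in B l].

Lemma cell_labelE (x : U) (l : 'I_k) : (cell_label x == Some l) = (x \in B l).
Proof.
rewrite /cell_label; case: pickP => [l' xl'|h].
  apply/eqP/idP => [[<-] //|xl]; congr Some.
  by apply: (tB) => //; exists x; split; exact: set_mem.
by rewrite h.
Qed.

Let C (v : option 'I_k) : set U := [set x | cell_label x = v].

Let mC v : measurable (C v).
Proof.
have CS l : C (Some l) = B l.
  apply/seteqP; split=> x /=; first by move/eqP; rewrite cell_labelE => /set_mem.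
  by move=> h; apply/eqP; rewrite cell_labelE; exact: mem_set.
case: v => [l|]; first by rewrite CS.
rewrite (_ : C None = ~` \bigcup_l B l).
  apply: measurableC; apply: fin_bigcup_measurable => //; exact: finite_finset.
apply/seteqP; split=> x /=.
  by move=> xN [l _ xl]; move: (cell_labelE x l); rewrite xN mem_set.
move=> h; rewrite /C /=; case e : (cell_label x) => [l|//]; exfalso; apply: h.
by exists l => //; apply/set_mem; rewrite -cell_labelE e.
Qed.

Definition counts_event : set T :=
  [set w | forall l, #|[pred i | X i w \in B l]| = m l].

Let b (c : {ffun I -> option 'I_k}) : R :=
  [forall l, count_mem (Some l) [seq c i | i <- enum I] == m l]%:R.

Lemma counts_event_indic (w : T) : \1_counts_event w =
  \sum_(c : {ffun I -> option 'I_k}) b c * \prod_i \1_(C (c i)) (X i w) :> R.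
Proof.
pose c0 := [ffun i => cell_label (X i w)].
rewrite (bigD1 c0) //= [X in _ + X]big1 ?addr0 => [|c cc0]; last first.
  have [i ci] : exists i, c i != c0 i.
    apply/existsP; rewrite -negb_forall; apply: contra cc0 => /forallP h.
    by apply/eqP/ffunP => i; exact/eqP.
  rewrite (bigD1 i) //= indicE memNset ?mul0r ?mulr0 //=.
  by rewrite /C /= => e; case/eqP: ci; rewrite ffunE.
rewrite [X in _ * X]big1 ?mulr1 => [|i _]; last by rewrite indicE mem_set //= ffunE.
rewrite indicE /b; congr (nat_of_bool _)%:R; apply/idP/idP => [/set_mem h|/forallP h].
  apply/forallP => l; rewrite -(h l) count_map cardE size_filter /=.
  rewrite -enumT; apply/eqP; apply: eq_count => i /=.
  by rewrite ffunE cell_labelE.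
apply/mem_set => l; rewrite -(eqP (h l)) count_map cardE size_filter /=.
rewrite -enumT; apply: eq_count => i /=.
by rewrite ffunE cell_labelE.
Qed.

Let bprod (c : {ffun I -> option 'I_k}) :
  bounded_measurable (fun w => b c * \prod_i \1_(C (c i)) (X i w) : R).
Proof.
apply: bounded_measurableM; first exact: bounded_measurable_cst.
apply: bounded_measurable_prod => i; split.
  by apply: (measurableT_comp _ (mX i)); exact: measurable_indic.
by exists 1 => x; rewrite indicE; case: (_ \in _); rewrite ?normr1 ?normr0.
Qed.

Lemma measurable_counts_event : measurable counts_event.
Proof.
have -> : counts_event = [set w | (1 : R) <= \sum_(c : {ffun I -> option 'I_k})
    b c * \prod_i \1_(C (c i)) (X i w)].
  apply/seteqP; split=> w /=; rewrite -counts_event_indic indicE.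
    by move=> h; rewrite mem_set.
  by case: (boolP (w \in counts_event)) => [/set_mem //|_]; rewrite ler10.
apply: measurable_set_le; first exact: measurable_cst.
by apply: (proj1 (bounded_measurable_sum _ _)) => c; exact: bprod.
Qed.

Lemma probability_counts_event :
  fine (P counts_event) = multinomial_weight (1 - \sum_l q l) q #|I| m.
Proof.
rewrite -integral_bm_indic; last exact: measurable_counts_event.
under eq_Rintegral do rewrite counts_event_indic.
rewrite integral_bm_sum; last exact: bprod.
rewrite /multinomial_weight -sum_ffun_walks; apply: eq_bigr => c _.
rewrite integral_bmZ; last first.
  apply: bounded_measurable_prod => i; split.
    by apply: (measurableT_comp _ (mX i)); exact: measurable_indic.
  by exists 1 => x; rewrite indicE; case: (_ \in _); rewrite ?normr1 ?normr0.
rewrite mulrC; congr (_ * _).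
rewrite (integral_indep_prod (phi := fun i => \1_(C (c i))) mX indX); last by move=> i; exact: bounded_measurable_indic.
rewrite big_map big_enum /=; apply: eq_bigr => i _.
have mXC v : measurable (X i @^-1` C v).
  by rewrite -[X in measurable X]setTI; exact: mX.
have PS l : \int[P]_w \1_(C (Some l)) (X i w) = q l.
  have := @integral_bm_indic _ _ _ P _ (mXC (Some l)).
  have -> : X i @^-1` C (Some l) = X i @^-1` B l.
    apply/seteqP; split=> w /=; first by move/eqP; rewrite cell_labelE => /set_mem.
    by move=> h; apply/eqP; rewrite cell_labelE; exact: mem_set.
  rewrite hq /= => <-; apply: eq_Rintegral => w _; rewrite !indicE; congr (nat_of_bool _)%:R.
  by apply/idP/idP => /set_mem h; apply/mem_set; move: h => /=;
    [move/eqP; rewrite cell_labelE => /set_mem|move=> h; apply/eqP; rewrite cell_labelE; exact: mem_set].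
have bm1 v : bounded_measurable (fun w => \1_(C v) (X i w) : R).
  split; first by apply: (measurableT_comp _ (mX i)); exact: measurable_indic.
  by exists 1 => x; rewrite indicE; case: (_ \in _); rewrite ?normr1 ?normr0.
case: (c i) => [l|]; first exact: PS.
(* The weight of [None] is obtained as what the cells leave of the total mass 1. *)
have : \int[P]_w (\sum_v \1_(C v) (X i w)) = 1.
  rewrite -[RHS](integral_bm_cst P); apply: eq_Rintegral => w _.
  rewrite (bigD1 (cell_label (X i w))) //= indicE mem_set // big1 ?addr0 // => v vw.
  by rewrite indicE memNset // => /= h; rewrite -h eqxx in vw.
rewrite integral_bm_sum // sum_option => <-.
by rewrite -(eq_bigr _ (fun l _ => PS l)) addrK.
Qed.

End CountProbability.

Section PoissonLimit.
Variable R : realType.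

Lemma cvg_near_eq (f g : nat -> R) (l : R) :
  g n @[n --> \oo] --> l -> (\forall n \near \oo, g n = f n) ->
  f n @[n --> \oo] --> l.
Proof. by move=> gl fg; apply: cvg_trans gl; exact: near_eq_cvg. Qed.

Lemma cvgr_sum_fin (I : Type) (s : seq I) (F : I -> nat -> R) (a : I -> R) :
  (forall i, F i n @[n --> \oo] --> a i) ->
  (\sum_(i <- s) F i n) @[n --> \oo] --> \sum_(i <- s) a i.
Proof.
move=> h; elim: s => [|i s IHs].
  by rewrite big_nil; under eq_fun do rewrite big_nil; exact: cvg_cst.
rewrite big_cons; under eq_fun do rewrite big_cons; exact: cvgD.
Qed.

Lemma cvgr_prod_fin (I : Type) (s : seq I) (F : I -> nat -> R) (a : I -> R) :
  (forall i, F i n @[n --> \oo] --> a i) ->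
  (\prod_(i <- s) F i n) @[n --> \oo] --> \prod_(i <- s) a i.
Proof.
move=> h; elim: s => [|i s IHs].
  by rewrite big_nil; under eq_fun do rewrite big_nil; exact: cvg_cst.
rewrite big_cons; under eq_fun do rewrite big_cons; exact: cvgM.
Qed.

Lemma cvgr_exprn (F : nat -> R) (a : R) (k : nat) :
  F n @[n --> \oo] --> a -> (F n ^+ k) @[n --> \oo] --> a ^+ k.
Proof.
move=> h; elim: k => [|k IHk].
  by rewrite expr0; under eq_fun do rewrite expr0; exact: cvg_cst.
rewrite exprS; under eq_fun do rewrite exprS; exact: cvgM.
Qed.

Lemma cvg_inv_infty (M : nat -> R) :
  M n @[n --> \oo] --> +oo -> (M n)^-1 @[n --> \oo] --> (0 : R).
Proof.
move=> hM; apply/cvgrPdist_lt => e e0.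
move/cvgryPgt : (hM) => /(_ e^-1); apply: filterS => n hn.
have Mn : 0 < M n by apply: lt_trans hn; rewrite invr_gt0.
rewrite sub0r normrN gtr0_norm ?invr_gt0 //.
by rewrite -[e]invrK ltf_pV2 // posrE // invr_gt0.
Qed.

Lemma cvg_ffact_ratio (M : nat -> nat) (J : nat) :
  (M n)%:R @[n --> \oo] --> (+oo : set_system R) ->
  ((M n ^_ J)%:R / (M n)%:R ^+ J) @[n --> \oo] --> (1 : R).
Proof.
move=> hM; elim: J => [|J IHJ].
  under eq_fun do rewrite ffactn0 expr0 divr1; exact: cvg_cst.
rewrite [X in _ --> X](_ : _ = 1 * (1 - J%:R * 0)); last by rewrite mulr0 subr0 mulr1.
apply: (cvg_near_eq (g := fun n => (M n ^_ J)%:R / (M n)%:R ^+ J * (1 - J%:R * (M n)%:R^-1))).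
  apply: cvgM => //; apply: cvgB; first exact: cvg_cst.
  by apply: cvgM; [exact: cvg_cst|exact: cvg_inv_infty].
near=> n.
have JM : J.+1%:R < (M n)%:R :> R by near: n; move/cvgryPgt : hM; exact.
have M0 : (M n)%:R != 0 :> R by rewrite gt_eqF // (le_lt_trans _ JM).
rewrite ffactnSr natrM natrB; last by move: JM; rewrite ltr_nat => /ltnW/ltnW.
rewrite exprSr; field; rewrite M0 //= expf_neq0 //.
Unshelve. all: by end_near. Qed.

(** A squeeze of [(1 - y) ^ M] between [exp (- M y / (1 - y))] and [exp (- M y)]: both bounds are
    instances of [1 + x <= exp x], at [x = y / (1 - y)] and at [x = - y]. *)
Lemma cvg_one_sub_exprn (M : nat -> nat) (y : nat -> R) (lam : R) :
  (M n)%:R @[n --> \oo] --> (+oo : set_system R) ->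
  ((M n)%:R * y n) @[n --> \oo] --> lam ->
  y n @[n --> \oo] --> (0 : R) /\
  ((1 - y n) ^+ M n) @[n --> \oo] --> expR (- lam).
Proof.
move=> hM hy.
have y0 : y n @[n --> \oo] --> (0 : R).
  rewrite [X in _ --> X](_ : _ = 0 * lam); last by rewrite mul0r.
  apply: (cvg_near_eq (g := fun n => (M n)%:R^-1 * ((M n)%:R * y n))).
    by apply: cvgM => //; exact: cvg_inv_infty.
  near=> n.
  have M0 : (0 : R) < (M n)%:R by near: n; move/cvgryPgt : hM; exact.
  by rewrite /= mulrA mulVf ?mul1r // gt_eqF.
split=> //.
have lo : expR (- ((M n)%:R * y n / (1 - y n))) @[n --> \oo] --> expR (- lam).
  apply: (continuous_cvg _ (@continuous_expR R (- lam))).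
  rewrite [X in _ --> X](_ : _ = - (lam / (1 - 0))); last by rewrite subr0 divr1.
  apply: cvgN; apply: cvgM => //.
  apply: cvgV; first by rewrite subr0 oner_neq0.
  by apply: cvgB => //; exact: cvg_cst.
have up : expR (- ((M n)%:R * y n)) @[n --> \oo] --> expR (- lam).
  by apply: (continuous_cvg _ (@continuous_expR R (- lam))); exact: cvgN.
apply: (squeeze_cvgr _ lo up); near=> n.
have y1 : `|y n| < 1.
  have : `|0 - y n| < 1 by near: n; move/cvgrPdist_lt : y0; apply.
  by rewrite sub0r normrN.
have h1 : 0 < 1 - y n by move: y1; rewrite ltr_norml => /andP[_]; rewrite subr_gt0.
apply/andP; split; last first.
  rewrite -mulrN expRM_natl lerXn2r ?nnegrE ?expR_ge0 ?(ltW h1) //.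
  exact: expR_ge1Dx.
rewrite -mulrA -mulrN expRM_natl lerXn2r ?nnegrE ?expR_ge0 ?(ltW h1) //.
rewrite expRN -[leRHS]invrK lef_pV2 ?posrE ?expR_gt0 ?invr_gt0 //.
apply: le_trans (expR_ge1Dx _); rewrite le_eqVlt; apply/orP; left; apply/eqP.
by field; rewrite gt_eqF.
Unshelve. all: by end_near. Qed.

Lemma cvg_multinomial_weight (k : nat) (M : nat -> nat) (q : nat -> 'I_k -> R)
    (lam : 'I_k -> R) (m : 'I_k -> nat) :
  (M n)%:R @[n --> \oo] --> (+oo : set_system R) ->
  (forall l, ((M n)%:R * q n l) @[n --> \oo] --> lam l) ->
  multinomial_weight (1 - \sum_l q n l) (q n) (M n) m @[n --> \oo] -->
  \prod_l (expR (- lam l) * lam l ^+ m l / (m l)`!%:R).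
Proof.
move=> hM hq.
pose J := (\sum_l m l)%N.
have hs : ((M n)%:R * \sum_l q n l) @[n --> \oo] --> \sum_l lam l.
  by under eq_fun do rewrite mulr_sumr; exact: cvgr_sum_fin.
have [y0 hexp] := cvg_one_sub_exprn hM hs.
have -> : \prod_l (expR (- lam l) * lam l ^+ m l / (m l)`!%:R) =
    1 * (\prod_l lam l ^+ m l) * (expR (- \sum_l lam l) / 1 ^+ J) / (\prod_l (m l)`!)%:R.
  rewrite !big_split /= expr1n divr1 mul1r -sumrN expR_sum natr_prod.
  by rewrite prodfV [X in X / _]mulrC.
have h1 : (1 - \sum_l q n l) @[n --> \oo] --> (1 : R).
  rewrite [X in _ --> X](_ : _ = 1 - 0); last by rewrite subr0.
  by apply: cvgB => //; exact: cvg_cst.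
have hprod : (\prod_l ((M n)%:R * q n l) ^+ m l) @[n --> \oo] --> \prod_l lam l ^+ m l.
  by apply: (@cvgr_prod_fin _ _ (fun l n => ((M n)%:R * q n l) ^+ m l)) => l; exact: cvgr_exprn.
have h1J : ((1 - \sum_l q n l) ^+ J)^-1 @[n --> \oo] --> (1 ^+ J : R)^-1.
  apply: cvgV; first by rewrite expr1n oner_neq0.
  exact: cvgr_exprn.
(* The closed form is regrouped so that each factor has its own limit: the falling factorial over
   [M ^ J], the powers of [M * q], and the power [M - J] of the remaining mass. *)
apply: (cvg_near_eq (g := fun n => (M n ^_ J)%:R / (M n)%:R ^+ J *
    (\prod_l ((M n)%:R * q n l) ^+ m l) *
    ((1 - \sum_l q n l) ^+ M n / (1 - \sum_l q n l) ^+ J) / (\prod_l (m l)`!)%:R)).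
  apply: cvgM; last exact: cvg_cst.
  apply: cvgM; last by apply: cvgM => //; rewrite expr1n -[1]invr1 -{1}(expr1n _ J).
  by apply: cvgM => //; exact: cvg_ffact_ratio.
near=> n.
have fact0 : (\prod_l (m l)`!)%:R != 0 :> R.
  by rewrite pnatr_eq0 -lt0n prodn_gt0 // => l; exact: fact_gt0.
have JM : J%:R < (M n)%:R :> R by near: n; move/cvgryPgt : hM; exact.
have M0 : (M n)%:R != 0 :> R by rewrite gt_eqF // (le_lt_trans _ JM).
have q1 : `|\sum_l q n l| < 1.
  have : `|0 - \sum_l q n l| < 1 by near: n; move/cvgrPdist_lt : y0; apply.
  by rewrite sub0r normrN.
have q0 : 1 - \sum_l q n l != 0.
  by rewrite gt_eqF //; move: q1; rewrite ltr_norml => /andP[_]; rewrite subr_gt0.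
apply: (mulIf fact0); rewrite multinomial_weightE -/J divfK //.
have -> : (1 - \sum_l q n l) ^+ M n / (1 - \sum_l q n l) ^+ J =
    (1 - \sum_l q n l) ^+ (M n - J).
  by rewrite -expfB_cond ?(negPf q0) //=; move: JM; rewrite ltr_nat => /ltnW.
congr (_ * _).
have -> : \prod_l ((M n)%:R * q n l) ^+ m l = (M n)%:R ^+ J * \prod_l q n l ^+ m l.
  rewrite /J -prodrXr -big_split; apply: eq_bigr => l _.
  by rewrite exprMn.
by rewrite mulrA divfK // expf_neq0.
Unshelve. all: by end_near. Qed.

End PoissonLimit.

(** * Regularly varying tails *)

Lemma powRVK (R : realType) (x t : R) : 0 <= x -> t != 0 -> (x `^ t^-1) `^ t = x.
Proof. by move=> x0 t0; rewrite -powRrM mulVf // powRr1. Qed.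

Section RegularVariation.
Variables (R : realType) (alpha : R) (mu : probability R R) (L : R -> R).
Hypotheses (alpha0 : 0 < alpha) (hL : slowly_varying L)
  (htail : forall x : R, 0 < x -> 1 - abs_cdf mu x = L x * x `^ (- alpha)).

Definition abs_tail (x : R) : R := 1 - abs_cdf mu x.
Local Notation G := abs_tail.

Let m_le (x : R) : measurable [set y : R | `|y| <= x].
Proof. by apply: measurable_set_le; [exact: normr_measurable|exact: measurable_cst]. Qed.

Lemma abs_tailE (x : R) : G x = fine (mu [set y : R | x < `|y|]).
Proof.
rewrite (_ : [set y : R | x < `|y|] = ~` [set y : R | `|y| <= x]); last first.
  by apply/seteqP; split=> y /=; rewrite ltNge; move/negP.
by rewrite probability_setC // fineB // fin_num_measure.
Qed.

Lemma abs_tail_ge0 x : 0 <= G x.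
Proof. by rewrite abs_tailE fine_ge0. Qed.

Lemma abs_tail_le1 x : G x <= 1.
Proof. by rewrite /G lerBlDl lerDr fine_ge0. Qed.

Lemma abs_tail_nonincreasing x y : x <= y -> G y <= G x.
Proof.
move=> xy; rewrite lerB // fine_le ?fin_num_measure //.
by apply: le_measure; rewrite ?inE // => z /= zx; exact: le_trans xy.
Qed.

Lemma abs_tail_neg x : x < 0 -> G x = 1.
Proof.
move=> x0; rewrite /G /abs_cdf (_ : [set y : R | _] = set0) ?measure0 ?subr0 //.
apply/seteqP; split=> y //= yx.
by have := le_lt_trans yx x0; rewrite ltNge normr_ge0.
Qed.

Lemma abs_tail_ratio (t e : R) : 0 < t -> 0 < e ->
  exists2 x0, 0 < x0 & forall x, x0 <= x -> `|G (t * x) / G x - t `^ (- alpha)| < e.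
Proof.
move=> t0 e0.
have ta : 0 < t `^ (- alpha) by exact: powR_gt0.
move/cvgrPdist_lt: (hL t0) => /(_ (e / t `^ (- alpha))).
case=> [|M [_ hM]]; first by rewrite divr_gt0.
exists (Num.max (M + 1) 1); first by rewrite lt_max ltr01 orbT.
move=> x; rewrite ge_max => /andP[Mx x1].
have x0 : 0 < x by lra.
have h : `|1 - L (t * x) / L x| < e / t `^ (- alpha) by apply: hM; lra.
have -> : G (t * x) / G x = L (t * x) / L x * t `^ (- alpha).
  rewrite /G !htail ?mulr_gt0 // powRM ?ltW //.
  have xa : x `^ (- alpha) != 0 by rewrite gt_eqF // powR_gt0.
  rewrite invfM; move: (x `^ _) xa (t `^ _) (L (t * x)) (L x)^-1 => z z0 ? ? ?.
  by field.
rewrite -{2}[t `^ _]mul1r -mulrBl normrM (gtr0_norm ta) distrC.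
by rewrite -ltr_pdivlMr.
Qed.

Lemma dyadic_bracket (x x0 : R) : 0 < x0 -> x0 <= x ->
  exists k : nat, 2 ^+ k * x0 <= x < 2 ^+ k.+1 * x0.
Proof.
move=> x00 xx0.
have ex : exists k, x < 2 ^+ k * x0.
  exists (Num.truncn (x / x0)).+1; rewrite -ltr_pdivrMr //.
  apply: lt_trans (truncnS_gt _) _.
  by rewrite -natrX ltr_nat ltn_expl.
case: (ex_minnP ex) => k hk kmin; case: k hk kmin => [|k] hk kmin.
  by move: hk; rewrite expr0 mul1r ltNge xx0.
exists k; rewrite hk andbT leNgt; apply/negP => /kmin.
by rewrite ltnn.
Qed.

(** One half of Potter's bounds: beyond some [x0], doubling the argument divides the tail by at
    least [2 ^ s], and monotonicity fills in between the points [2 ^ k * x0]. The constant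
    [(2 * x0) ^ s] also covers [x < x0], where the tail is at most 1. *)
Lemma abs_tail_upper (s : R) : 0 < s < alpha ->
  exists2 C, 0 < C & forall x, 0 < x -> G x <= C * x `^ (- s).
Proof.
move=> /andP[s0 sa].
have e0 : 0 < 2 `^ (- s) - 2 `^ (- alpha) :> R.
  rewrite subr_gt0 !powRN ltf_pV2 ?posrE ?powR_gt0 //.
  rewrite /powR gt_eqF // ltr_expR ltr_pM2r // ln_gt0 //.
  by rewrite ltr1n.
have [x0 x00 hx0] := abs_tail_ratio (ltr0n _ 2) e0.
have step x : x0 <= x -> G (2 * x) <= 2 `^ (- s) * G x.
  move=> x0x; have := hx0 _ x0x.
  have := abs_tail_ge0 x; rewrite le_eqVlt => /orP[/eqP Gx0 _|Gx0].
    by rewrite -Gx0 mulr0 Gx0 abs_tail_nonincreasing //; lra.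
  rewrite ltr_norml => /andP[_]; rewrite ltrBlDr subrK ltr_pdivrMr // => /ltW.
  done.
have pow k : G (2 ^+ k * x0) <= (2 `^ (- s)) ^+ k.
  elim: k => [|k IHk]; first by rewrite !expr0 abs_tail_le1.
  rewrite !exprS -mulrA; apply: le_trans (step _ _) _.
    by rewrite ler_peMl ?(ltW x00) ?exprn_ege1 ?ler1n.
  by rewrite ler_wpM2l // powR_ge0.
exists ((2 * x0) `^ s) => [|x x_gt0]; first by rewrite powR_gt0 // mulr_gt0.
have [xx0|x0x] := ltP x x0.
  apply: le_trans (abs_tail_le1 x) _; rewrite powRN ler_pdivlMr ?powR_gt0 // mul1r.
  by apply: ge0_ler_powR; rewrite ?nnegrE ?ltW ?mulr_gt0 //; lra.
have [k /andP[k1 k2]] := dyadic_bracket x00 x0x.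
apply: le_trans (abs_tail_nonincreasing k1) _.
apply: le_trans (pow k) _.
rewrite -powR_mulrn ?powR_ge0 // -powRrM mulNr !powRN ler_pdivlMr ?powR_gt0 // mulrC.
rewrite ler_pdivrMr ?powR_gt0 //.
have -> : 2 `^ (s * k%:R) = (2 ^+ k) `^ s :> R.
  by rewrite mulrC powRrM powR_mulrn.
have p2 : 0 <= 2 ^+ k :> R by rewrite exprn_ge0.
rewrite -powRM ?mulr_ge0 ?p2 ?(ltW x00) //.
apply: ge0_ler_powR; rewrite ?nnegrE ?mulr_ge0 ?p2 ?(ltW x00) ?(ltW x_gt0) ?(ltW s0) //.
by rewrite mulrAC -exprS ltW.
Qed.

Lemma abs_tail_lower (s : R) : alpha < s ->
  exists c x1, [/\ 0 < c, 0 < x1 & forall x, x1 <= x -> c * x `^ (- s) <= G x].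
Proof.
move=> sa.
have e0 : 0 < 2 `^ (- alpha) - 2 `^ (- s) :> R.
  rewrite subr_gt0 !powRN ltf_pV2 ?posrE ?powR_gt0 //.
  rewrite /powR gt_eqF // ltr_expR ltr_pM2r // ln_gt0 //.
  by rewrite ltr1n.
have [x0 x00 hx0] := abs_tail_ratio (ltr0n _ 2) e0.
have s2 : 0 < 2 `^ (- s) :> R by rewrite powR_gt0.
have step x : x0 <= x -> 0 < G x /\ 2 `^ (- s) * G x <= G (2 * x).
  (* Positivity of the tail comes out here: if [G x] were 0, the quotient would be 0 by convention,
     at distance [2 ^ (- alpha)] from its limit, more than the tolerance. *)
  move=> /hx0; have := abs_tail_ge0 x; rewrite le_eqVlt => /orP[/eqP <-|Gx0].
    rewrite invr0 mulr0 sub0r normrN gtr0_norm ?powR_gt0 //.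
    by move=> h; exfalso; move: h; rewrite ltNge lerBlDr lerDl ltW.
  rewrite ltr_norml => /andP[+ _]; rewrite opprB ltrBrDr subrK ltr_pdivlMr // => /ltW.
  done.
have [Gx0 _] := step x0 (lexx _).
have pow k : (2 `^ (- s)) ^+ k * G x0 <= G (2 ^+ k * x0).
  elim: k => [|k IHk]; first by rewrite !expr0 !mul1r.
  rewrite !exprS -!mulrA; apply: le_trans (proj2 (step _ _)).
    by rewrite ler_wpM2l // ltW.
  by rewrite ler_peMl ?(ltW x00) ?exprn_ege1 ?ler1n.
exists (2 `^ (- s) * G x0 * x0 `^ s), x0; split => //.
  by rewrite !mulr_gt0 // powR_gt0.
move=> x x0x.
have [k /andP[k1 k2]] := dyadic_bracket x00 x0x.
apply: le_trans (abs_tail_nonincreasing (ltW k2)).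
apply: le_trans (pow k.+1).
have x_gt0 : 0 < x by lra.
rewrite exprS -!mulrA ler_pM2l // [leLHS]mulrC ler_pM2r //.
rewrite -powR_mulrn ?powR_ge0 // -powRrM mulNr !powRN ler_pdivrMr ?powR_gt0 //.
rewrite mulrC ler_pdivlMr ?powR_gt0 //.
have -> : 2 `^ (s * k%:R) = (2 ^+ k) `^ s :> R.
  by rewrite mulrC powRrM powR_mulrn.
have p2 : 0 <= 2 ^+ k :> R by rewrite exprn_ge0.
rewrite -powRM ?p2 ?(ltW x00) //.
apply: ge0_ler_powR; rewrite ?nnegrE ?mulr_ge0 ?p2 ?(ltW x00) ?(ltW x_gt0) //.
  by rewrite ltW // (lt_trans alpha0).
by rewrite mulrC.
Qed.

Lemma abs_tail_gt0 (x : R) : 0 < G x.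
Proof.
have [c [x1 [c0 x10 hc]]] := @abs_tail_lower (alpha + 1) (ltr_pwDr ltr01 (lexx _)).
apply: lt_le_trans (abs_tail_nonincreasing (_ : x <= Num.max x x1)).
  apply: lt_le_trans (hc _ _); last by rewrite le_max lexx orbT.
  by rewrite mulr_gt0 // powR_gt0 // lt_max x10 orbT.
by rewrite le_max lexx.
Qed.

Variables (m : nat -> nat) (b : nat -> R).
Hypotheses (hm : (m n)%:R @[n --> \oo] --> (+oo : set_system R))
  (hb : forall n, b n = tail_quantile (abs_cdf mu) (m n)).

Lemma near_natr_gt (K : R) : \forall n \near \oo, K < (m n)%:R.
Proof. by move/cvgryPgt : hm; exact. Qed.

(** The infimum is a genuine one: for [m n > 1] the set is bounded below by 0, as the tail is 1 on
    negative numbers, and it is nonempty because the tail decays. *)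
Lemma tail_quantile_le (n : nat) (x : R) : (1 < m n)%N -> b n < x -> G x <= (m n)%:R^-1.
Proof.
move=> mn; rewrite hb => bx.
have m1 : ((m n)%:R^-1 : R) < 1 by rewrite invf_lt1 ?ltr1n // ltr0n ltnW.
have m0 : 0 < (m n)%:R :> R by rewrite ltr0n ltnW.
have a2 : 0 < alpha / 2 < alpha by apply/andP; split; have := alpha0; lra.
have [C C0 hC] := abs_tail_upper a2.
have hinf : has_inf [set x : R | 1 - abs_cdf mu x <= (m n)%:R^-1].
  split; last first.
    exists 0 => z /= hz; rewrite leNgt; apply/negP => /abs_tail_neg.
    by rewrite /G => e; move: hz; rewrite e leNgt m1.
  (* The solution [z] of [C * z ^ (- alpha / 2) = 1 / m n]. *)
  exists ((C * (m n)%:R) `^ (2 / alpha)) => /=.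
  have z0 : 0 < C * (m n)%:R by rewrite mulr_gt0.
  apply: le_trans (hC _ _) _; first by rewrite powR_gt0.
  rewrite -powRrM (_ : 2 / alpha * - (alpha / 2) = -1); last by field; rewrite lt0r_neq0.
  rewrite powR_inv1 ?(ltW z0) // invfM mulrA mulfV ?mul1r ?lt0r_neq0 //.
have [z /= hz zx] := inf_lt hinf.1 bx.
by apply: le_trans hz; apply: abs_tail_nonincreasing; exact: ltW.
Qed.

Lemma tail_quantile_ge (n : nat) (x : R) : (1 < m n)%N -> x < b n -> (m n)%:R^-1 < G x.
Proof.
move=> mn; rewrite hb => xb; rewrite ltNge; apply/negP => hx.
move: xb; apply/negP; rewrite -leNgt; apply: ge_inf => //.
exists 0 => z /= hz; rewrite leNgt; apply/negP => /abs_tail_neg.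
have m1 : ((m n)%:R^-1 : R) < 1 by rewrite invf_lt1 ?ltr1n // ltr0n ltnW.
by rewrite /G => e; move: hz; rewrite e leNgt m1.
Qed.

Lemma near_m_gt1 : \forall n \near \oo, (1 < m n)%N.
Proof. by near=> n; rewrite -(ltr_nat R); near: n; exact: near_natr_gt.
Unshelve. all: by end_near. Qed.

(** For [s] between [alpha] and [1 / t], the tail at [m ^ t] is at least of order [m ^ (- t * s)],
    which exceeds [1 / m]; hence [m ^ t] does not lie beyond the quantile. *)
Lemma near_tail_quantile_gt (t : R) : 0 < t -> t * alpha < 1 ->
  \forall n \near \oo, (m n)%:R `^ t <= b n.
Proof.
move=> t0 ta.
pose s := (alpha + t^-1) / 2.
have tV : alpha < t^-1 by rewrite -(ltr_pM2l t0) mulfV // gt_eqF.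
have sa : alpha < s by rewrite /s; lra.
have ts : t * s < 1.
  by rewrite -[ltRHS](mulfV (lt0r_neq0 t0)) ltr_pM2l // /s; lra.
have [c [x1 [c0 x10 hc]]] := abs_tail_lower sa.
have u0 : 0 < 1 - t * s by lra.
near=> n.
have mn : (1 < m n)%N by near: n; exact: near_m_gt1.
have m0 : 0 < (m n)%:R :> R by rewrite ltr0n ltnW.
rewrite leNgt; apply/negP => hlt.
have := tail_quantile_le mn hlt; apply/negP; rewrite -ltNge.
have x1m : x1 <= (m n)%:R `^ t.
  have : x1 `^ t^-1 < (m n)%:R by near: n; exact: near_natr_gt.
  move=> /ltW h; rewrite -(powRVK (ltW x10) (lt0r_neq0 t0)).
  by apply: ge0_ler_powR; rewrite ?nnegrE ?powR_ge0 ?(ltW t0) ?(ltW m0).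
apply: lt_le_trans (hc _ x1m).
rewrite -powRrM mulrN.
have cm : c^-1 < (m n)%:R `^ (1 - t * s).
  have : (c^-1) `^ (1 - t * s)^-1 < (m n)%:R by near: n; exact: near_natr_gt.
  have cV0 : 0 <= c^-1 by rewrite invr_ge0 ltW.
  move=> h; rewrite -(powRVK cV0 (lt0r_neq0 u0)).
  by apply: gt0_ltr_powR; rewrite ?nnegrE ?powR_ge0 ?(ltW m0).
rewrite -powR_inv1 ?(ltW m0) //.
have -> : -1 = (- (t * s)) + - (1 - t * s) by ring.
rewrite powRD ?(gt_eqF m0) ?implybT // mulrC ltr_pM2r ?powR_gt0 // powRN.
by rewrite -[c]invrK ltf_pV2 ?posrE ?powR_gt0 ?invr_gt0.
Unshelve. all: by end_near. Qed.

Lemma near_tail_quantile_ge (K : R) : \forall n \near \oo, K <= b n.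
Proof.
have t0 : 0 < (2 * alpha)^-1 by rewrite invr_gt0 mulr_gt0.
have ta : (2 * alpha)^-1 * alpha < 1.
  by rewrite invfM -mulrA mulVf ?lt0r_neq0 // mulr1; lra.
near=> n.
apply: le_trans (_ : (m n)%:R `^ (2 * alpha)^-1 <= _); last first.
  by near: n; exact: near_tail_quantile_gt.
apply: le_trans (ler_norm K) _.
have : `|K| `^ (2 * alpha) < (m n)%:R by near: n; exact: near_natr_gt.
move=> h; rewrite -(powRVK (normr_ge0 K) (lt0r_neq0 t0)) invrK.
by apply: ge0_ler_powR; rewrite ?nnegrE ?powR_ge0 ?(ltW t0) ?ler0n // ltW.
Unshelve. all: by end_near. Qed.

(** The law may have atoms, so the tail at [b n] itself is not compared with [1 / m n]. The
    comparison is made at [y1 * b n] and [y2 * b n], on either side of [b n], and regular variation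
    costs only the factors [y1 ^ alpha = 1 - dl] and [y2 ^ alpha = 1 + dl]. *)
Lemma cvg_tail_quantile (x : R) : 0 < x ->
  ((m n)%:R * G (x * b n)) @[n --> \oo] --> x `^ (- alpha).
Proof.
move=> x0; apply/cvgrPdist_le => e e0.
have xa : 0 < x `^ (- alpha) by rewrite powR_gt0.
have an0 := lt0r_neq0 alpha0.
have [dl [dl0 dl1 dle]] : exists dl, [/\ 0 < dl, dl < 1 & x `^ (- alpha) * dl <= e / 2].
  exists (Num.min (e / (2 * x `^ (- alpha))) 2^-1); split.
  - by rewrite lt_min invr_gt0 ltr0n andbT divr_gt0 // mulr_gt0.
  - by rewrite gt_min; apply/orP; right; lra.
  - apply: (@le_trans _ _ (x `^ (- alpha) * (e / (2 * x `^ (- alpha))))).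
      by rewrite ler_wpM2l ?(ltW xa) // ge_min lexx.
    by rewrite le_eqVlt; apply/orP; left; apply/eqP; field; rewrite gt_eqF.
have [y1 y10 y1a] : exists2 y1, 0 < y1 & y1 `^ alpha = 1 - dl.
  by exists ((1 - dl) `^ alpha^-1); [rewrite powR_gt0 // subr_gt0|rewrite powRVK //; lra].
have [y2 y20 y2a] : exists2 y2, 0 < y2 & y2 `^ alpha = 1 + dl.
  by exists ((1 + dl) `^ alpha^-1); [rewrite powR_gt0 //; lra|rewrite powRVK //; lra].
have y11 : y1 < 1.
  rewrite ltNge; apply/negP => h.
  have : 1 `^ alpha <= y1 `^ alpha.
    by apply: ge0_ler_powR; rewrite ?nnegrE ?(ltW alpha0) ?(ltW y10).
  by rewrite powR1 y1a; lra.
have y21 : 1 < y2.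
  rewrite ltNge; apply/negP => h.
  have : y2 `^ alpha <= 1 `^ alpha.
    by apply: ge0_ler_powR; rewrite ?nnegrE ?(ltW alpha0) ?(ltW y20).
  by rewrite powR1 y2a; lra.
have powE y : 0 < y -> (x / y) `^ (- alpha) = x `^ (- alpha) * y `^ alpha.
  move=> y_gt0; rewrite powRM ?(ltW x0) ?invr_ge0 ?(ltW y_gt0) //; congr (_ * _).
  by rewrite -powR_inv1 ?(ltW y_gt0) // -powRrM mulN1r opprK.
have e2 : 0 < e / 2 by rewrite divr_gt0.
have [z1 z10 hz1] := abs_tail_ratio (divr_gt0 x0 y10) e2.
have [z2 z20 hz2] := abs_tail_ratio (divr_gt0 x0 y20) e2.
near=> n.
have mn : (1 < m n)%N by near: n; exact: near_m_gt1.
have m0 : 0 < (m n)%:R :> R by rewrite ltr0n ltnW.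
have b1 : 1 <= b n by near: n; exact: near_tail_quantile_ge.
have bz1 : z1 <= y1 * b n.
  by rewrite mulrC -ler_pdivrMr //; near: n; exact: near_tail_quantile_ge.
have bz2 : z2 <= y2 * b n.
  by rewrite mulrC -ler_pdivrMr //; near: n; exact: near_tail_quantile_ge.
have := hz1 _ bz1; have := hz2 _ bz2.
have -> : x / y1 * (y1 * b n) = x * b n by field; rewrite gt_eqF.
have -> : x / y2 * (y2 * b n) = x * b n by field; rewrite gt_eqF.
rewrite !powE // y1a y2a.
have g1 : (m n)%:R^-1 < G (y1 * b n).
  by apply: tail_quantile_ge => //; rewrite gtr_pMl //; lra.
have g2 : G (y2 * b n) <= (m n)%:R^-1.
  by apply: tail_quantile_le => //; rewrite ltr_pMl //; lra.
have gx := abs_tail_ge0 (x * b n).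
have h1 : G (x * b n) / G (y1 * b n) <= (m n)%:R * G (x * b n).
  rewrite mulrC ler_wpM2r // -[leRHS]invrK lef_pV2 ?posrE ?invr_gt0 ?(ltW g1) //.
  by apply: lt_trans g1; rewrite invr_gt0.
have k5 : (m n)%:R * G (x * b n) <= G (x * b n) / G (y2 * b n).
  rewrite mulrC ler_wpM2l // -[leLHS]invrK lef_pV2 ?posrE ?invr_gt0 //.
  exact: abs_tail_gt0.
rewrite !ltr_norml => /andP[k1 k2] /andP[k3 k4].
move: k1 k2 k3 k4 h1 k5 dle; rewrite mulrBr mulrDr !mulr1.
move: (x `^ (- alpha)) (x `^ (- alpha) * dl) => X D.
move: (G (x * b n) / G (y1 * b n)) (G (x * b n) / G (y2 * b n)) => A B.
move: ((m n)%:R * G (x * b n)) => W ? ? ? ? ? ? ?.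
by rewrite ler_norml; apply/andP; split; lra.
Unshelve. all: by end_near. Qed.

End RegularVariation.

(** * Absolute moments and truncated variables *)

Section Moments.
Variables (R : realType) (mu : probability R R).
Local Notation G := (abs_tail mu).

(** A decomposition into dyadic layers bounds the power by 1 plus a series of weighted indicators of
    [A k], whose integrals decay geometrically with ratio [2 ^ (s - t)]. *)
Lemma absolute_moment_finite (s t C : R) : 0 < s < t ->
  (forall x, 0 < x -> G x <= C * x `^ (- t)) ->
  exists2 M : R, 0 <= M & (\int[mu]_y (`|y| `^ s)%:E <= M%:E)%E.
Proof.
move=> /andP[s0 st] hC.
have C0 : 0 <= C.
  have := hC 1 ltr01; rewrite powR1 mulr1; apply: le_trans; exact: abs_tail_ge0.
pose r : R := 2 `^ (s - t).
have r0 : 0 < r by rewrite powR_gt0.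
have r1 : r < 1.
  rewrite /r -[ltRHS](powRr0 2) /powR !gt_eqF // ltr_expR ltr_pM2r ?ln_gt0 ?ltr1n //.
  by rewrite subr_lt0.
(* The exponent is [k.+2], not [k.+1]: the inequality in [A k] is strict, so a modulus equal to a
   power of two falls into the layer below. *)
pose w k : R := (2 ^+ k.+2) `^ s.
have w0 k : 0 <= w k by exact: powR_ge0.
pose A k := [set y : R | 2 ^+ k < `|y|].
have mA k : measurable (A k).
  by apply: measurable_set_lt; [exact: measurable_cst|exact: normr_measurable].
pose phi k (y : R) : \bar R := ((w k)%:E * (\1_(A k) y)%:E)%E.
have phi0 k y : (0 <= phi k y)%E by rewrite /phi -EFinM lee_fin mulr_ge0 // indicE.
have mphi k : measurable_fun [set: R] (phi k).
  apply: (eq_measurable_fun (fun y => (w k * \1_(A k) y)%:E)) => [y _|].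
    by rewrite /phi EFinM.
  by apply/measurable_EFinP; apply: measurable_funM => //; exact: measurable_indic.
pose a := C * 4 `^ s.
have a0 : 0 <= a by rewrite mulr_ge0 // powR_ge0.
have intphi k : (\int[mu]_y phi k y <= (a * r ^+ k)%:E)%E.
  rewrite ge0_integralZl_EFin //; last first.
    by apply/measurable_EFinP; exact: measurable_indic.
  rewrite integral_indic // setIT.
  have muA : mu (A k) = (G (2 ^+ k))%:E.
    by rewrite abs_tailE fineK // fin_num_measure //; exact: mA.
  rewrite [X in (_ * X)%E]muA.
  rewrite -EFinM lee_fin.
  apply: le_trans (ler_wpM2l (w0 k) (hC _ _)) _; first by rewrite exprn_gt0.
  rewrite le_eqVlt; apply/orP; left; apply/eqP.
  rewrite /w /a /r 2!exprS mulrA -natrM powRM ?exprn_ge0 //.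
  rewrite -!powR_mulrn ?powR_ge0 // -!powRrM.
  rewrite (_ : (s - t) * k%:R = k%:R * s + k%:R * - t); last by ring.
  rewrite powRD; last by rewrite pnatr_eq0 implybT.
  by ring.
have pt (y : R) : ((`|y| `^ s)%:E <= 1%:E + \sum_(0 <= k <oo) phi k y)%E.
  have [y1|y1] := leP `|y| 1.
    apply: (@le_trans _ _ 1%E); last by rewrite leeDl // nneseries_ge0.
    rewrite lee_fin -[leRHS](congr1 (fun f => f s) (powR1 R)).
    by apply: ge0_ler_powR; rewrite ?nnegrE ?(ltW s0).
  have [j yj1 yj2] : exists2 j, 2 ^+ j < `|y| & `|y| <= 2 ^+ j.+2.
    have [[|k] /andP[k1 k2]] := dyadic_bracket ltr01 (ltW y1).
      exists 0%N => //; move: k2; rewrite mulr1 expr1 => k2.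
      by rewrite expr2; lra.
    exists k; last by move: k2; rewrite mulr1 => /ltW.
    apply: lt_le_trans k1; rewrite mulr1 exprS ltr_pMl ?exprn_gt0 //.
    by rewrite ltr1n.
  apply: (@le_trans _ _ (phi j y)).
    rewrite /phi indicE mem_set //= mule1 lee_fin.
    by apply: ge0_ler_powR; rewrite ?nnegrE ?(ltW s0) ?exprn_ge0.
  apply: (@le_trans _ _ (\sum_(0 <= k <oo) phi k y)%E); last by rewrite leeDr.
  apply: le_trans (nneseries_lim_ge j.+1 _) => //.
  by rewrite big_nat_recr //= leeDr // sume_ge0.
exists (1 + a / (1 - r)).
  by rewrite addr_ge0 // divr_ge0 // subr_ge0 ltW.
have mpow : measurable_fun [set: R] (fun y : R => (`|y| `^ s)%:E).
  apply/measurable_EFinP; apply: (measurableT_comp (measurable_powR s)).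
  exact: normr_measurable.
apply: (@le_trans _ _ (\int[mu]_y (1%:E + \sum_(0 <= k <oo) phi k y))%E).
  apply: ge0_le_integral => //.
  by apply: emeasurable_funD => //; apply: ge0_emeasurable_sum.
rewrite ge0_integralD //; last 2 first.
  - by move=> y _; rewrite nneseries_ge0.
  - exact: ge0_emeasurable_sum.
rewrite integral_cst // [X in (_ * X)%E](probability_setT mu) mule1 EFinD leeD2l //.
rewrite integral_nneseries //.
apply: lime_le.
  apply: is_cvg_nneseries => k _ _; exact: integral_ge0.
apply: nearW => n.
apply: (@le_trans _ _ (\sum_(0 <= k < n) (a * r ^+ k)%:E)%E).
  by apply: lee_sum => k _; exact: intphi.
rewrite sumEFin lee_fin.
have := geometric_le_lim n a0 r0; rewrite gtr0_norm // => /(_ r1).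
by rewrite /series /geometric /=.
Qed.

Definition truncate (K y : R) : R := if `|y| <= K then y else 0.

Lemma measurable_truncate (K : R) : measurable_fun [set: R] (truncate K).
Proof.
apply: measurable_fun_ifT => //; apply: measurable_fun_ler => //.
Qed.

Lemma norm_truncate_le (K y : R) : 0 <= K -> `|truncate K y| <= K.
Proof. by move=> K0; rewrite /truncate; case: ifP; rewrite ?normr0. Qed.

Lemma bounded_measurable_truncate (K : R) : 0 <= K -> bounded_measurable (truncate K).
Proof.
by move=> K0; split; [exact: measurable_truncate|exists K => y; exact: norm_truncate_le].
Qed.

Variables (s M : R).
Hypotheses (s0 : 0 < s) (M0 : 0 <= M) (hM : (\int[mu]_y (`|y| `^ s)%:E <= M%:E)%E).

Let mpow : measurable_fun [set: R] (fun y : R => (`|y| `^ s)%:E).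
Proof.
apply/measurable_EFinP; apply: (measurableT_comp (measurable_powR s)).
exact: normr_measurable.
Qed.

Lemma integral_le_absolute_moment (f : R -> R) (A B : R) : bounded_measurable f ->
  (forall y, 0 <= f y) -> 0 <= A -> 0 <= B ->
  (forall y, f y <= A + B * `|y| `^ s) -> \int[mu]_y f y <= A + B * M.
Proof.
move=> bf f0 A0 B0 hf.
have h : (\int[mu]_y (f y)%:E <= (A + B * M)%:E)%E.
  apply: (@le_trans _ _ (\int[mu]_y (A%:E + B%:E * (`|y| `^ s)%:E))%E).
    apply: ge0_le_integral => //.
    - by move=> y _; rewrite lee_fin.
    - by apply/measurable_EFinP; case: bf.
    - by apply: emeasurable_funD => //; apply: emeasurable_funM.
    - by move=> y _; rewrite -EFinM -EFinD lee_fin.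
  rewrite ge0_integralD //; last 2 first.
    - by move=> y _; rewrite mule_ge0 // lee_fin powR_ge0.
    - exact: emeasurable_funM.
  rewrite integral_cst // [X in (_ * X)%E](probability_setT mu) mule1.
  rewrite ge0_integralZl_EFin //.
  rewrite EFinD EFinM leeD2l // lee_wpmul2l //.
have fin : (\int[mu]_y (f y)%:E)%E \is a fin_num.
  by apply: integrable_fin_num => //; exact: bounded_measurable_integrable.
by rewrite /Rintegral -lee_fin fineK.
Qed.

(** For a modulus between 1 and [K], the power [q - s] is at most 1 or at most [K ^ (q - s)]
    according to the sign of [q - s]; the sum of the two covers both signs. *)
Lemma powR_split (K y q : R) : 1 <= K -> s <= q \/ 1 <= `|y| -> `|y| <= K ->
  `|y| `^ q <= 1 + (1 + K `^ (q - s)) * `|y| `^ s.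
Proof.
move=> K1 hq yK.
have y0 := normr_ge0 y.
have ys := powR_ge0 `|y| s.
have Ks := powR_ge0 K (q - s).
have [y1|y1] := leP 1 `|y|; last first.
  case: hq => [sq|]; last by rewrite leNgt y1.
  have yq1 : `|y| `^ q <= 1.
    rewrite -[leRHS](congr1 (fun f => f q) (powR1 R)); apply: ge0_ler_powR; rewrite ?nnegrE ?(ltW y1) //.
    by apply: le_trans sq; exact: ltW.
  by apply: le_trans yq1 _; rewrite lerDl mulr_ge0 // addr_ge0.
have y_gt0 : 0 < `|y| by lra.
have -> : `|y| `^ q = `|y| `^ (q - s) * `|y| `^ s.
  by rewrite -powRD ?subrK // (gt_eqF y_gt0) implybT.
have : `|y| `^ (q - s) <= 1 + K `^ (q - s).
  have [qs|qs] := leP 0 (q - s).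
    have : `|y| `^ (q - s) <= K `^ (q - s).
      by apply: ge0_ler_powR; rewrite ?nnegrE //; lra.
    by lra.
  have : `|y| `^ (q - s) <= `|y| `^ 0 by apply: ler_powR => //; exact: ltW.
  by rewrite powRr0; lra.
move=> h; apply: le_trans (ler_wpM2r ys h) _; lra.
Qed.

Lemma truncate_second_moment (K : R) : 1 <= K ->
  \int[mu]_y (truncate K y ^+ 2) <= 1 + (1 + K `^ (2 - s)) * M.
Proof.
move=> K1; have K0 : 0 <= K by lra.
apply: integral_le_absolute_moment => //.
- exact: bounded_measurableX (bounded_measurable_truncate K0).
- by move=> y; rewrite sqr_ge0.
- by rewrite addr_ge0 // powR_ge0.
move=> y; rewrite /truncate; case: ifP => [yK|_]; last first.
  by rewrite expr0n /= addr_ge0 // mulr_ge0 ?powR_ge0 // addr_ge0 ?powR_ge0.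
rewrite -real_normK ?num_real //.
have [y1|y1] := leP 1 `|y|.
  by rewrite -powR_mulrn //; apply: powR_split => //; right.
apply: (@le_trans _ _ 1); first by rewrite exprn_ile1 // ltW.
by rewrite lerDl mulr_ge0 ?powR_ge0 // addr_ge0 ?powR_ge0.
Qed.

Lemma truncate_mean_le (K : R) : 1 <= K ->
  `|\int[mu]_y truncate K y| <= 1 + (1 + K `^ (1 - s)) * M.
Proof.
move=> K1; have K0 : 0 <= K by lra.
have [mt [C hC]] := bounded_measurable_truncate K0.
apply: le_trans (le_normr_Rintegral _ _) _ => //.
  by apply: bounded_measurable_integrable; exact: bounded_measurable_truncate.
apply: integral_le_absolute_moment => //.
- split; first by apply: measurableT_comp => //; exact: normr_measurable.
  by exists C => y; rewrite normr_id.
- by rewrite addr_ge0 // powR_ge0.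
move=> y; rewrite /truncate; case: ifP => [yK|_]; last first.
  by rewrite normr0 /= addr_ge0 // mulr_ge0 ?powR_ge0 // addr_ge0 ?powR_ge0.
have [y1|y1] := leP 1 `|y|.
  by rewrite -[leLHS]powRr1 //; apply: powR_split => //; right.
apply: (@le_trans _ _ 1); first by rewrite ltW.
by rewrite lerDl mulr_ge0 ?powR_ge0 // addr_ge0 ?powR_ge0.
Qed.

(** With mean 0, the truncated mean is minus the mean of the discarded part, which lives above [K],
    where the modulus is at most [K ^ (1 - s)] times its power [s]. *)
Lemma truncate_mean_centered_le (K : R) : 1 < s -> 1 <= K ->
  (\int[mu]_y y%:E = 0)%E -> `|\int[mu]_y truncate K y| <= K `^ (1 - s) * M.
Proof.
move=> s1 K1 mean0; have K0 : 0 < K by lra.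
pose g (y : R) : R := truncate K y - y.
have hg (y : R) : `|g y| <= K `^ (1 - s) * `|y| `^ s.
  rewrite /g /truncate; case: (leP `|y| K) => yK.
    by rewrite subrr normr0 mulr_ge0 ?powR_ge0.
  have y_gt0 : 0 < `|y| by lra.
  rewrite sub0r normrN -[leLHS]powRr1 //.
  have -> : `|y| `^ 1 = `|y| `^ (1 - s) * `|y| `^ s.
    by rewrite -powRD ?subrK // (gt_eqF y_gt0) implybT.
  rewrite ler_wpM2r ?powR_ge0 // -[1 - s]opprB !powRN lef_pV2 ?posrE ?powR_gt0 //.
  by apply: ge0_ler_powR; rewrite ?nnegrE ?(ltW K0) ?(ltW yK) //; lra.
have mg : measurable_fun [set: R] g.
  by apply: measurable_funB => //; exact: measurable_truncate.
have Ig : (\int[mu]_y `|(g y)%:E| <= (K `^ (1 - s) * M)%:E)%E.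
  apply: (@le_trans _ _ (\int[mu]_y ((K `^ (1 - s))%:E * (`|y| `^ s)%:E))%E).
    apply: ge0_le_integral => //.
    - by apply: measurableT_comp => //; exact/measurable_EFinP.
    - exact: emeasurable_funM.
    - by move=> y _; rewrite -EFinM lee_fin.
  rewrite ge0_integralZl_EFin // ?powR_ge0 //.
  by rewrite EFinM lee_wpmul2l // lee_fin powR_ge0.
have intg : mu.-integrable [set: R] (EFin \o g).
  apply/integrableP; split; first exact/measurable_EFinP.
  by apply: le_lt_trans Ig _; rewrite ltry.
have inttr : mu.-integrable [set: R] (EFin \o truncate K).
  by apply: bounded_measurable_integrable; apply: bounded_measurable_truncate; exact: ltW.
(* The identity is integrable as the bounded truncation minus the discarded part. *)
have intid : mu.-integrable [set: R] (EFin \o (fun y : R => y)).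
  rewrite (_ : EFin \o _ = (EFin \o truncate K) \- (EFin \o g))%E; last first.
    by apply/funext => y /=; rewrite -EFinB /g; congr EFin; ring.
  exact: integrableB.
have e : \int[mu]_y g y = \int[mu]_y truncate K y.
  rewrite RintegralB // [X in _ - X](_ : _ = 0) ?subr0 //.
  by rewrite /Rintegral mean0.
rewrite -e; apply: le_trans (le_normr_Rintegral _ _) _ => //.
rewrite /Rintegral -lee_fin fineK //.
rewrite ge0_fin_numE; last exact: integral_ge0.
by apply: le_lt_trans Ig _; rewrite ltry.
Qed.

End Moments.

(** * Vague convergence from counts on dyadic cells *)

Section VagueTopology.
Variable R : realType.

Lemma compact_uniform_continuity (f : R -> R) (K : set R) (e : R) :
  continuous f -> compact K -> 0 < e ->
  exists2 dl, 0 < dl & forall x y, K x -> `|x - y| < dl -> `|f x - f y| < e.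
Proof.
move=> cf cK e0.
pose P (dl x : R) := forall y, `|x - y| < dl -> `|f x - f y| < e.
have /compact_near_coveringP/(_ R (0^'+) P _) hK := cK.
have : \forall dl \near 0^'+, K `<=` P dl.
  apply: hK => x Kx.
  have /cvgrPdist_lt/(_ (e / 2)) [|r /= r0 hr] := cf x; first by rewrite divr_gt0.
  have r2 : 0 < r / 2 by rewrite divr_gt0.
  exists (ball x (r / 2), [set dl : R | 0 < dl < r / 2]).
    split => /=; first exact: nbhsx_ballx.
    near=> dl; apply/andP; split; near: dl; [exact: nbhs_right_gt|exact: nbhs_right_lt].
  move=> [x' dl] /= [xx' /andP[dl0 dlr]] y x'y.
  have h1 : `|f x - f x'| < e / 2.
    by apply: hr => /=; apply: lt_trans (_ : r / 2 < r) => //; lra.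
  have h2 : `|f x - f y| < e / 2.
    apply: hr => /=; rewrite -[x - y](subrKA x'); apply: le_lt_trans (ler_normD _ _) _.
    have : `|x - x'| < r / 2 by exact: xx'.
    by lra.
  rewrite -[_ - f y](subrKA (f x)); apply: le_lt_trans (ler_normD _ _) _.
  by rewrite distrC; lra.
move=> h; have [dl [dl0 hdl]] : exists dl, 0 < dl /\ K `<=` P dl.
  have : \forall dl \near 0^'+, 0 < dl /\ K `<=` P dl.
    by near=> dl; split; near: dl => //; exact: nbhs_right_gt.
  by move/filter_ex.
by exists dl => // x y Kx; exact: hdl.
Unshelve. all: by end_near. Qed.

(** The shift of the index keeps every cell away from 0, where a point measure may accumulate, so
    all counts are finite. The first [4 ^ m] cells, of width [2 ^- m], cover the points from
    [2 ^- m] to [2 ^ m], which exhausts the half-line. *)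
Definition grid_cell (m l : nat) : set R :=
  `](l.+1%:R / 2 ^+ m), (l.+2%:R / 2 ^+ m)]%classic.

Lemma measurable_grid_cell m l : measurable (grid_cell m l).
Proof. exact: measurable_itv. Qed.

Lemma grid_cell_inj m l l' x : grid_cell m l x -> grid_cell m l' x -> l = l'.
Proof.
rewrite /grid_cell /= !in_itv /= => /andP[a1 a2] /andP[b1 b2].
have p0 : (0 : R) < (2 ^+ m)^-1 by rewrite invr_gt0 exprn_gt0.
have := lt_le_trans a1 b2; have := lt_le_trans b1 a2.
by rewrite !ltr_pM2r // !ltr_nat !ltnS => h1 h2; apply/eqP; rewrite eqn_leq h1 h2.
Qed.

Lemma grid_cell_pos m l : grid_cell m l `<=` `]0, +oo[%classic.
Proof.
move=> x; rewrite /grid_cell /= !in_itv /= andbT => /andP[h _].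
by apply: lt_trans h; rewrite divr_gt0 ?exprn_gt0 // ltr0n.
Qed.

Lemma grid_cell_fin (nu : point_measure R) m l : (nu (grid_cell m l) < +oo)%E.
Proof.
have p0 : (0 : R) < 2 ^+ m by rewrite exprn_gt0.
apply: (@le_lt_trans _ _ (nu `[(l.+1%:R / 2 ^+ m), (l.+2%:R / 2 ^+ m)]%classic)).
  apply: le_measure; rewrite ?inE; [exact: measurable_itv|exact: measurable_itv|].
  by move=> x; rewrite /grid_cell /= !in_itv /= => /andP[/ltW -> ->].
apply: pm_locally_finite; first exact: segment_compact.
move=> x /=; rewrite !in_itv /= andbT => /andP[h _].
by apply: lt_le_trans h; rewrite divr_gt0 // ltr0n.
Qed.

Lemma exists_grid_cell (m : nat) (x : R) : (2 ^+ m)^-1 < x -> x <= 2 ^+ m ->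
  exists2 l, (l < 4 ^ m)%N & grid_cell m l x.
Proof.
move=> x1 x2; have p0 : (0 : R) < 2 ^+ m by rewrite exprn_gt0.
have hx : x * 2 ^+ m <= (4 ^ m)%:R.
  rewrite natrX (_ : 4 = 2 * 2 :> R); last by ring.
  by rewrite exprMn ler_pM2r.
have ex : exists k, x * 2 ^+ m <= k.+2%:R.
  by exists (4 ^ m)%N; apply: le_trans hx _; rewrite ler_nat; do 2 apply: ltnW.
case: (ex_minnP ex) => l hl lmin; exists l.
  have : (l <= (4 ^ m).-1)%N.
    apply: lmin; apply: le_trans hx _; rewrite ler_nat prednK ?expn_gt0 //.
  by rewrite -ltnS prednK // expn_gt0.
rewrite /grid_cell /= in_itv /= ler_pdivlMr // hl andbT ltr_pdivrMr //.
case: l hl lmin => [|l] hl lmin; first by rewrite -ltr_pdivrMr // mul1r.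
by rewrite ltNge; apply/negP => /lmin; rewrite ltnn.
Qed.

Lemma test_function_bounds (f : test_function R) :
  exists c C : R, [/\ 0 < c, c < C & forall x, ~ (c <= x <= C) -> f x = 0].
Proof.
have [K [cK K0 hK]] := test_support f.
have [M [_ hM]] := compact_bounded cK.
have nK0 : ~ K 0 by move/K0; rewrite /= in_itv /= ltxx.
have oK : open (~` K) by apply: closed_openC; exact: compact_closed.
have /nbhs_ballP[c /= c0 hc] : nbhs (0 : R) (~` K) by exact: open_nbhs_nbhs.
exists c, (Num.max c M + 1); split=> //.
  by rewrite ltr_pwDr // le_max lexx.
move=> x hx; apply: hK => Kx; apply: hx.
have x0 : 0 < x by have := K0 _ Kx; rewrite /= in_itv /= andbT.
apply/andP; split.
  rewrite leNgt; apply/negP => xc; apply: (hc x) => //=.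
  by rewrite /ball /= sub0r normrN gtr0_norm.
have : `|x| <= Num.max c M + 1.
  by apply: (hM _ _ x Kx); rewrite ltr_pwDr // le_max lexx orbT.
by rewrite gtr0_norm.
Qed.

Lemma integrable_indic_lty (nu : {measure set R -> \bar R}) (B : set R) :
  measurable B -> (nu B < +oo)%E -> nu.-integrable [set: R] (EFin \o \1_B).
Proof.
move=> mB fB; apply/integrableP; split.
  by apply/measurable_EFinP; exact: measurable_indic.
rewrite (eq_integral (fun x => (\1_B x)%:E)); last first.
  by move=> t _; rewrite gee0_abs // lee_fin.
by rewrite integral_indic // setIT.
Qed.

Lemma Rintegral_sum_indic (nu : {measure set R -> \bar R}) (I : finType)
    (Q : pred I) (B : I -> set R) (a : I -> R) :
  (forall i, measurable (B i)) -> (forall i, (nu (B i) < +oo)%E) ->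
  nu.-integrable [set: R] (EFin \o (fun x => \sum_(i | Q i) a i * \1_(B i) x)) /\
  \int[nu]_x (\sum_(i | Q i) a i * \1_(B i) x) = \sum_(i | Q i) a i * fine (nu (B i)).
Proof.
move=> mB fB; have int1 i : nu.-integrable [set: R] (EFin \o \1_(B i)).
  exact: integrable_indic_lty.
have inta i : nu.-integrable [set: R] (EFin \o (fun x => a i * \1_(B i) x)).
  rewrite (_ : EFin \o _ = (fun x => (a i)%:E * (EFin \o \1_(B i)) x)%E).
    exact: integrableZl.
  by apply/funext => x /=; rewrite EFinM.
elim: (index_enum I) => [|i s [IH1 IH2]].
  rewrite big_nil; under eq_Rintegral do rewrite big_nil.
  split; last by rewrite /Rintegral integral0.
  rewrite (_ : EFin \o _ = cst 0%E); first exact: integrable0.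
  by apply/funext => x /=; rewrite big_nil.
rewrite big_cons; case: ifP => Qi; last first.
  split.
    rewrite (_ : EFin \o _ = (EFin \o (fun x => \sum_(i <- s | Q i) a i * \1_(B i) x))) //.
    by apply/funext => x /=; rewrite big_cons Qi.
  by under eq_Rintegral do rewrite big_cons Qi.
split.
  rewrite (_ : EFin \o _ = ((EFin \o (fun x => a i * \1_(B i) x)%R) \+
    (EFin \o (fun x => \sum_(i <- s | Q i) a i * \1_(B i) x)%R))%E).
    exact: integrableD.
  by apply/funext => x /=; rewrite big_cons Qi -EFinD.
under eq_Rintegral do rewrite big_cons Qi.
rewrite RintegralD // IH2 RintegralZl //; congr (_ * _ + _).
by rewrite /Rintegral integral_indic // setIT.
Qed.

Lemma test_integrable (nu : point_measure R) (f : test_function R) :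
  nu.-integrable [set: R] (EFin \o f).
Proof.
have [c [C [c0 cC hf]]] := test_function_bounds f.
have mf : measurable_fun [set: R] f.
  by apply: continuous_measurable_fun; exact: test_continuous.
have cK : compact `[c, C]%classic by exact: segment_compact.
have Kfin : (nu `[c, C]%classic < +oo)%E.
  apply: pm_locally_finite => // x /=; rewrite !in_itv /= andbT => /andP[h _].
  exact: lt_le_trans h.
have /compact_bounded[M [_ hM]] : compact (f @` `[c, C]%classic).
  apply: continuous_compact => //; apply: continuous_subspaceT; exact: test_continuous.
have intK : nu.-integrable [set: R] (fun x => (`|M| + 1)%:E * (EFin \o \1_`[c, C]%classic) x)%E.
  by apply: integrableZl => //; exact: integrable_indic_lty.
apply: le_integrable intK => //; first exact/measurable_EFinP.
move=> x _ /=; rewrite lee_fin normrM indicE.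
have M1 : M < `|M| + 1 by rewrite ltr_pwDr // ler_norm.
have [xK|xK] := boolP (x \in _).
  rewrite normr1 mulr1 [leRHS]ger0_norm ?addr_ge0 //.
  by apply: (hM _ M1); exists x => //; exact: set_mem.
rewrite hf ?normr0 ?mulr_ge0 //; move=> h; move: xK; rewrite mem_set //.
Qed.

(* With the mesh fine enough for [f] to oscillate by at most [e] on a cell, the
   integral of [f] is determined by the counts of the cells meeting its support,
   up to [2 e] times the number of points near that support. *)
Lemma test_pairing_counts (f : test_function R) (mu : point_measure R) (e : R) :
  0 < e -> exists m0, forall m, (m0 <= m)%N -> forall nu : point_measure R,
    (forall l, (l < 4 ^ m)%N -> nu (grid_cell m l) = mu (grid_cell m l)) ->
    `|test_pairing mu f - test_pairing nu f| < e.
Proof.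
move=> e0; have [c [C [c0 cC hf]]] := test_function_bounds f.
(* The margin around the support [[c, C]] exceeds the mesh chosen below, so every cell meeting the
   support lies in [K], whose mass bounds the number of points involved. *)
pose K : set R := `[c / 2, C + 1]%classic.
have cK : compact K by exact: segment_compact.
have Kpos : K `<=` `]0, +oo[%classic.
  by move=> x; rewrite /K /= !in_itv /= andbT => /andP[h _]; lra.
have Kfin : (mu K < +oo)%E by exact: pm_locally_finite.
pose D := fine (mu K).
have D0 : 0 <= D by rewrite fine_ge0.
pose eta := e / (4 * (D + 1)).
have eta0 : 0 < eta by rewrite divr_gt0 // mulr_gt0 //; lra.
have [dl dl0 hdl] := compact_uniform_continuity (@test_continuous _ f) cK eta0.
pose t := Num.min dl (Num.min (c / 2) 1).
have t0 : 0 < t by rewrite !lt_min dl0 ltr01 divr_gt0.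
have [m0 hm0] : exists m0, forall m, (m0 <= m)%N -> (2 ^+ m)^-1 < t /\ C <= 2 ^+ m.
  exists (Num.truncn (Num.max t^-1 C)).+1 => m hm.
  have : Num.max t^-1 C < 2 ^+ m.
    apply: lt_le_trans (truncnS_gt _) _; rewrite -natrX ler_nat.
    by apply: leq_trans hm _; apply: ltnW; exact: ltn_expl.
  rewrite gt_max => /andP[h1 h2]; split; last exact: ltW.
  by rewrite -[t]invrK ltf_pV2 ?posrE ?exprn_gt0 // invr_gt0.
exists m0 => m /hm0[mt mC] nu hnu.
have [tdl [tc t1]] : t <= dl /\ t <= c / 2 /\ t <= 1.
  by rewrite /t !ge_min !lexx !orbT.
have p0 : (0 : R) < 2 ^+ m by rewrite exprn_gt0.
pose u (l : nat) : R := l.+1%:R / 2 ^+ m.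
have uS l : l.+2%:R / 2 ^+ m = u l + (2 ^+ m)^-1.
  by rewrite /u -[in LHS]natr1 mulrDl mul1r.
pose La (l : 'I_(4 ^ m)) : bool := (c <= u l + (2 ^+ m)^-1) && (u l <= C).
pose xl (l : 'I_(4 ^ m)) : R := u l + (2 ^+ m)^-1.
have LaK l : La l -> grid_cell m l `<=` K.
  move=> /andP[h1 h2] x; rewrite /grid_cell /K /= !in_itv /= uS => /andP[k1 k2].
  by move: k1; rewrite -/(u l) => k1; apply/andP; split; lra.
pose S (nu' : point_measure R) := \sum_(l | La l) fine (nu' (grid_cell m l)).
have key (nu' : point_measure R) :
    `|test_pairing nu' f - \sum_(l | La l) f (xl l) * fine (nu' (grid_cell m l))| <=
    eta * S nu'.
  have mc (l : 'I_(4 ^ m)) : measurable (grid_cell m l) by exact: measurable_grid_cell.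
  have fc (l : 'I_(4 ^ m)) := grid_cell_fin nu' m l.
  have [i1 e1] := Rintegral_sum_indic La (fun l => f (xl l)) mc fc.
  have [i2 e2] := Rintegral_sum_indic La (fun=> eta) mc fc.
  rewrite -e1 /S mulr_sumr -e2 /test_pairing.
  have itf := test_integrable nu' f.
  rewrite -RintegralB //.
  have itd : nu'.-integrable [set: R]
      (EFin \o (fun x => f x - \sum_(l | La l) f (xl l) * \1_(grid_cell m l) x)).
    rewrite (_ : EFin \o _ = ((EFin \o f) \- (EFin \o (fun x =>
       \sum_(l | La l) f (xl l) * \1_(grid_cell m l) x)%R))%E); last first.
      by apply/funext => x /=; rewrite -EFinB.
    exact: integrableB.
  apply: le_trans (le_normr_Rintegral _ _) _ => //.
  apply: le_Rintegral => //.
    rewrite (_ : EFin \o _ = (fun x => `|(EFin \o (fun x => f x -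
       \sum_(l | La l) f (xl l) * \1_(grid_cell m l) x)%R) x|)%E); last first.
      by apply/funext => x.
    exact: integrable_abse.
  move=> x _.
  have [[l Ll xcell]|no] := pselect (exists2 l : 'I_(4 ^ m), La l & grid_cell m l x).
    have E (a : 'I_(4 ^ m) -> R) : \sum_(l | La l) a l * \1_(grid_cell m l) x = a l.
      rewrite (bigD1 l) //= indicE mem_set // mulr1 big1 ?addr0 // => k /andP[_ kl].
      rewrite indicE memNset ?mulr0 // => xk; case/eqP: kl; apply: val_inj.
      exact: grid_cell_inj xk xcell.
    rewrite !E; apply: ltW; apply: hdl; first exact: LaK xcell.
    move: xcell; rewrite /grid_cell /= in_itv /= uS -/(xl l) -/(u l) => /andP[k1 k2].
    by rewrite /xl in k2 *; rewrite ler0_norm; lra.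
  have E (a : 'I_(4 ^ m) -> R) : \sum_(l | La l) a l * \1_(grid_cell m l) x = 0.
    rewrite big1 // => l Ll; rewrite indicE memNset ?mulr0 // => xl'.
    by apply: no; exists l.
  rewrite !E subr0 hf ?normr0 // => /andP[cx xC]; apply: no.
  have [||l l4 xcell] := @exists_grid_cell m x; [lra|lra|].
  exists (Ordinal l4) => //; move: xcell; rewrite /La /grid_cell /= in_itv /= uS -/(u l).
  by move=> /andP[k1 k2]; apply/andP; split; lra.
have Seq : S nu = S mu.
  by apply: eq_bigr => l _; rewrite hnu.
have Fe : \sum_(l | La l) f (xl l) * fine (nu (grid_cell m l)) =
          \sum_(l | La l) f (xl l) * fine (mu (grid_cell m l)).
  by apply: eq_bigr => l _; rewrite hnu.
have SD : S mu <= D.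
  have mc (l : 'I_(4 ^ m)) : measurable (grid_cell m l) by exact: measurable_grid_cell.
  have fc (l : 'I_(4 ^ m)) := grid_cell_fin mu m l.
  have [i2 e2] := Rintegral_sum_indic La (fun=> 1) mc fc.
  have mK : measurable K by exact: measurable_itv.
  have -> : D = \int[mu]_x \1_K x by rewrite /Rintegral integral_indic // setIT.
  rewrite /S; under eq_bigr do rewrite -[fine _]mul1r.
  rewrite -e2; apply: le_Rintegral => //; first exact: integrable_indic_lty.
  move=> x _; have [[l Ll xcell]|no] := pselect (exists2 l : 'I_(4 ^ m), La l & grid_cell m l x).
    rewrite (bigD1 l) //= indicE mem_set // mulr1 big1 ?addr0 => [|k /andP[_ kl]].
      by rewrite indicE mem_set //; exact: LaK xcell.
    rewrite indicE memNset ?mulr0 // => xk; case/eqP: kl; apply: val_inj.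
    exact: grid_cell_inj xk xcell.
  rewrite big1 ?indicE ?ler0n // => l Ll; rewrite indicE memNset ?mulr0 // => xl'.
  by apply: no; exists l.
have := key nu; have := key mu; rewrite Fe Seq.
have eD : eta * S mu < e / 2.
  apply: le_lt_trans (ler_wpM2l (ltW eta0) SD) _.
  rewrite /eta -mulrA (mulrC _ D) ltr_pM2l // ltr_pdivrMr ?mulr_gt0 //; lra.
set Z := \sum_(l | La l) _ => k1 k2.
rewrite -[_ - test_pairing nu f](subrKA Z); apply: le_lt_trans (ler_normD _ _) _.
by rewrite [X in _ + X]distrC; lra.
Qed.

End VagueTopology.

(** Dominated convergence with a constant bound. Measurability of the limit belongs to the
    conclusion, since continuous functionals of point processes get theirs from it. *)
Lemma bounded_convergence (R : realType) (d : measure_display) (T : measurableType d)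
    (P : probability T R) (f_ : nat -> T -> R) (f : T -> R) (C : R) :
  (forall n, measurable_fun [set: T] (f_ n)) -> (forall n x, `|f_ n x| <= C) ->
  (forall x, f_ n x @[n --> \oo] --> f x) ->
  bounded_measurable f /\ (\int[P]_x f_ n x) @[n --> \oo] --> \int[P]_x f x.
Proof.
move=> mf_ fC cvf.
have cvfE x : (f_ n x)%:E @[n --> \oo] --> (f x)%:E.
  by apply: cvg_EFin; [exact: nearW|exact: cvf].
have mf : measurable_fun [set: T] f.
  apply/measurable_EFinP; apply: (emeasurable_fun_cvg (fun n x => (f_ n x)%:E)).
    by move=> n; exact/measurable_EFinP.
  by move=> x _; exact: cvfE.
have bf : bounded_measurable f.
  split=> //; exists C => x; rewrite leNgt; apply/negP => Cf.
  have e0 : 0 < `|f x| - C by rewrite subr_gt0.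
  have /cvgrPdist_lt/(_ _ e0)/filter_ex[n hn] := cvf x.
  have := fC n x; have : `|f x| <= `|f x - f_ n x| + `|f_ n x|.
    by rewrite -{1}[f x](subrK (f_ n x)) ler_normD.
  by lra.
split=> //.
have [_ _] := @dominated_convergence _ _ _ P _ measurableT (fun n x => (f_ n x)%:E)
  (EFin \o f) (cst C%:E) (fun n => (measurable_EFinP _ _).2 (mf_ n))
  ((measurable_EFinP _ _).2 mf) (aeW _ (fun x _ => cvfE x))
  (finite_measure_integrable_cst P C measurableT) (aeW _ (fun x n _ => fC n x)).
have e : (\int[P]_x (EFin \o f) x = (\int[P]_x f x)%:E)%E.
  by rewrite /Rintegral fineK //; apply: integrable_fin_num => //; exact: bounded_measurable_integrable.
by rewrite e => /fine_cvg.
Qed.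

Section VagueContinuity.
Variable R : realType.

Definition same_counts (m : nat) (mu nu : point_measure R) : Prop :=
  forall l, (l < 4 ^ m)%N -> nu (grid_cell m l) = mu (grid_cell m l).

(** The sets containing all measures that share the counts of [mu] on every fine enough grid form a
    filter. It converges to [mu] in the vague topology by [test_pairing_counts], and continuity of
    [g] transports it. *)
Lemma continuous_same_counts (g : vague R -> R) (mu : vague R) (e : R) :
  continuous g -> 0 < e -> exists m0, forall m, (m0 <= m)%N ->
  forall nu : vague R, same_counts m mu nu -> `|g mu - g nu| < e.
Proof.
move=> cg e0.
pose F : set_system (vague R) := fun U => exists m0, forall m, (m0 <= m)%N ->
  forall nu : vague R, same_counts m mu nu -> U nu.
have FF : Filter F.
  split=> [|U V [m1 h1] [m2 h2]|U V UV [m0 h]]; first by exists 0%N.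
    exists (maxn m1 m2) => m; rewrite geq_max => /andP[k1 k2] nu hnu.
    by split; [exact: h1 hnu|exact: h2 hnu].
  by exists m0 => m hm nu hnu; apply: UV; exact: h hnu.
have Fpair : @test_pairing R @ F --> (test_pairing mu : {ptws test_function R -> R}).
  apply/cvg_sup => f U [_ [[B Bop <-] Bmu sBU]].
  have /nbhs_ballP[r /= r0 hr] : nbhs (test_pairing mu f) B by exact: open_nbhs_nbhs.
  have [m0 hm0] := test_pairing_counts f mu r0.
  by exists m0 => m hm nu hnu; apply: sBU; apply: hr; exact: hm0 hnu.
have Fmu : F --> mu.
  move=> U [_ [[B Bop <-] Bmu sBU]].
  have FB : F (@test_pairing R @^-1` B) by apply: Fpair; exact: open_nbhs_nbhs.
  exact: filterS FB.
have /cvgrPdist_lt/(_ e e0)[m0 hm0] : g @ F --> g mu by exact: (cvg_comp _ _ Fmu (cg mu)).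
by exists m0.
Qed.

Variables (g : vague R -> R) (C : R).
Hypotheses (cg : continuous g) (g0 : forall mu, 0 <= g mu) (gC : forall mu, g mu <= C).

Definition has_counts (m : nat) (c : 'I_(4 ^ m) -> nat) (mu : point_measure R) : Prop :=
  forall l : 'I_(4 ^ m), mu (grid_cell m l) = (c l)%:R%:E.

(** The best lower bound on [g] that depends on the counts alone. If no measure has the counts [c],
    the value is 0 by the convention on empty infima. *)
Definition counts_inf m (c : 'I_(4 ^ m) -> nat) : R :=
  inf [set g nu | nu in [set nu : vague R | has_counts c nu]].

Lemma counts_inf_ge0 m c : 0 <= @counts_inf m c.
Proof.
rewrite /counts_inf; set S := (X in inf X).
have [->|/set0P S0] := eqVneq S set0; first by rewrite inf0.
by apply: lb_le_inf => // _ [nu _ <-].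
Qed.

Lemma counts_inf_le m c (mu : vague R) : has_counts c mu -> @counts_inf m c <= g mu.
Proof.
move=> h; apply: ge_inf; last by exists mu.
by exists 0 => _ [nu _ <-].
Qed.

Lemma counts_inf_le_bound m c : @counts_inf m c <= C.
Proof.
have C0 : 0 <= C by apply: le_trans (g0 _) (gC (point_measure_of (fun=> 0) : vague R)); exact: 0%N.
rewrite /counts_inf; set S := (X in inf X).
have [->|/set0P [_ [nu h _]]] := eqVneq S set0; first by rewrite inf0.
exact: le_trans (counts_inf_le h) (gC _).
Qed.

Definition cell_count (m : nat) (mu : point_measure R) (l : 'I_(4 ^ m)) : nat :=
  Num.truncn (fine (mu (grid_cell m l))).

Lemma has_counts_cell_count m mu : has_counts (@cell_count m mu) mu.
Proof.
move=> l; have [k hk] := pm_integer (@measurable_grid_cell R m l) (grid_cell_fin mu m l).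
by rewrite /cell_count hk /= natrK.
Qed.

Lemma has_counts_inj m c mu : has_counts c mu -> c =1 @cell_count m mu.
Proof.
move=> h l; have := has_counts_cell_count mu l; rewrite h => -[] /eqP.
by rewrite eqr_nat => /eqP.
Qed.

Lemma counts_inf_ext m (c c' : 'I_(4 ^ m) -> nat) : c =1 c' -> counts_inf c = counts_inf c'.
Proof. by move=> /funext ->. Qed.

(** On a fine grid every measure with the counts of [mu] has a value of [g] within [e] of [g mu],
    and so does the infimum of these values. *)
Lemma cvg_counts_inf (mu : vague R) :
  counts_inf (@cell_count m mu) @[m --> \oo] --> g mu.
Proof.
apply/cvgrPdist_le => e e0.
have [m0 hm0] := continuous_same_counts mu cg e0.
exists m0 => // m /= hm.
have h1 := counts_inf_le (@has_counts_cell_count m mu).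
rewrite ger0_norm ?subr_ge0 // lerBlDr -lerBlDl.
apply: lb_le_inf; first by exists (g mu); exists mu => //; exact: has_counts_cell_count.
move=> _ [nu hnu <-].
have hs : same_counts m mu nu.
  by move=> l l4; rewrite (hnu (Ordinal l4)) (@has_counts_cell_count m mu (Ordinal l4)).
by have := hm0 _ hm _ hs; rewrite ltr_norml => /andP[]; lra.
Qed.

Section RandomPointMeasure.
Context (d : measure_display) (T : measurableType d) (P : probability T R).
Variable zeta : T -> point_measure R.
Hypothesis mzeta : forall m l, measurable_fun [set: T] (fun w => zeta w (grid_cell m l)).

Lemma measurable_has_counts m (c : 'I_(4 ^ m) -> nat) :
  measurable [set w | has_counts c (zeta w)].
Proof.
rewrite (_ : [set w | _] = \bigcap_(l in [set: 'I_(4 ^ m)])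
   ((fun w => zeta w (grid_cell m l)) @^-1` [set (c l)%:R%:E])).
  apply: fin_bigcap_measurable => [|l _]; first exact: finite_finset.
  by rewrite -[X in measurable X]setTI; apply: mzeta => //; exact: emeasurable_set1.
by apply/seteqP; split=> w /= h l; [move=> _|]; exact: h.
Qed.

(** Capping the counts at [B] makes the minorant of [g] a finite combination of indicators of count
    events, whose expectation is a finite sum of count probabilities. Beyond the cap it is 0, still
    below [g]. *)
Definition counts_step (m B : nat) (w : T) : R :=
  \sum_(c : {ffun 'I_(4 ^ m) -> 'I_B})
    counts_inf (fun l => c l) * \1_[set w | has_counts (fun l => c l) (zeta w)] w.

Lemma counts_stepE m B w : counts_step m B w =
  if [forall l : 'I_(4 ^ m), (cell_count (zeta w) l < B)%N] then counts_inf (@cell_count m (zeta w)) else 0.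
Proof.
rewrite /counts_step; case: ifPn => [/forallP hB|].
  pose c0 := [ffun l => Ordinal (hB l)].
  rewrite (bigD1 c0) //= big1 ?addr0 => [|c cc0].
    rewrite indicE mem_set ?mulr1 /=; first by apply: counts_inf_ext => l; rewrite ffunE.
    by move=> l; rewrite ffunE /=; exact: has_counts_cell_count.
  rewrite indicE memNset ?mulr0 //= => h; case/eqP: cc0; apply/ffunP => l.
  by apply: val_inj; rewrite ffunE /=; exact: (has_counts_inj h).
move=> hB; rewrite big1 // => c _; rewrite indicE memNset ?mulr0 //= => h.
case/negP: hB; apply/forallP => l; rewrite -(has_counts_inj h); exact: ltn_ord.
Qed.

Lemma bounded_measurable_counts_step m B : bounded_measurable (counts_step m B).
Proof.
apply: bounded_measurable_sum => c; apply: bounded_measurableM.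
  exact: bounded_measurable_cst.
by apply: bounded_measurable_indic; exact: measurable_has_counts.
Qed.

Let C0 : 0 <= C.
Proof. by apply: le_trans (g0 _) (gC (point_measure_of (fun=> 0) : vague R)); exact: 0%N. Qed.

Lemma counts_step_ge0 m B w : 0 <= counts_step m B w.
Proof. by rewrite counts_stepE; case: ifP => // _; exact: counts_inf_ge0. Qed.

Lemma counts_step_le m B w : counts_step m B w <= g (zeta w).
Proof.
rewrite counts_stepE; case: ifP => // _; apply: counts_inf_le.
exact: has_counts_cell_count.
Qed.

Let norm_counts_step m B w : `|counts_step m B w| <= C.
Proof.
rewrite ger0_norm; last exact: counts_step_ge0.
exact: le_trans (counts_step_le m B w) (gC _).
Qed.

Lemma cvg_counts_step m w :
  counts_step m B w @[B --> \oo] --> counts_inf (@cell_count m (zeta w)).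
Proof.
apply: (cvg_near_eq (g := fun=> counts_inf (@cell_count m (zeta w)))); first exact: cvg_cst.
exists (\max_(l : 'I_(4 ^ m)) cell_count (zeta w) l).+1 => // B /= hB.
rewrite counts_stepE; case: ifPn => // /forallPn[l]; rewrite -leqNgt => hl.
have := leq_trans hB hl; rewrite ltnNge => /negP[].
exact: (leq_bigmax (F := fun l : 'I_(4 ^ m) => cell_count (zeta w) l) l).
Qed.

Let cvg_step m := @bounded_convergence _ _ _ P (counts_step m) _ C
  (fun B => (bounded_measurable_counts_step m B).1)
  (norm_counts_step m) (fun w => @cvg_counts_step m w).

Let cvg_inf := @bounded_convergence _ _ _ P (fun m w => counts_inf (@cell_count m (zeta w)))
  (fun w => g (zeta w)) C (fun m => (cvg_step m).1.1).

(** Two successive limits, first in the cap [B], then in the grid [m], lead from count events to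
    [g]. Each step carries measurability along with the convergence of integrals. *)
Lemma cvg_integral_counts :
  bounded_measurable (fun w => g (zeta w)) /\
  forall e, 0 < e -> exists m B,
    \int[P]_w g (zeta w) - e <= \int[P]_w counts_step m B w.
Proof.
have [] := cvg_inf.
- move=> m w; rewrite ger0_norm; last exact: counts_inf_ge0.
  exact: counts_inf_le_bound.
- by move=> w; exact: cvg_counts_inf.
move=> bg cv; split=> // e e0.
have e2 : 0 < e / 2 by rewrite divr_gt0.
have /cvgrPdist_lt/(_ _ e2)/filter_ex[m hm] := cv.
have /cvgrPdist_lt/(_ _ e2)/filter_ex[B hB] := (cvg_step m).2.
exists m, B; move: hm hB; rewrite !ltr_norml => /andP[_ h1] /andP[_ h2]; lra.
Qed.

Lemma integral_counts_step m B : \int[P]_w counts_step m B w =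
  \sum_(c : {ffun 'I_(4 ^ m) -> 'I_B}) counts_inf (fun l => c l) *
    fine (P [set w | has_counts (fun l => c l) (zeta w)]).
Proof.
rewrite integral_bm_sum => [|c]; last first.
  apply: bounded_measurableM; first exact: bounded_measurable_cst.
  by apply: bounded_measurable_indic; exact: measurable_has_counts.
apply: eq_bigr => c _; rewrite integral_bmZ; last first.
  by apply: bounded_measurable_indic; exact: measurable_has_counts.
by rewrite integral_bm_indic //; exact: measurable_has_counts.
Qed.

End RandomPointMeasure.

Section Liminf.
Context (d : nat -> measure_display) (T : forall n, measurableType (d n))
  (P : forall n, probability (T n) R) (xi : forall n, T n -> point_measure R)
  (d' : measure_display) (T' : measurableType d') (Q : probability T' R)
  (eta : T' -> point_measure R).
Hypotheses
  (mxi : forall n m l, measurable_fun [set: T n] (fun w => @xi n w (grid_cell m l)))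
  (meta : forall m l, measurable_fun [set: T'] (fun w => eta w (grid_cell m l)))
  (hcounts : forall m (c : 'I_(4 ^ m) -> nat) e, 0 < e -> \forall n \near \oo,
     fine (Q [set w | has_counts c (eta w)]) - e <=
     fine (P n [set w | has_counts c (@xi n w)])).

Lemma liminf_integral_vague (e : R) : 0 < e ->
  \forall n \near \oo, \int[Q]_w g (eta w) - e <= \int[P n]_w g (@xi n w).
Proof.
move=> e0; have e2 : 0 < e / 2 by rewrite divr_gt0.
have [bg /(_ _ e2)[m [B hmB]]] := cvg_integral_counts Q meta.
have C0 : 0 <= C by apply: le_trans (g0 _) (gC (point_measure_of (fun=> 0) : vague R)); exact: 0%N.
pose K : R := #|{ffun 'I_(4 ^ m) -> 'I_B}|%:R.
have K0 : 0 <= K by rewrite ler0n.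
(* The sum runs over [K] count vectors with coefficients at most [C], so an error [r] on each
   probability costs at most [e / 2] in total. *)
pose r := (e / 2) / ((C + 1) * (K + 1)).
have r0 : 0 < r by rewrite divr_gt0 // mulr_gt0 // ltr_wpDl.
have rCK : C * r * K <= e / 2.
  have D0 : 0 < (C + 1) * (K + 1) by rewrite mulr_gt0 // ltr_wpDl.
  rewrite (_ : C * r * K = e / 2 * (C * K / ((C + 1) * (K + 1)))); last by rewrite /r; ring.
  by rewrite ler_piMr ?(ltW e2) // ler_pdivrMr // mul1r; nra.
have : \forall n \near \oo, forall c : {ffun 'I_(4 ^ m) -> 'I_B},
    fine (Q [set w | has_counts (fun l => c l) (eta w)]) - r <=
    fine (P n [set w | has_counts (fun l => c l) (@xi n w)]).
  by apply: filter_forall => c; exact: hcounts.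
apply: filterS => n hn.
have [bgn _] := cvg_integral_counts (P n) (@mxi n).
apply: (@le_trans _ _ (\int[P n]_w counts_step (@xi n) m B w)); last first.
  apply: le_integral_bm => //; first exact: bounded_measurable_counts_step.
  by move=> w; exact: counts_step_le.
have : \int[Q]_w counts_step eta m B w - C * r * K <= \int[P n]_w counts_step (@xi n) m B w.
  rewrite !integral_counts_step // lerBlDr.
  have -> : C * r * K = \sum_(c : {ffun 'I_(4 ^ m) -> 'I_B}) C * r.
    by rewrite sumr_const -mulr_natr.
  rewrite -big_split; apply: ler_sum => c _ /=.
  have v0 := counts_inf_ge0 (fun l => c l); have vC := counts_inf_le_bound (fun l => c l).
  have := hn c; rewrite lerBlDr => h.
  apply: le_trans (ler_wpM2l v0 h) _; rewrite mulrDr lerD2l.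
  by rewrite ler_wpM2r // ltW.
lra.
Qed.

End Liminf.
End VagueContinuity.

(** The hypothesis on count probabilities is one-sided because both [g + C] and [C - g] are
    nonnegative and receive the lower bound. *)
Lemma cvg_in_distribution_counts (R : realType) (d : nat -> measure_display)
    (T : forall n, measurableType (d n)) (P : forall n, probability (T n) R)
    (xi : forall n, T n -> point_measure R)
    (d' : measure_display) (T' : measurableType d') (Q : probability T' R)
    (eta : T' -> point_measure R) :
  (forall n m l, measurable_fun [set: T n] (fun w => xi n w (grid_cell m l))) ->
  (forall m l, measurable_fun [set: T'] (fun w => eta w (grid_cell m l))) ->
  (forall m (c : 'I_(4 ^ m) -> nat) e, 0 < e -> \forall n \near \oo,
     fine (Q [set w | has_counts c (eta w)]) - e <=
     fine (P n [set w | has_counts c (xi n w)])) ->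
  cvg_in_distribution P xi Q eta.
Proof.
move=> mxi meta hcounts g cg [C0 hC0].
pose C : R := `|C0|.
have hC mu : `|g mu| <= C by apply: le_trans (hC0 mu) (ler_norm _).
have gC mu : - C <= g mu <= C by rewrite -ler_norml.
pose g1 (mu : vague R) : R := g mu + C.
pose g2 (mu : vague R) : R := C - g mu.
have Fmu (mu : vague R) : Filter (nbhs mu) by exact: nbhs_filter.
have cg1 : continuous g1 by move=> mu; apply: cvgD; [exact: cg|exact: cvg_cst].
have cg2 : continuous g2 by move=> mu; apply: (cvgB (f := fun=> C) (g := g)); [exact: cvg_cst|exact: cg].
have g1_ge0 mu : 0 <= g1 mu by have := gC mu; rewrite /g1; lra.
have g1_le mu : g1 mu <= 2 * C by have := gC mu; rewrite /g1; lra.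
have g2_ge0 mu : 0 <= g2 mu by have := gC mu; rewrite /g2; lra.
have g2_le mu : g2 mu <= 2 * C by have := gC mu; rewrite /g2; lra.
have bm (d1 : measure_display) (T1 : measurableType d1) (P1 : probability T1 R)
    (z : T1 -> point_measure R) :
    (forall m l, measurable_fun [set: T1] (fun w => z w (grid_cell m l))) ->
    [/\ bounded_measurable (fun w => g (z w)),
     \int[P1]_w g1 (z w) = \int[P1]_w g (z w) + C &
     \int[P1]_w g2 (z w) = C - \int[P1]_w g (z w)].
  move=> mz; have [b1 _] := cvg_integral_counts cg1 g1_ge0 g1_le P1 mz.
  have bc c := @bounded_measurable_cst _ T1 R c.
  have b : bounded_measurable (fun w => g (z w)).
    rewrite (_ : (fun w => g (z w)) = fun w => g1 (z w) + - C).
      exact: bounded_measurableD.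
    by apply/funext => w; rewrite /g1 addrK.
  split=> //.
    by rewrite integral_bmD // integral_bm_cst.
  rewrite /g2; under eq_Rintegral do rewrite -mulN1r.
  have bN : bounded_measurable (fun w => -1 * g (z w)) by exact: bounded_measurableM.
  by rewrite integral_bmD // integral_bm_cst integral_bmZ // mulN1r.
have EE (d1 : measure_display) (T1 : measurableType d1) (P1 : probability T1 R)
    (X : T1 -> R) : bounded_measurable X -> ('E_P1[X] = (\int[P1]_w X w)%:E)%E.
  move=> bX; rewrite unlock /Rintegral fineK //.
  by apply: integrable_fin_num => //; exact: bounded_measurable_integrable.
have [bQ Q1 Q2] := bm _ _ Q eta meta.
rewrite EE //.
rewrite (_ : (fun n => _) = (fun n => (\int[P n]_w g (xi n w))%:E)); last first.
  by apply/funext => n; rewrite EE //; case: (bm _ _ (P n) (xi n) (mxi n)).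
apply: cvg_EFin; first exact: nearW.
apply/cvgrPdist_le => e e0.
have h1 := liminf_integral_vague cg1 g1_ge0 g1_le mxi meta hcounts e0.
have h2 := liminf_integral_vague cg2 g2_ge0 g2_le mxi meta hcounts e0.
apply: filterS2 h1 h2 => n; have [_ -> ->] := bm _ _ (P n) (xi n) (mxi n).
by rewrite Q1 Q2 /= ler_norml => k1 k2; apply/andP; split; lra.
Qed.

(** * Truncation of a random matrix with independent entries *)

Section UnionBound.
Context (R : realType) (d : measure_display) (T : measurableType d) (P : probability T R).

Lemma probability_union_le (I : finType) (Q : pred I) (A : I -> set T) :
  (forall i, measurable (A i)) ->
  measurable [set w | exists2 i, Q i & A i w] /\
  fine (P [set w | exists2 i, Q i & A i w]) <= \sum_(i | Q i) fine (P (A i)).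
Proof.
move=> mA.
have mU : measurable [set w | exists2 i, Q i & A i w].
  rewrite (_ : [set w | _] = \bigcup_(i in [set i | Q i]) A i).
    by apply: fin_bigcup_measurable => //; exact: finite_finset.
  by apply/seteqP; split=> w /= [i Qi Ai]; exists i.
split=> //; rewrite -integral_bm_indic // big_mkcond /=.
under eq_bigr => i _ do rewrite -(integral_bm_indic P (mA i)).
pose f (i : I) (w : T) : R := (Q i)%:R * \1_(A i) w.
have bf i : bounded_measurable (f i).
  apply: bounded_measurableM; first exact: bounded_measurable_cst.
  exact: bounded_measurable_indic.
rewrite (eq_bigr (fun i => \int[P]_w f i w)) => [|i _]; last first.
  rewrite /f integral_bmZ; last exact: bounded_measurable_indic.
  by case: (Q i); rewrite ?mul1r ?mul0r.
rewrite -integral_bm_sum //; apply: le_integral_bm.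
- exact: bounded_measurable_indic.
- exact: bounded_measurable_sum.
have f0 i w : 0 <= f i w by rewrite /f mulr_ge0 // indicE.
move=> w; rewrite indicE; have [/set_mem [i Qi Ai]|_] := boolP (w \in _); last first.
  by rewrite sumr_ge0.
by rewrite (bigD1 i) //= {1}/f Qi indicE mem_set // mul1r lerDl sumr_ge0.
Qed.

Lemma probability_le_sub (A B : set T) : measurable A -> measurable B ->
  A `<=` B -> fine (P A) <= fine (P B).
Proof.
by move=> mA mB AB; rewrite fine_le ?fin_num_measure // le_measure ?inE.
Qed.

Lemma probability_setU_le (A B : set T) : measurable A -> measurable B ->
  fine (P (A `|` B)) <= fine (P A) + fine (P B).
Proof.
move=> mA mB; rewrite -fineD ?fin_num_measure // fine_le ?fin_numD ?fin_num_measure //.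
  exact: measurableU.
exact: measureU2.
Qed.

End UnionBound.

Lemma mutually_independent_comp (R : realType) (d : measure_display) (T : measurableType d)
    (P : probability T R) (d1 d2 : measure_display) (U : measurableType d1)
    (V : measurableType d2) (I : finType) (X : I -> T -> U) (f : U -> V) :
  measurable_fun [set: U] f -> mutually_independent P X ->
  mutually_independent P (fun i w => f (X i w)).
Proof.
move=> mf indX B mB; apply: (indX (fun i => f @^-1` B i)) => i.
by rewrite -[X in measurable X]setTI; exact: mf.
Qed.

Section IidMatrix.
Context (R : realType) (d : measure_display) (T : measurableType d) (P : probability T R).
Variables (mu : probability R R) (n p : nat) (a : 'I_n -> 'I_p -> {RV P >-> R}).
Hypotheses (hlaw : forall i j (B : set R), measurable B -> distribution P (a i j) B = mu B)
  (hindep : mutually_independent P (fun (ij : 'I_n * 'I_p) (w : T) => a ij.1 ij.2 w)).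
Local Notation G := (abs_tail mu).
Let X (e : 'I_n * 'I_p) (w : T) : R := a e.1 e.2 w.

Lemma measurable_entry e : measurable_fun [set: T] (X e).
Proof. exact: measurable_funPT. Qed.

Lemma entry_law e (B : set R) : measurable B -> P (X e @^-1` B) = mu B.
Proof. exact: hlaw. Qed.

Lemma integral_entry e (phi : R -> R) : bounded_measurable phi ->
  \int[P]_w phi (X e w) = \int[mu]_y phi y.
Proof.
move=> bphi; rewrite /Rintegral; congr fine.
have bX : bounded_measurable (fun w => phi (X e w)).
  case: bphi => [mphi [C hC]]; split; last by exists C.
  exact: measurableT_comp mphi (measurable_entry e).
transitivity (\int[distribution P (a e.1 e.2)]_y (phi y)%:E)%E.
  rewrite integral_distribution //; first by apply/measurable_EFinP; case: bphi.
  exact: bounded_measurable_integrable bX.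
by apply: eq_measure_integral => B mB _; exact: hlaw.
Qed.

Lemma prob_large e (K : R) : fine (P [set w | K < `|X e w|]) = G K.
Proof.
rewrite abs_tailE -(entry_law e) //.
by apply: measurable_set_lt; [exact: measurable_cst|exact: normr_measurable].
Qed.

Lemma measurable_large e (K : R) : measurable [set w | K < `|X e w|].
Proof.
apply: measurable_set_lt; first exact: measurable_cst.
exact: measurableT_comp (measurable_entry e).
Qed.

Lemma prob_two_large e e' (K : R) : e != e' ->
  fine (P ([set w | K < `|X e w|] `&` [set w | K < `|X e' w|])) = G K ^+ 2.
Proof.
move=> ee'.
pose A := [set y : R | K < `|y|].
have mA : measurable A.
  by apply: measurable_set_lt; [exact: measurable_cst|exact: normr_measurable].
pose B f := if (f == e) || (f == e') then A else setT.
have mB f : measurable (B f) by rewrite /B; case: ifP.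
have := hindep mB.
rewrite (_ : \bigcap_(i in _) _ = [set w | K < `|X e w|] `&` [set w | K < `|X e' w|]); last first.
  apply/seteqP; split=> w /=.
    move=> h; have := h e I; have := h e' I.
    by rewrite /B !eqxx orbT.
  move=> [h1 h2] f _; rewrite /B; case: ifP => // /orP[/eqP ->|/eqP ->].
    exact: h1.
  exact: h2.
move=> ->; rewrite (bigD1 e) //= (bigD1 e') 1?eq_sym //= big1 ?mule1; last first.
  move=> f /andP[fe fe']; rewrite /B (negPf fe) (negPf fe') preimage_setT.
  exact: probability_setT.
rewrite {1}/B {1}/B !eqxx orbT /=.
rewrite -[in X in fine X](fineK (fin_num_measure P _ (measurable_large e K))).
rewrite -[X in (_ * X)%E](fineK (fin_num_measure P _ (measurable_large e' K))).
by rewrite -EFinM /= !prob_large expr2.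
Qed.

Definition same_line (ee : ('I_n * 'I_p) * ('I_n * 'I_p)) : bool :=
  (ee.1 != ee.2) && ((ee.1.1 == ee.2.1) || (ee.1.2 == ee.2.2)).

Definition clash (K : R) : set T :=
  [set w | exists2 ee, same_line ee & ([set w | K < `|X ee.1 w|] `&` [set w | K < `|X ee.2 w|]) w].

(** A pair on one line is a position together with a second column or a second row, which leaves at
    most [n * p * (n + p)] pairs. *)
Lemma card_same_line : (#|same_line| <= (n + p) ^ 3)%N.
Proof.
pose f (x : 'I_n * 'I_p * 'I_p + 'I_n * 'I_p * 'I_n) : ('I_n * 'I_p) * ('I_n * 'I_p) :=
  match x with
  | inl (i, j, j') => ((i, j), (i, j'))
  | inr (i, j, i') => ((i, j), (i', j))
  end.
apply: (@leq_trans #|[seq f x | x in predT]|).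
  apply: subset_leq_card; apply/fintype.subsetP => -[[i j] [i' j']].
  rewrite unfold_in /same_line /= => /andP[_ /orP[/eqP <-|/eqP <-]]; apply/fintype.imageP.
    by exists (inl (i, j, j')).
  by exists (inr (i, j, i')).
apply: leq_trans (leq_image_card _ _) _.
rewrite card_sum !card_prod !card_ord -mulnDr addnC expnSr leq_mul // expnSr expn1.
by rewrite leq_mul ?leq_addr ?leq_addl.
Qed.

Lemma prob_clash (K : R) : measurable (clash K) /\
  fine (P (clash K)) <= (n + p)%:R ^+ 3 * G K ^+ 2.
Proof.
have [|m1 m2] := probability_union_le P same_line (A := fun ee =>
  [set w | K < `|X ee.1 w|] `&` [set w | K < `|X ee.2 w|]).
  by move=> ee; apply: measurableI; exact: measurable_large.
split=> //; apply: le_trans m2 _.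
rewrite (eq_bigr (fun=> G K ^+ 2)) => [|[e e'] /= /andP[ee' _]]; last exact: prob_two_large.
rewrite sumr_const -[X in X <= _]mulr_natl ler_wpM2r ?sqr_ge0 // -natrX ler_nat.
exact: card_same_line.
Qed.

Definition near_level (u v : R) : set T :=
  [set w | exists2 e : 'I_n * 'I_p, true & ([set w | u < `|X e w|] `\` [set w | v < `|X e w|]) w].

Lemma prob_near_level (u v : R) : u <= v -> measurable (near_level u v) /\
  fine (P (near_level u v)) <= (n * p)%:R * (G u - G v).
Proof.
move=> uv.
have [|m1 m2] := probability_union_le P predT (A := fun e =>
  [set w | u < `|X e w|] `\` [set w | v < `|X e w|]).
  by move=> e; apply: measurableD; exact: measurable_large.
split=> //; apply: le_trans m2 _.
rewrite (eq_bigr (fun=> G u - G v)) => [|e _].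
  by rewrite sumr_const -[X in X <= _]mulr_natl card_prod !card_ord.
rewrite -(prob_large e u) -(prob_large e v) -fineB ?fin_num_measure //; try exact: measurable_large.
congr fine; rewrite measureD; try exact: measurable_large.
  congr (_ - P _)%E; apply/seteqP; split=> w /=; first by case.
  by move=> h; split=> //; exact: le_lt_trans h.
by rewrite -ge0_fin_numE // fin_num_measure //; exact: measurable_large.
Qed.

Variables (K r N : R).
Hypotheses (K0 : 0 <= K) (r2K : 2 * K <= r) (N0 : 0 < N) (VN : (n + p)%:R <= N)
  (hr : N * \int[mu]_y (truncate K y ^+ 2) <= r ^+ 2).

Let mK := \int[mu]_y truncate K y.
Definition centered_entry (e : 'I_n * 'I_p) (w : T) : R := truncate K (X e w) - mK.

Let phi (y : R) : R := truncate K y - mK.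

Let btr := @bounded_measurable_truncate R K K0.

Let bphi : bounded_measurable phi.
Proof.
by apply: bounded_measurableD => //; exact: bounded_measurable_cst.
Qed.

Let mK_le : `|mK| <= K.
Proof.
by apply: norm_integral_bm_le => // y; exact: norm_truncate_le.
Qed.

Let phi_le y : `|phi y| <= 2 * K.
Proof.
apply: le_trans (ler_normB _ _) _; have := norm_truncate_le y K0; have := mK_le; lra.
Qed.

Lemma bounded_measurable_centered_entry e : bounded_measurable (centered_entry e).
Proof.
case: bphi => mphi [C hC]; split; last by exists C => w; exact: hC.
exact: measurableT_comp mphi (measurable_entry e).
Qed.

Lemma centered_entry_independent : mutually_independent P centered_entry.
Proof. by apply: (mutually_independent_comp (f := phi)) hindep; case: bphi. Qed.

(** The two conditions on [r] serve here. The first moment vanishes by centering; for higher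
    moments, two factors give a variance of at most [r ^+ 2 / N], and each of the others is at most
    [2 * K], hence at most [r]. *)
Lemma centered_entry_moments e (c : nat) : (0 < c)%N ->
  `|\int[P]_w (centered_entry e w ^+ c)| <= r ^+ c / N.
Proof.
move=> c0; have r0 : 0 <= r  by apply: le_trans r2K; rewrite mulr_ge0.
rewrite (integral_entry e (phi := fun y => phi y ^+ c)); last exact: bounded_measurableX.
case: c c0 => [//|[_|c _]].
  under eq_Rintegral do rewrite expr1.
  rewrite /phi integral_bmD //; last exact: bounded_measurable_cst.
  by rewrite integral_bm_cst -/mK subrr normr0 expr1 divr_ge0 // ltW.
have b2 : bounded_measurable (fun y => phi y ^+ 2) by exact: bounded_measurableX.
have bt2 : bounded_measurable (fun y => truncate K y ^+ 2) by exact: bounded_measurableX.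
have var : \int[mu]_y (phi y ^+ 2) <= \int[mu]_y (truncate K y ^+ 2).
  have -> : \int[mu]_y (phi y ^+ 2) =
      \int[mu]_y (truncate K y ^+ 2) - mK ^+ 2.
    transitivity (\int[mu]_y (truncate K y ^+ 2 + ((- 2 * mK) * truncate K y + mK ^+ 2))).
      by apply: eq_Rintegral => y _; rewrite /phi; ring.
    rewrite integral_bmD //; last first.
      apply: bounded_measurableD; last exact: bounded_measurable_cst.
      by apply: bounded_measurableM => //; exact: bounded_measurable_cst.
    rewrite integral_bmD; [|by apply: bounded_measurableM => //; exact: bounded_measurable_cst|exact: bounded_measurable_cst].
    by rewrite integral_bmZ // integral_bm_cst -/mK; ring.
  by rewrite gerBl sqr_ge0.
apply: (@le_trans _ _ (\int[mu]_y ((2 * K) ^+ c * phi y ^+ 2))).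
  apply: le_trans (le_normr_Rintegral _ _) _ => //.
    by apply: bounded_measurable_integrable; exact: bounded_measurableX.
  apply: le_integral_bm.
  - have [m1 [C hC]] := bounded_measurableX c.+2 bphi.
    split; first by apply: measurableT_comp => //; exact: normr_measurable.
    by exists C => y; rewrite normr_id.
  - by apply: bounded_measurableM => //; exact: bounded_measurable_cst.
  move=> y; rewrite normrX -addn2 exprD -[phi y ^+ 2]real_normK ?num_real //.
  by rewrite ler_wpM2r ?sqr_ge0 // lerXn2r // nnegrE mulr_ge0.
rewrite integral_bmZ //.
apply: (@le_trans _ _ (r ^+ c * (r ^+ 2 / N))); last first.
  by rewrite mulrA -exprD addn2.
apply: ler_pM; rewrite ?exprn_ge0 ?mulr_ge0 //.
- by apply: Rintegral_ge0 => y _; rewrite sqr_ge0.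
- by rewrite lerXn2r // nnegrE mulr_ge0.
- by apply: le_trans var _; rewrite ler_pdivlMr // mulrC.
Qed.

(** A trace moment stands in for the operator norm: as a polynomial in the entries it is measurable
    at once. *)
Definition big_norm (k : nat) (rho : R) : set T :=
  [set w | (rho ^+ 2) ^+ (2 ^ k) <= \tr (bipartite_mx centered_entry w ^+ (2 ^ k.+1))].

Lemma prob_big_norm (k : nat) (rho : R) : 0 < rho -> measurable (big_norm k rho) /\
  fine (P (big_norm k rho)) <= (r / rho) ^+ (2 ^ k.+1) * N * (2 ^ k.+1)`!%:R.
Proof.
move=> rho0; have r0 : 0 <= r by apply: le_trans r2K; rewrite mulr_ge0.
split.
  apply: measurable_set_le; first exact: measurable_cst.
  exact: (bounded_measurable_trace bounded_measurable_centered_entry _).1.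
exact: (probability_trace_ge bounded_measurable_centered_entry
  centered_entry_independent r0 N0 VN centered_entry_moments k rho0).
Qed.

(** The truncated matrix is the centered one plus a constant matrix. The Frobenius norm of the
    latter is the modulus of [mK] times the root of [n * p], hence at most [rho], and the two parts
    add up to [2 * rho]. *)
Lemma sqnorm_truncated_le (k : nat) (rho : R) (w : T) (v : 'rV[R]_n) : 0 < rho ->
  ~ big_norm k rho w -> `|mK| * N <= rho ->
  sqnorm (v *m \matrix_(i, j) truncate K (a i j w)) <= (2 * rho) ^+ 2 * sqnorm v.
Proof.
move=> rho0 hw hmK.
have s0 := sqnorm_ge0 v.
have -> : \matrix_(i, j) truncate K (a i j w) =
   \matrix_(i, j) centered_entry (i, j) w + const_mx mK :> 'M[R]_(n, p).
  by apply/matrixP => i j; rewrite !mxE subrK.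
rewrite mulmxDr.
have h1 : sqnorm (v *m \matrix_(i, j) centered_entry (i, j) w) <=
    (rho * Num.sqrt (sqnorm v)) ^+ 2.
  rewrite exprMn sqr_sqrtr //; apply: (sqnorm_random_mulmx_le (m := k)); first exact: ltW.
  by rewrite leNgt; apply/negP => h; apply: hw; exact: ltW.
have h2 : sqnorm (v *m (const_mx mK : 'M[R]_(n, p))) <= (rho * Num.sqrt (sqnorm v)) ^+ 2.
  rewrite exprMn sqr_sqrtr //.
  apply: le_trans (sqnorm_mulmx_le_trace _ _) _; rewrite mulrC ler_wpM2r //.
  have -> : \tr ((const_mx mK : 'M[R]_(n, p)) *m (const_mx mK)^T) = mK ^+ 2 * (n * p)%:R.
    rewrite /mxtrace (eq_bigr (fun=> mK ^+ 2 * p%:R)) => [|i _].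
      by rewrite sumr_const card_ord mulnC natrM mulrA [RHS]mulr_natr.
    rewrite mxE (eq_bigr (fun=> mK ^+ 2)) => [|j _]; last by rewrite !mxE expr2.
    by rewrite sumr_const card_ord mulr_natr.
  apply: (@le_trans _ _ ((`|mK| * N) ^+ 2)); last first.
    by apply: lerXn2r => //; rewrite nnegrE; [exact: mulr_ge0 (normr_ge0 _) (ltW N0)|exact: ltW].
  rewrite exprMn real_normK ?num_real // ler_wpM2l ?sqr_ge0 //.
  apply: (@le_trans _ _ ((n + p)%:R ^+ 2)).
    by rewrite -natrX ler_nat expnS expn1 leq_mul ?leq_addr ?leq_addl.
  by rewrite lerXn2r // nnegrE ?ler0n // ltW.
have rs : 0 <= rho * Num.sqrt (sqnorm v) by rewrite mulr_ge0 ?sqrtr_ge0 // ltW.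
apply: le_trans (sqnormD_le rs rs h1 h2) _.
by rewrite -{3}(sqr_sqrtr s0) -exprMn; rewrite (_ : _ + _ = 2 * rho * Num.sqrt (sqnorm v)) //; ring.
Qed.

End IidMatrix.

Lemma card_pred_diff (I : finType) (Q1 Q2 : pred I) :
  (forall i, Q2 i -> Q1 i) -> #|[pred i | Q1 i && ~~ Q2 i]| = (#|Q1| - #|Q2|)%N.
Proof.
move=> Q21; rewrite -(cardID Q2 Q1) (_ : #|[predI Q1 & Q2]| = #|Q2|); last first.
  by apply: eq_card => i; rewrite !inE; apply: andb_idl; exact: Q21.
by rewrite addKn; apply: eq_card => i; rewrite !inE andbC.
Qed.

Lemma point_measure_of_itv (R : realType) (n : nat) (x : 'I_n -> R) (u v : R) :
  0 < u -> u <= v ->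
  point_measure_of x `]u, v]%classic =
  (#|[pred i | (u < x i)%R]| - #|[pred i | (v < x i)%R]|)%:R%:E.
Proof.
move=> u0 uv.
rewrite -card_pred_diff => [|i]; last exact: le_lt_trans.
change (point_measure_of x `]u, v]%classic) with (sum_dirac x `]u, v]%classic).
rewrite sum_diracE -sum1_card natr_sum -sumEFin [RHS]big_mkcond /=.
apply: eq_bigr => i _; rewrite diracE inE -leNgt.
have -> : (x i \in `]u, v]%classic `&` `]0, +oo[%classic) = (u < x i <= v).
  apply/idP/idP => [/set_mem[/= + _]|h]; first by rewrite in_itv.
  apply/mem_set; split; rewrite /= in_itv //= andbT.
  by case/andP: h => h _; exact: lt_trans h.
by case: ifP.
Qed.

(** * Equality of eigenvalue and entry counts outside the bad events *)

Section GoodEvent.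
Context (R : realType) (d : measure_display) (T : measurableType d) (P : probability T R).
Variables (mu : probability R R) (n p : nat) (a : 'I_n -> 'I_p -> {RV P >-> R}).
Variables (K N rho : R) (k : nat) (w : T) (lam : 'I_n -> R).
Hypotheses (K0 : 0 <= K) (N0 : 0 < N) (VN : (n + p)%:R <= N) (rho0 : 0 < rho)
  (hmean : `|\int[mu]_y truncate K y| * N <= rho)
  (no_clash : ~ clash a K w) (small_norm : ~ big_norm mu a K k rho w)
  (hlam : char_poly ((\matrix_(i, j) a i j w) *m (\matrix_(i, j) a i j w)^T) =
     \prod_(i < n) ('X - (lam i)%:P)).

Let A : 'M[R]_(n, p) := \matrix_(i, j) a i j w.

Let sparse i j i' j' : K < `|A i j| -> K < `|A i' j'| ->
  (i == i') || (j == j') -> (i, j) = (i', j').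
Proof.
rewrite !mxE => h h' e; apply/eqP/negPn/negP => ne; apply: no_clash.
by exists ((i, j), (i', j')); rewrite /same_line /= ?ne.
Qed.

Let small v : sqnorm (v *m (A - large_part A K)) <= (2 * rho) ^+ 2 * sqnorm v.
Proof.
rewrite (_ : A - large_part A K = \matrix_(i, j) truncate K (a i j w)).
  exact: (sqnorm_truncated_le N0 VN v rho0 small_norm hmean).
apply/matrixP => i j; rewrite !mxE /truncate leNgt; case: ifP => _ /=.
  by rewrite subrr.
by rewrite subr0.
Qed.

(** The spectral comparison shifts levels by [2 * rho] either way. As no modulus lies within that
    window around [z], the entry counts at both shifted levels equal the count at [z]. *)
Lemma card_eigenvalue_eq_large (z : R) : K <= z - 2 * rho ->
  ~ near_level a (z - 2 * rho) (z + 2 * rho) w ->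
  #|[pred i | z ^+ 2 < lam i]| = #|[pred e : 'I_n * 'I_p | z < `|a e.1 e.2 w|]|.
Proof.
move=> Kz no_near.
have r2 : 0 <= 2 * rho by rewrite mulr_ge0 // ltW.
have jump (e : 'I_n * 'I_p) : z - 2 * rho < `|a e.1 e.2 w| -> z + 2 * rho < `|a e.1 e.2 w|.
  move=> h; rewrite ltNge; apply/negP => h'; apply: no_near.
  by exists e => //; split => //=; apply/negP; rewrite -leNgt.
apply/eqP; rewrite eqn_leq; apply/andP; split.
  have := card_eigenvalue_le_large K0 sparse Kz r2 small hlam.
  rewrite !cardsE subrK => h; apply: leq_trans h _; apply: subset_leq_card.
  apply/fintype.subsetP => e; rewrite unfold_in [A _ _]mxE => /jump; apply: le_lt_trans.
  by rewrite lerDl.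
have Kz' : K <= z + 2 * rho by apply: le_trans Kz _; rewrite lerD2l ge0_cp.
have := card_large_le_eigenvalue K0 sparse Kz' r2 small hlam.
rewrite !cardsE addrK => h.
have h2 : 2 * rho <= z + 2 * rho.
  by rewrite lerDr; have := le_trans K0 Kz; rewrite subr_ge0; apply: le_trans.
apply: leq_trans (h h2); apply: subset_leq_card.
apply/fintype.subsetP => e; rewrite unfold_in => ze; rewrite unfold_in [A _ _]mxE.
by apply: jump; apply: le_lt_trans ze; rewrite gerBl.
Qed.

End GoodEvent.

(** * Asymptotics of the good event *)

(* [s] is the order of a finite moment, [n ^ kappa] the truncation level, and
   [n ^ tau] a lower bound for the quantile, of order at least [(n ^ 2) ^ t]. *)
Lemma exists_exponents (R : realType) (alpha : R) : 0 < alpha < 4 ->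
  exists s kappa tau t : R,
    [/\ 0 < s < alpha, 0 < kappa < tau, tau < 2 * t, 0 < t & t * alpha < 1] /\
    [/\ 3 < 2 * (kappa * s), 1 < 2 * tau, alpha < 2 -> 1 < tau & 2 <= alpha -> 1 < s].
Proof.
move=> /andP[a0 a4].
have [q q0 qa] : exists2 q : R, 0 < q & q * alpha = 1.
  by exists alpha^-1; rewrite ?invr_gt0 // mulVf ?gt_eqF.
have [e [e0 e1 e2 e3]] : exists e : R, [/\ 0 < e, e <= 24^-1, 2 * e <= 1 - alpha / 4 &
    alpha < 2 -> 2 * e <= 1 - alpha / 2].
  have [al2|al2] := ltP alpha 2.
    exists (Num.min 24^-1 (Num.min ((1 - alpha / 4) / 2) ((1 - alpha / 2) / 2))).
    split.
    - by rewrite !lt_min; apply/and3P; split; lra.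
    - by rewrite ge_min lexx.
    - rewrite mulrC -ler_pdivlMr // !ge_min lexx /= orbT //.
    - by move=> _; rewrite mulrC -ler_pdivlMr // !ge_min lexx /= !orbT.
  exists (Num.min 24^-1 ((1 - alpha / 4) / 2)); split.
  - by rewrite lt_min; apply/andP; split; lra.
  - by rewrite ge_min lexx.
  - by rewrite mulrC -ler_pdivlMr // !ge_min lexx /= orbT.
  - by move=> h; exfalso; lra.
(* With [q = 1 / alpha], these perturb [alpha], [2 / alpha], [2 / alpha] and [1 / alpha]. The
   factors [1 - 2 * e < 1 - e < 1 - e / 2] order the last three; [e <= 1 / 24] keeps
   [2 * (kappa * s)], close to 4, above 3; the other bounds on [e] turn [alpha < 4] into
   [1 < 2 * tau] and [alpha < 2] into [1 < tau]. *)
exists (alpha * (1 - e)), (2 * q * (1 - 2 * e)), (2 * q * (1 - e)), (q * (1 - e / 2)).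
have ae : 0 < alpha * e by rewrite mulr_gt0.
have qe : 0 < q * e by rewrite mulr_gt0.
have qe2 : q * e <= q * 24^-1 by rewrite ler_pM2l.
have k0 : 0 < 2 * q * (1 - 2 * e) by rewrite !mulr_gt0 //; lra.
have t0 : 0 < q * (1 - e / 2) by rewrite mulr_gt0 //; lra.
have s0 : 0 < alpha * (1 - e) by rewrite mulr_gt0 //; lra.
split; split=> //.
- by rewrite s0 /=; nra.
- by rewrite k0 /=; nra.
- nra.
- have -> : q * (1 - e / 2) * alpha = (q * alpha) * (1 - e / 2) by ring.
  by rewrite qa; lra.
- have -> : 2 * (2 * q * (1 - 2 * e) * (alpha * (1 - e))) =
    4 * (q * alpha) * ((1 - 2 * e) * (1 - e)) by ring.
  by rewrite qa; nra.
- have : q * (2 * e) <= q * (1 - alpha / 4) by rewrite ler_pM2l.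
  have -> : q * (1 - alpha / 4) = q - (q * alpha) / 4 by ring.
  by rewrite qa; nra.
- move=> al2; have : q * (2 * e) <= q * (1 - alpha / 2) by rewrite ler_pM2l // e3.
  have -> : q * (1 - alpha / 2) = q - (q * alpha) / 2 by ring.
  by rewrite qa; nra.
- move=> al2; nra.
Qed.

Lemma near_natr_powR_le (R : realType) (u v A : R) : u < v ->
  \forall n \near \oo, A * n%:R `^ u <= n%:R `^ v :> R.
Proof.
move=> uv; have vu : 0 < v - u by rewrite subr_gt0.
near=> n.
have n1 : 1 <= n%:R :> R by near: n; exact: nbhs_infty_ger.
have n0 : 0 < n%:R :> R by exact: lt_le_trans n1.
have hn : (`|A| + 1) `^ (v - u)^-1 <= n%:R by near: n; exact: nbhs_infty_ger.
rewrite -[v](subrK u) powRD ?(gt_eqF n0) ?implybT // ler_wpM2r ?powR_ge0 //.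
apply: (@le_trans _ _ (`|A| + 1)).
  by apply: le_trans (ler_norm _) _; rewrite lerDl.
have A1 : 0 <= `|A| + 1 by rewrite addr_ge0.
rewrite -[leLHS](powRVK A1 (lt0r_neq0 vu)).
by apply: ge0_ler_powR; rewrite ?nnegrE ?powR_ge0 ?(ltW vu) ?(ltW n0).
Unshelve. all: by end_near. Qed.

Lemma continuous_powR (R : realType) (a x : R) : 0 < x ->
  {for x, continuous (fun y : R => y `^ a)}.
Proof.
move=> x0; apply: differentiable_continuous; apply/derivable1_diffP.
by apply: derivable_powR; rewrite in_itv /= x0.
Qed.

Lemma powR_intensity_itv (R : realType) (alpha u v : R) : 0 < u -> u < v ->
  intensity_measure (fun x : R => alpha / (2 * x `^ (1 + alpha / 2))) `]u, v]%classic =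
  (u `^ (- (alpha / 2)) - v `^ (- (alpha / 2)))%:E.
Proof.
move=> u0 uv; rewrite /intensity_measure.
pose f (x : R) := alpha / 2 * x `^ (- (1 + alpha / 2)).
pose F (x : R) : R^o := - x `^ (- (alpha / 2)).
have pos x : x \in `[u, v] -> 0 < x.
  by rewrite in_itv /= => /andP[ux _]; exact: lt_le_trans ux.
have cf : {within `[u, v], continuous f}.
  apply: continuous_in_subspaceT => x /set_mem/pos x0.
  by apply: cvgM; [exact: cvg_cst|exact: continuous_powR].
have dF (x : R) : 0 < x -> is_derive x 1 F (f x).
  move=> x0; have h := is_derive1_powR (- (alpha / 2)) x0.
  have := is_deriveN h; rewrite (_ : f x = - (- (alpha / 2) * x `^ (- (alpha / 2) - 1))) //.
  by rewrite mulNr opprK /f opprD [- 1 - _]addrC.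
transitivity (\int[lebesgue_measure]_(x in `]u, v]) (f x)%:E)%E.
  apply: eq_integral => x /set_mem; rewrite /= in_itv /= => /andP[ux _].
  by rewrite /f powRN invfM mulrA.
rewrite integral_itv_obnd_cbnd; last first.
  apply/measurable_EFinP; apply: (measurable_funS (E := [set` `[u, v]])) => //.
    by apply: subset_itvr; rewrite bnd_simp.
  exact: subspace_continuous_measurable_fun.
rewrite (continuous_FTC2 uv cf (F := F)).
- by rewrite -EFinB /F opprK addrC.
- split.
  + by move=> x /subset_itv_oo_cc/pos/dF [].
  + apply: cvg_at_right_filter; apply: cvgN; exact: continuous_powR.
  + apply: cvg_at_left_filter; apply: cvgN; apply: continuous_powR; exact: lt_trans uv.
- by move=> x /subset_itv_oo_cc/pos/dF h; rewrite derive1E; exact: derive_val.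
Qed.

Section Asymptotics.
Variables (R : realType) (alpha gamma : R) (p : nat -> nat) (mu : probability R R) (L : R -> R)
  (b : nat -> R).
Hypotheses (halpha : 0 < alpha < 4) (hgamma : 1 <= gamma)
  (hp : (p n)%:R / n%:R @[n --> \oo] --> gamma) (hL : slowly_varying L)
  (htail : forall x : R, 0 < x -> 1 - abs_cdf mu x = L x * x `^ (- alpha))
  (hb : forall n, b n = tail_quantile (abs_cdf mu) (n * p n)).
Local Notation G := (abs_tail mu).

Let alpha0 : 0 < alpha. Proof. by case/andP: halpha. Qed.

Lemma near_aspect_ratio : \forall n \near \oo,
  n%:R / 2 <= (p n)%:R :> R /\ (p n)%:R <= (gamma + 1) * n%:R :> R.
Proof.
near=> n.
have n0 : 0 < n%:R :> R by near: n; exact: nbhs_infty_gtr.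
have : `|gamma - (p n)%:R / n%:R| <= 2^-1.
  by near: n; move/cvgrPdist_le : hp; apply; rewrite invr_gt0.
rewrite ler_norml => /andP[h1 h2].
have e : (p n)%:R = (p n)%:R / n%:R * n%:R :> R by rewrite divfK ?gt_eqF.
rewrite e; move: (_ / _) h1 h2 => x h1 h2; have g1 := hgamma.
split; last by rewrite ler_wpM2r ?(ltW n0) //; lra.
by rewrite mulrC ler_wpM2r ?(ltW n0) //; lra.
Unshelve. all: by end_near. Qed.

Lemma near_number_of_entries : \forall n \near \oo,
  n%:R ^+ 2 / 2 <= (n * p n)%:R :> R.
Proof.
near=> n.
have [h _] : n%:R / 2 <= (p n)%:R :> R /\ (p n)%:R <= (gamma + 1) * n%:R :> R.
  by near: n; exact: near_aspect_ratio.
by rewrite natrM expr2 -mulrA ler_wpM2l.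
Unshelve. all: by end_near. Qed.

Lemma cvg_number_of_entries : (n * p n)%:R @[n --> \oo] --> (+oo : set_system R).
Proof.
apply/cvgryPge => A; near=> n.
have n2 : 2 <= n%:R :> R by near: n; exact: nbhs_infty_ger.
have nA : A <= n%:R by near: n; exact: nbhs_infty_ger.
apply: (@le_trans _ _ (n%:R ^+ 2 / 2)); last by near: n; exact: near_number_of_entries.
apply: le_trans nA _; rewrite expr2 -mulrA ler_peMr //; lra.
Unshelve. all: by end_near. Qed.

Lemma near_quantile_powR (t u A : R) : 0 < t -> t * alpha < 1 -> u < 2 * t ->
  \forall n \near \oo, A * n%:R `^ u <= b n.
Proof.
move=> t0 ta ut; near=> n.
have n1 : 1 <= n%:R :> R by near: n; exact: nbhs_infty_ger.
have n0 : 0 < n%:R :> R by exact: lt_le_trans n1.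
apply: (@le_trans _ _ ((n * p n)%:R `^ t)); last first.
  by near: n; exact: (near_tail_quantile_gt alpha0 hL htail cvg_number_of_entries hb t0 ta).
have h2 : n%:R ^+ 2 / 2 <= (n * p n)%:R :> R by near: n; exact: near_number_of_entries.
have n20 : 0 <= n%:R ^+ 2 / 2 :> R by rewrite divr_ge0 // sqr_ge0.
apply: (@le_trans _ _ ((n%:R ^+ 2 / 2) `^ t)); last first.
  by apply: ge0_ler_powR; rewrite ?nnegrE ?(ltW t0).
rewrite powRM ?sqr_ge0 ?invr_ge0 // -powR_mulrn ?ler0n // -powRrM.
rewrite -ler_pdivrMr ?powR_gt0 ?invr_gt0 //.
rewrite mulrAC; near: n; exact: near_natr_powR_le.
Unshelve. all: by end_near. Qed.

Let c1 : R := gamma + 2.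
Let c10 : 0 < c1. Proof. by rewrite /c1; have := hgamma; lra. Qed.

Lemma near_dimension : \forall n \near \oo, (n + p n)%:R <= c1 * n%:R :> R.
Proof.
near=> n.
have [_ h] : n%:R / 2 <= (p n)%:R :> R /\ (p n)%:R <= (gamma + 1) * n%:R :> R.
  by near: n; exact: near_aspect_ratio.
by rewrite natrD /c1; lra.
Unshelve. all: by end_near. Qed.

Lemma near_clash_bound (s C kappa e : R) : 0 < kappa ->
  (forall x, 0 < x -> G x <= C * x `^ (- s)) -> 3 < 2 * (kappa * s) -> 0 < e ->
  \forall n \near \oo, (n + p n)%:R ^+ 3 * G (n%:R `^ kappa) ^+ 2 <= e.
Proof.
move=> k0 hC ks e0; near=> n.
have n1 : 1 <= n%:R :> R by near: n; exact: nbhs_infty_ger.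
have n0 : 0 < n%:R :> R by exact: lt_le_trans n1.
have hN : (n + p n)%:R <= c1 * n%:R :> R by near: n; exact: near_dimension.
have hG : G (n%:R `^ kappa) <= C * n%:R `^ (- (kappa * s)).
  by rewrite -mulrN powRrM; apply: hC; exact: powR_gt0.
apply: (@le_trans _ _ ((c1 * n%:R) ^+ 3 * (C * n%:R `^ (- (kappa * s))) ^+ 2)).
  apply: ler_pM; rewrite ?sqr_ge0 ?exprn_ge0 ?ler0n //.
    by rewrite lerXn2r // nnegrE ?mulr_ge0 ?ler0n ?(ltW c10).
  rewrite lerXn2r // nnegrE ?abs_tail_ge0 //.
  by apply: le_trans hG; exact: abs_tail_ge0.
rewrite !exprMn.
rewrite (_ : _ * _ = c1 ^+ 3 * C ^+ 2 * n%:R `^ (3 - 2 * (kappa * s))); last first.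
  rewrite powRD ?(gt_eqF n0) ?implybT // (powR_mulrn 3) ?ler0n //.
  rewrite [in X in _ = _ * (_ * X)](_ : - (2 * (kappa * s)) = - (kappa * s) * 2%:R); last by ring.
  by rewrite powRrM powR_mulrn ?powR_ge0 //; ring.
rewrite -[leRHS]mulr1 -[X in _ <= _ * X](powRr0 n%:R) -ler_pdivrMl // [e^-1 * _]mulrA.
by near: n; apply: near_natr_powR_le; lra.
Unshelve. all: by end_near. Qed.

Section Noise.
Variables (s kappa tau t M : R).
Hypotheses (s0 : 0 < s) (M0 : 0 <= M) (hM : (\int[mu]_y (`|y| `^ s)%:E <= M%:E)%E)
  (kappa0 : 0 < kappa) (kappa_tau : kappa < tau) (tau_t : tau < 2 * t) (t0 : 0 < t)
  (t_alpha : t * alpha < 1) (kappa_s : 3 < 2 * (kappa * s)) (tau1 : 1 < 2 * tau).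
Local Notation K n := (n%:R `^ kappa : R).

Lemma near_scale_bound (delta e : R) : 0 < delta -> 0 < e ->
  exists k (r : nat -> R), \forall n \near \oo,
    [/\ 2 * K n <= r n, (c1 * n%:R) * \int[mu]_y (truncate (K n) y ^+ 2) <= r n ^+ 2 &
        (r n / (delta * b n)) ^+ (2 ^ k.+1) * (c1 * n%:R) * (2 ^ k.+1)`!%:R <= e].
Proof.
move=> delta0 e0.
(* The three exponents are those of [K ^ 2], of [n], and of [n * K ^ (2 - s)], the last two coming
   from the bound on [n] times the truncated second moment. All lie below [2 * tau], the third
   because [kappa * s > 3 / 2]. *)
pose theta := Num.max (2 * kappa) (Num.max 1 (1 + kappa * (2 - s))).
have theta_tau : theta < 2 * tau.
  rewrite !gt_max tau1 ltr_pM2l // kappa_tau /=.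
  have -> : kappa * (2 - s) = 2 * kappa - kappa * s by ring.
  by move: kappa_s kappa_tau; lra.
pose A := 4 + c1 * (1 + 2 * M).
have A4 : 4 <= A.
  by rewrite lerDl mulr_ge0 ?(ltW c10) // addr_ge0 // mulr_ge0.
have A0 : 0 < A by apply: lt_le_trans A4.
pose g := tau - theta / 2; have g0 : 0 < g by rewrite /g; lra.
(* The ratio of [r n] to [b n] is at most of order [n ^ (- g)]. A fixed power of it beats the factor
   [n] from Markov's inequality; the factorial is then a constant. *)
have [k hk] : exists k, 1 < g * (2 ^ k.+1)%:R.
  exists (Num.truncn g^-1); rewrite mulrC -ltr_pdivrMr // mul1r.
  apply: lt_le_trans (truncnS_gt _) _; rewrite ler_nat.
  by apply: ltnW; exact: ltn_expl.
pose q := (2 ^ k.+1)%N.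
exists k, (fun n => A * n%:R `^ (theta / 2)).
near=> n.
have n1 : 1 <= n%:R :> R by near: n; exact: nbhs_infty_ger.
have n0 : 0 < n%:R :> R by exact: lt_le_trans n1.
have K1 : 1 <= K n by rewrite -[leLHS](powRr0 n%:R) ler_powR // ltW.
have P0 x : 0 <= n%:R `^ x :> R by exact: powR_ge0.
split.
- apply: ler_pM => //; first by apply: le_trans A4; rewrite ler_nat.
  by rewrite ler_powR // ler_pdivlMr // mulrC /theta le_max lexx.
- apply: (@le_trans _ _ (c1 * (1 + 2 * M) * n%:R `^ theta)); last first.
    rewrite exprMn -[X in _ <= _ * X]powR_mulrn // -powRrM mulfVK //.
    rewrite ler_wpM2r // (@le_trans _ _ A) ?expr2 ?ler_peMr ?(ltW A0) //.
      by rewrite /A lerDr.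
    by apply: le_trans A4; rewrite ler1n.
  rewrite -mulrA -[X in _ <= X]mulrA ler_wpM2l ?(ltW c10) //.
  apply: le_trans (ler_wpM2l (ltW n0) (truncate_second_moment s0 hM K1)) _.
  rewrite -powRrM.
  have h1 : n%:R <= n%:R `^ theta :> R.
    by rewrite -[leLHS]powRr1 ?(ltW n0) // ler_powR // /theta !le_max lexx orbT.
  have h2 : n%:R * n%:R `^ (kappa * (2 - s)) <= n%:R `^ theta :> R.
    rewrite -[X in X * _]powRr1 ?(ltW n0) // -powRD ?(gt_eqF n0) ?implybT //.
    by rewrite ler_powR // /theta !le_max lexx !orbT.
  have := ler_wpM2r M0 h1; have := ler_wpM2r M0 h2; lra.
have hb' : n%:R `^ tau <= b n.
  by rewrite -[leLHS]mul1r; near: n; exact: (near_quantile_powR _ t0 t_alpha tau_t).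
have b0 : 0 < b n by apply: lt_le_trans hb'; exact: powR_gt0.
apply: (@le_trans _ _ ((A / delta * n%:R `^ (- g)) ^+ q * (c1 * n%:R) * q`!%:R)).
  rewrite ler_wpM2r // ler_wpM2r ?mulr_ge0 ?(ltW c10) ?(ltW n0) //.
  apply: lerXn2r; rewrite ?nnegrE ?divr_ge0 ?mulr_ge0 ?invr_ge0 ?(ltW A0) ?(ltW b0) ?(ltW delta0) //.
  rewrite invfM mulrACA; rewrite ler_wpM2l ?divr_ge0 ?(ltW A0) ?(ltW delta0) //.
  rewrite ler_pdivrMr //; apply: le_trans (ler_wpM2l (P0 _) hb').
  by rewrite -powRD ?(gt_eqF n0) ?implybT // /g opprB subrK.
rewrite (_ : _ * _ = (A / delta) ^+ q * c1 * q`!%:R * n%:R `^ (1 - g * q%:R)); last first.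
  rewrite powRD ?(gt_eqF n0) ?implybT // powRr1 ?(ltW n0) // -mulNr powRrM powR_mulrn //.
  by rewrite exprMn; ring.
rewrite -[leRHS]mulr1 -[X in _ <= _ * X](powRr0 n%:R) -ler_pdivrMl // [e^-1 * _]mulrA.
by near: n; apply: near_natr_powR_le; rewrite /q; lra.
Unshelve. all: by end_near. Qed.

Hypotheses (tau_gt1 : alpha < 2 -> 1 < tau) (s_gt1 : 2 <= alpha -> 1 < s)
  (mean0 : 2 <= alpha -> (\int[mu]_y y%:E = 0)%E).

Lemma near_mean_bound (delta : R) : 0 < delta ->
  \forall n \near \oo, `|\int[mu]_y truncate (K n) y| * (c1 * n%:R) <= delta * b n.
Proof.
move=> delta0.
(* The exponent of [n * K ^ (1 - s)]. The other contribution to the mean bound, of order [n], occurs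
   only for [alpha < 2], where [tau > 1] takes care of it. *)
pose u := 1 + kappa * (1 - s).
have u_tau : u < tau.
  rewrite /u; have -> : kappa * (1 - s) = kappa - kappa * s by ring.
  by move: kappa_s kappa_tau; lra.
have H1 : \forall n \near \oo, alpha < 2 -> 2 * (c1 * (1 + M) / delta) * n%:R `^ 1 <= b n.
  have [al2|al2] := ltP alpha 2; last by near=> n.
  near=> n => _; near: n; apply: (near_quantile_powR _ t0 t_alpha); apply: lt_trans tau_t.
  exact: tau_gt1.
near=> n.
have n1 : 1 <= n%:R :> R by near: n; exact: nbhs_infty_ger.
have n0 : 0 < n%:R :> R by exact: lt_le_trans n1.
have K1 : 1 <= K n by rewrite -[leLHS](powRr0 n%:R) ler_powR // ltW.
have P0 x : 0 <= n%:R `^ x :> R by exact: powR_ge0.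
have nK : n%:R * (K n) `^ (1 - s) = n%:R `^ u.
  by rewrite /u -powRrM powRD ?(gt_eqF n0) ?implybT // powRr1 ?(ltW n0).
have h2 : 2 * (c1 * M / delta) * n%:R `^ u <= b n.
  by near: n; apply: (near_quantile_powR _ t0 t_alpha); exact: lt_trans tau_t.
have b0 : 0 <= b n.
  by apply: le_trans h2; rewrite mulr_ge0 // mulr_ge0 // divr_ge0 ?mulr_ge0 ?(ltW c10) ?(ltW delta0).
have h2' : c1 * M * n%:R `^ u <= delta * (b n / 2).
  rewrite mulrA ler_pdivlMr // -ler_pdivrMl // [leLHS](_ : _ = 2 * (c1 * M / delta) * n%:R `^ u) //.
  by field; rewrite gt_eqF.
have [al2|al2] := ltP alpha 2.
  have h1 : 2 * (c1 * (1 + M) / delta) * n%:R `^ 1 <= b n.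
    by move: al2; near: n; exact: H1.
  apply: le_trans (ler_wpM2r _ (truncate_mean_le s0 hM K1)) _.
    by rewrite mulr_ge0 ?(ltW c10) ?(ltW n0).
  have h1' : c1 * (1 + M) * n%:R <= delta * (b n / 2).
    rewrite mulrA ler_pdivlMr // -ler_pdivrMl // [leLHS](_ : _ = 2 * (c1 * (1 + M) / delta) * n%:R `^ 1) //.
    by rewrite powRr1 ?(ltW n0) //; field; rewrite gt_eqF.
  rewrite [leLHS](_ : _ = c1 * (1 + M) * n%:R + c1 * M * (n%:R * (K n) `^ (1 - s))); last by ring.
  by rewrite nK; lra.
apply: le_trans (ler_wpM2r _ (truncate_mean_centered_le hM (s_gt1 al2) K1 (mean0 al2))) _.
  by rewrite mulr_ge0 ?(ltW c10) ?(ltW n0).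
rewrite [leLHS](_ : _ = c1 * M * (n%:R * (K n) `^ (1 - s))); last by ring.
rewrite nK; apply: le_trans h2' _; rewrite ler_wpM2l ?(ltW delta0) //; lra.
Unshelve. all: by end_near. Qed.

End Noise.

End Asymptotics.

(** Continuity of the power at finitely many levels. The difference is the limiting expected number
    of entries whose modulus, divided by [b n], falls within [2 * delta] of the level. *)
Lemma exists_level_width (R : realType) (alpha e : R) (I : finType) (x : I -> R) :
  (forall l, 0 < x l) -> 0 < e -> exists2 delta, 0 < delta &
    forall l, 2 * delta < x l /\
      (x l - 2 * delta) `^ (- alpha) - (x l + 2 * delta) `^ (- alpha) < e.
Proof.
move=> x0 e0.
have H : \forall delta \near (0 : R)^'+, forall l, 2 * delta < x l /\
      (x l - 2 * delta) `^ (- alpha) - (x l + 2 * delta) `^ (- alpha) < e.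
  apply: filter_forall => l; apply: filterI.
    near=> delta; rewrite mulrC -ltr_pdivlMr //; near: delta; apply: nbhs_right_lt.
    by rewrite divr_gt0.
  have c2 (c : R) : x l + c * delta @[delta --> (0 : R)^'+] --> x l.
    rewrite -[X in _ --> X]addr0 -[X in _ + X](mulr0 c).
    apply: cvgD; first exact: cvg_cst.
    apply: cvgM; first exact: cvg_cst.
    by apply: cvg_at_right_filter; exact: cvg_id.
  have cp (c : R) : (x l + c * delta) `^ (- alpha) @[delta --> (0 : R)^'+] --> x l `^ (- alpha).
    apply: (@cvg_comp _ _ _ (fun delta => x l + c * delta) (fun y => y `^ (- alpha)) _ _ _ (c2 c)).
    exact: continuous_powR.
  near=> delta.
  have h1 : (x l + - 2 * delta) `^ (- alpha) < x l `^ (- alpha) + e / 2.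
    by near: delta; apply: (cvgr_lt _ (cp (- 2))); rewrite ltrDl divr_gt0.
  have h2 : x l `^ (- alpha) - e / 2 < (x l + 2 * delta) `^ (- alpha).
    by near: delta; apply: (cvgr_gt _ (cp 2)); rewrite gtrBl divr_gt0.
  by rewrite mulNr in h1; lra.
near (0 : R)^'+ => delta; exists delta; first by near: delta; exact: nbhs_right_gt.
by near: delta.
Unshelve. all: by end_near. Qed.

Section GoodEventAsymptotics.
Variables (R : realType) (alpha gamma : R) (p : nat -> nat) (mu : probability R R) (L : R -> R)
  (b : nat -> R).
Hypotheses (halpha : 0 < alpha < 4) (hgamma : 1 <= gamma)
  (hp : (p n)%:R / n%:R @[n --> \oo] --> gamma) (hL : slowly_varying L)
  (htail : forall x : R, 0 < x -> 1 - abs_cdf mu x = L x * x `^ (- alpha))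
  (hb : forall n, b n = tail_quantile (abs_cdf mu) (n * p n)).
Variables (d : nat -> measure_display) (T : forall n, measurableType (d n))
  (P : forall n, probability (T n) R) (a : forall n, 'I_n -> 'I_(p n) -> {RV (P n) >-> R}).
Hypotheses (hlaw : forall n (i : 'I_n) (j : 'I_(p n)) (B : set R),
     measurable B -> distribution (P n) (a i j) B = mu B)
  (hindep : forall n, mutually_independent (P n)
     (fun (ij : 'I_n * 'I_(p n)) (w : T n) => a ij.1 ij.2 w))
  (hmean : 2 <= alpha -> forall n (i : 'I_n) (j : 'I_(p n)), ('E_(P n)[a i j] = 0)%E).
Local Notation G := (abs_tail mu).

Let alpha0 : 0 < alpha. Proof. by case/andP: halpha. Qed.

Lemma integrable_identity (s M : R) : 1 <= s ->
  (\int[mu]_y (`|y| `^ s)%:E <= M%:E)%E -> mu.-integrable [set: R] (EFin \o (fun y : R => y)).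
Proof.
move=> s1 hM; have mid : measurable_fun [set: R] (fun y : R => y) by exact: measurable_id.
apply/integrableP; split; first by apply/measurable_EFinP.
apply: (@le_lt_trans _ _ (\int[mu]_y (1%:E + (`|y| `^ s)%:E))%E).
  apply: ge0_le_integral => //.
  - by apply/measurable_EFinP; exact: normr_measurable.
  - apply: emeasurable_funD => //; apply/measurable_EFinP.
    by apply: (measurableT_comp (measurable_powR s)); exact: normr_measurable.
  move=> y _ /=; rewrite -EFinD lee_fin.
  have [y1|y1] := leP `|y| 1; first by rewrite (le_trans y1) // lerDl powR_ge0.
  by rewrite -[leLHS]powRr1 // (le_trans (ler_powR (ltW y1) s1)) // lerDr.
rewrite ge0_integralD //; last first.
  by apply/measurable_EFinP; apply: (measurableT_comp (measurable_powR s)).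
rewrite lte_add_pinfty //; last by apply: le_lt_trans hM _; rewrite ltry.
by rewrite integral_cst // [X in (_ * X)%E](probability_setT mu) mule1 ltry.
Qed.

(** The mean is prescribed for the entries; its transfer to [mu] takes an actual entry, hence an [n]
    with [n] and [p n] positive, and integrability, from a moment of order above 1. *)
Lemma mean_of_law : (2 <= alpha) -> (\int[mu]_y y%:E = 0)%E.
Proof.
move=> al2.
have [s /andP[s1 sa]] : exists s : R, 1 < s < alpha by exists ((1 + alpha) / 2); apply/andP; split; lra.
have [C C0 hC] : exists2 C : R, 0 < C & forall x, 0 < x -> G x <= C * x `^ (- ((s + alpha) / 2)).
  by apply: (abs_tail_upper hL htail); apply/andP; split; lra.
have [M _ hM] : exists2 M : R, 0 <= M & (\int[mu]_y (`|y| `^ s)%:E <= M%:E)%E.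
  by apply: (absolute_moment_finite (t := (s + alpha) / 2)) hC; apply/andP; split; lra.
have int_id := integrable_identity (ltW s1) hM.
have [n [i [j _]]] : exists n (i : 'I_n) (j : 'I_(p n)), True.
  near \oo => n; exists n.
  have n0 : 0 < n%:R :> R by near: n; exact: nbhs_infty_gtr.
  have [h _] : n%:R / 2 <= (p n)%:R :> R /\ (p n)%:R <= (gamma + 1) * n%:R :> R.
    by near: n; exact: near_aspect_ratio.
  have p0 : 0 < (p n)%:R :> R by apply: lt_le_trans h; rewrite divr_gt0.
  by rewrite !ltr0n in n0 p0; exists (Ordinal n0), (Ordinal p0).
have law (f : R -> \bar R) : (\int[distribution (P n) (a i j)]_y f y = \int[mu]_y f y)%E.
  by apply: eq_measure_integral => B mB _; exact: hlaw.
have mid : measurable_fun [set: R] (EFin \o (fun y : R => y)).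
  by apply/measurable_EFinP; exact: measurable_id.
have := hmean al2 i j; rewrite unlock => mean.
rewrite -[LHS]law -[RHS]mean; apply: (integral_distribution mid).
apply/integrableP; split; first by apply/measurable_EFinP; exact: measurable_funPT.
have /integrableP[_] := int_id; apply: le_lt_trans.
rewrite -law ge0_integral_distribution //.
by apply/measurable_EFinP; exact: normr_measurable.
Unshelve. all: by end_near. Qed.

Lemma near_good_event (I : finType) (x : I -> R) (e : R) :
  (forall l, 0 < x l) -> 0 < e ->
  \forall n \near \oo, exists Bad : set (T n), [/\ measurable Bad, fine (P n Bad) <= e &
    forall w (lam : 'I_n -> R), ~ Bad w ->
      char_poly ((\matrix_(i, j) @a n i j w) *m (\matrix_(i, j) a i j w)^T) =
        \prod_(i < n) ('X - (lam i)%:P) ->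
      forall l, #|[pred i | (x l * b n) ^+ 2 < lam i]| =
        #|[pred ij : 'I_n * 'I_(p n) | x l * b n < `|a ij.1 ij.2 w|]|].
Proof.
move=> x0 e0.
(* A third of [e] goes to each kind of bad event; the share for entries near a level is split among
   the levels, and the [+ 1] allows for an empty [I]. *)
pose e' := e / 3 / (#|I|%:R + 1).
have I1 : 0 < #|I|%:R + 1 :> R by rewrite ltr_wpDl.
have e'0 : 0 < e' by rewrite !divr_gt0.
have [delta delta0 hdelta] := exists_level_width alpha x0 e'0.
have [s [kappa [tau [t [[/andP[s0 sa] /andP[k0 kt] tt t0 ta] [ks tau1 tau2 s1]]]]]] :=
  exists_exponents halpha.
have [C C0 hC] : exists2 C : R, 0 < C & forall x, 0 < x -> G x <= C * x `^ (- s).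
  by apply: (abs_tail_upper hL htail); rewrite s0.
(* A finite moment of order [s] takes a tail exponent strictly above [s]; the bound [hC] at [s]
   itself serves the clash estimate. *)
have [C' C'0 hC'] : exists2 C : R, 0 < C & forall x, 0 < x -> G x <= C * x `^ (- ((s + alpha) / 2)).
  by apply: (abs_tail_upper hL htail); apply/andP; split; lra.
have [M M0 hM] : exists2 M : R, 0 <= M & (\int[mu]_y (`|y| `^ s)%:E <= M%:E)%E.
  by apply: (absolute_moment_finite (t := (s + alpha) / 2)) hC'; apply/andP; split; lra.
have e3 : 0 < e / 3 by rewrite divr_gt0.
have [k [r hr]] := near_scale_bound halpha hgamma hp hL htail hb s0 M0 hM k0 kt tt t0 ta ks tau1 delta0 e3.
pose N n : R := (gamma + 2) * n%:R.
pose K n : R := n%:R `^ kappa.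
pose u n l := x l * b n - 2 * (delta * b n); pose v n l := x l * b n + 2 * (delta * b n).
have level : \forall n \near \oo, forall l, K n <= u n l /\
    (n * p n)%:R * (G (u n l) - G (v n l)) <= e'.
  apply: filter_forall => l; have [dx dxe] := hdelta l.
  have uE n : u n l = (x l - 2 * delta) * b n by rewrite /u; ring.
  have vE n : v n l = (x l + 2 * delta) * b n by rewrite /v; ring.
  have dx1 : 0 < x l - 2 * delta by rewrite subr_gt0.
  have dx2 : 0 < x l + 2 * delta by rewrite addr_gt0 // mulr_gt0.
  have hm := cvg_number_of_entries hgamma hp.
  have cu := cvg_tail_quantile alpha0 hL htail hm hb dx1.
  have cv := cvg_tail_quantile alpha0 hL htail hm hb dx2.
  (* Half of the slack left by [hdelta], granted to each of the two convergent tails. *)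
  pose h := (e' - ((x l - 2 * delta) `^ (- alpha) - (x l + 2 * delta) `^ (- alpha))) / 2.
  have h0 : 0 < h by rewrite divr_gt0 // subr_gt0.
  near=> n; split.
    rewrite uE mulrC -ler_pdivrMr // mulrC; near: n.
    by apply: (near_quantile_powR halpha hgamma hp hL htail hb _ t0 ta); exact: lt_trans tt.
  have h1 : (n * p n)%:R * G (u n l) < (x l - 2 * delta) `^ (- alpha) + h.
    by rewrite uE; near: n; apply: (cvgr_lt _ cu); rewrite ltrDl.
  have h2 : (x l + 2 * delta) `^ (- alpha) - h < (n * p n)%:R * G (v n l).
    by rewrite vE; near: n; apply: (cvgr_gt _ cv); rewrite gtrBl.
  rewrite mulrBr; move: h1 h2; rewrite /h; lra.
near=> n.
have n1 : 1 <= n%:R :> R by near: n; exact: nbhs_infty_ger.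
have n0 : 0 < n%:R :> R by exact: lt_le_trans n1.
have N0 : 0 < N n by rewrite mulr_gt0 //; have := hgamma; lra.
have VN : (n + p n)%:R <= N n by near: n; exact: near_dimension.
have K0 : 0 <= K n by exact: powR_ge0.
have b1 : 1 <= b n.
  by near: n; apply: (near_tail_quantile_ge alpha0 hL htail (cvg_number_of_entries hgamma hp) hb).
have rho0 : 0 < delta * b n by rewrite mulr_gt0 //; exact: lt_le_trans b1.
have [r2K hrn hbound] : [/\ 2 * K n <= r n, N n * \int[mu]_y (truncate (K n) y ^+ 2) <= r n ^+ 2 &
    (r n / (delta * b n)) ^+ (2 ^ k.+1) * N n * (2 ^ k.+1)`!%:R <= e / 3].
  by near: n.
have mean : `|\int[mu]_y truncate (K n) y| * N n <= delta * b n.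
  near: n; apply: (near_mean_bound halpha hgamma hp hL htail hb s0 M0 hM k0 kt tt t0 ta ks) => //.
  exact: mean_of_law.
have lev l : K n <= u n l /\ (n * p n)%:R * (G (u n l) - G (v n l)) <= e'.
  by move: l; near: n; exact: level.
have uv l : u n l <= v n l.
  by rewrite /u /v lerD2l ge0_cp // mulr_ge0 // ltW.
have [m1 P1] := prob_clash (@hlaw n) (@hindep n) (K n).
have [m2 P2] := prob_big_norm (@hlaw n) (@hindep n) K0 r2K N0 VN hrn k rho0.
have lvl l := prob_near_level (@hlaw n) (uv l).
have [m3 P3] := probability_union_le (P n) predT (fun l => (lvl l).1).
exists (clash (@a n) (K n) `|` big_norm mu (@a n) (K n) k (delta * b n) `|`
  [set w | exists2 l, true & near_level (@a n) (u n l) (v n l) w]); split.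
- by apply: measurableU => //; exact: measurableU.
- apply: le_trans (probability_setU_le _ _ m3) _; first exact: measurableU.
  apply: le_trans (lerD (probability_setU_le _ m1 m2) (lexx _)) _.
  have Q1 : fine (P n (clash (@a n) (K n))) <= e / 3.
    by apply: le_trans P1 _; near: n; apply: (near_clash_bound hgamma hp k0 hC ks).
  have Q2 := le_trans P2 hbound.
  have Q3 : fine (P n [set w | exists2 l, true & near_level (@a n) (u n l) (v n l) w]) <= e / 3.
    apply: le_trans P3 _; apply: (@le_trans _ _ (\sum_(l : I) e')).
      by apply: ler_sum => l _; apply: le_trans (lvl l).2 (lev l).2.
    rewrite sumr_const -[X in X <= _]mulr_natl cardT -cardE.
    by rewrite /e' mulrA ler_pdivrMr // mulrC ler_wpM2l ?(ltW e3) // lerDl.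
  by apply: le_trans (lerD (lerD Q1 Q2) Q3) _; lra.
move=> w lam /not_orP[/not_orP[nc nb] nl] hlam l.
apply: (card_eigenvalue_eq_large K0 N0 VN rho0 mean nc nb hlam (lev l).1).
by move=> hl; apply: nl; exists l.
Unshelve. all: by end_near. Qed.

End GoodEventAsymptotics.

(** * Eigenvalue counts and Poisson counts *)

Lemma measurable_point_measure_of (R : realType) (d : measure_display) (T : measurableType d)
    (n : nat) (x : 'I_n -> T -> R) (B : set R) :
  (forall i, measurable_fun [set: T] (x i)) -> measurable B ->
  measurable_fun [set: T] (fun w => point_measure_of (fun i => x i w) B).
Proof.
move=> mx mB.
rewrite (_ : (fun w => _) =
    (fun w => \sum_(i < n) (\1_(B `&` `]0, +oo[%classic) (x i w))%:E)%E); last first.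
  apply/funext => w.
  change (sum_dirac (fun i => x i w) B =
    (\sum_(i < n) (\1_(B `&` `]0, +oo[%classic) (x i w))%:E)%E).
  by rewrite sum_diracE; apply: eq_bigr => i _; rewrite diracE indicE.
apply: emeasurable_sum => i; apply/measurable_EFinP.
apply: measurableT_comp (mx i); apply: measurable_indic; exact: measurableI.
Qed.

(** The mass of the cell under the intensity, which has antiderivative [- x ^ (- alpha / 2)]. *)
Definition cell_rate (R : realType) (alpha : R) (m l : nat) : R :=
  (l.+1%:R / 2 ^+ m) `^ (- (alpha / 2)) - (l.+2%:R / 2 ^+ m) `^ (- (alpha / 2)).

Lemma poisson_counts (R : realType) (alpha : R) (d : measure_display) (T : measurableType d)
    (Q : probability T R) (eta : T -> point_measure R) (m : nat) (c : 'I_(4 ^ m) -> nat) :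
  poisson_point_process Q
    (intensity_measure (fun x : R => alpha / (2 * x `^ (1 + alpha / 2)))) eta ->
  fine (Q [set w | has_counts c (eta w)]) =
  \prod_(l < 4 ^ m) (expR (- cell_rate alpha m l) * cell_rate alpha m l ^+ c l / (c l)`!%:R).
Proof.
move=> [meta poisson _ indep].
pose Lambda := intensity_measure (fun x : R => alpha / (2 * x `^ (1 + alpha / 2))).
have LE (l : nat) : Lambda (grid_cell m l) = (cell_rate alpha m l)%:E.
  apply: powR_intensity_itv; first by rewrite divr_gt0 ?exprn_gt0.
  by rewrite ltr_pM2r ?invr_gt0 ?exprn_gt0 // ltr_nat.
pose B (l : 'I_(4 ^ m)) : set R := grid_cell m l.
have mB l : measurable (B l) by exact: measurable_grid_cell.
have Bpos l : B l `<=` `]0, +oo[ by exact: grid_cell_pos.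
have tB : trivIset [set: 'I_(4 ^ m)] B.
  by move=> l l' _ _ [x [h1 h2]]; apply/val_inj; exact: (grid_cell_inj h1 h2).
have := indep _ B mB Bpos tB (fun l => [set (c l)%:R%:E]) (fun l => emeasurable_set1 _).
rewrite (_ : \bigcap_(l in _) _ = [set w | has_counts c (eta w)]); last first.
  by apply/seteqP; split=> [w h l|w h l _]; [exact: (h l I)|exact: h].
move=> ->.
transitivity (fine (\prod_(l < 4 ^ m)
    (expR (- cell_rate alpha m l) * cell_rate alpha m l ^+ c l / (c l)`!%:R)%:E)%E).
  congr fine; apply: eq_bigr => l _.
  have := poisson (B l) (mB l) (@Bpos l); rewrite [intensity_measure _ _]LE => /(_ (ltry _) (c l)).
  by [].
by rewrite prodEFin.
Qed.

Section CountsOfEigenvalues.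
Variables (R : realType) (m : nat).

(** Eigenvalues correspond to squares of entries, so the levels for entries are the square roots of
    the grid points. There is one more level than cells; [lower] and [upper] select the two ends of
    a cell. *)
Let root (l : 'I_(4 ^ m).+1) : R := Num.sqrt (l.+1%:R / 2 ^+ m).
Let lower (l : 'I_(4 ^ m)) : 'I_(4 ^ m).+1 := widen_ord (leqnSn _) l.
Let upper (l : 'I_(4 ^ m)) : 'I_(4 ^ m).+1 := lift ord0 l.

Let ratio_gt0 (l : nat) : 0 < l.+1%:R / 2 ^+ m :> R.
Proof. by rewrite divr_gt0 ?exprn_gt0. Qed.

Lemma grid_root_gt0 l : 0 < root l.
Proof. by rewrite sqrtr_gt0. Qed.

Let upperE l : root (upper l) = Num.sqrt (l.+2%:R / 2 ^+ m).
Proof. by []. Qed.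

Let root_mono l : root (lower l) < root (upper l).
Proof. by rewrite upperE ltr_sqrt // ltr_pM2r ?invr_gt0 ?exprn_gt0 // ltr_nat. Qed.

Lemma powR_grid_root (alpha : R) l : root l `^ (- alpha) = (l.+1%:R / 2 ^+ m) `^ (- (alpha / 2)).
Proof.
rewrite /root -powR12_sqrt ?(ltW (ratio_gt0 _)) // -powRrM; congr (_ `^ _).
by rewrite mulrN mulrC.
Qed.

(** A difference of two superlevel sets: its probability is a difference of tails, and its count a
    difference of counts above levels, the only quantities compared with eigenvalues. *)
Definition entry_cell (beta : R) (l : 'I_(4 ^ m)) : set R :=
  [set y | root (lower l) * beta < `|y|] `\` [set y | root (upper l) * beta < `|y|].

Lemma measurable_entry_cell beta l : measurable (entry_cell beta l).
Proof.
by apply: measurableD; apply: measurable_set_lt;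
  [exact: measurable_cst|exact: normr_measurable|exact: measurable_cst|exact: normr_measurable].
Qed.

Lemma trivIset_entry_cell beta : 0 < beta -> trivIset [set: 'I_(4 ^ m)] (entry_cell beta).
Proof.
move=> beta0 l l' _ _ [y [[h1 h2] [h3 h4]]].
have sep (k k' : 'I_(4 ^ m)) : (k < k')%N -> root (lower k') * beta < `|y| ->
    root (upper k) * beta < `|y|.
  move=> kk'; apply: le_lt_trans; rewrite ler_pM2r // upperE ler_sqrt //.
  by rewrite ler_pM2r ?invr_gt0 ?exprn_gt0 // ler_nat.
apply/val_inj/eqP; rewrite eqn_leq; apply/andP; split; rewrite leqNgt; apply/negP => h.
- by apply: h4; exact: sep h h1.
- by apply: h2; exact: sep h h3.
Qed.

Lemma law_entry_cell (mu : probability R R) beta l : 0 < beta ->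
  fine (mu (entry_cell beta l)) =
  abs_tail mu (root (lower l) * beta) - abs_tail mu (root (upper l) * beta).
Proof.
move=> beta0.
have mL (z : R) : measurable [set y : R | z < `|y|].
  by apply: measurable_set_lt; [exact: measurable_cst|exact: normr_measurable].
rewrite !abs_tailE -fineB ?fin_num_measure //; congr fine.
rewrite /entry_cell measureD //; last by rewrite -ge0_fin_numE // fin_num_measure.
congr (_ - mu _)%E; apply/seteqP; split=> y /=; first by case.
move=> h; split=> //; apply: lt_trans h; rewrite ltr_pM2r //; exact: root_mono.
Qed.

Lemma has_counts_of_entry_cells (n p : nat) (lam : 'I_n -> R) (x : 'I_n * 'I_p -> R)
    (beta : R) (c : 'I_(4 ^ m) -> nat) : 0 < beta ->
  (forall l, #|[pred i | (root l * beta) ^+ 2 < lam i]| =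
             #|[pred e | root l * beta < `|x e|]|) ->
  (forall l, #|[pred e | x e \in entry_cell beta l]| = c l) ->
  has_counts c (point_measure_of (fun i => beta ^- 2 * lam i)).
Proof.
move=> beta0 same hc l.
have gridE (k : 'I_(4 ^ m).+1) :
    #|[pred i | (k.+1%:R / 2 ^+ m < beta ^- 2 * lam i)%R]| = #|[pred e | root k * beta < `|x e|]|.
  rewrite -same; apply: eq_card => i; rewrite !inE exprMn sqr_sqrtr ?(ltW (ratio_gt0 _)) //.
  by rewrite ltr_pdivlMl ?exprn_gt0 // mulrC.
rewrite point_measure_of_itv //; last first.
  by rewrite ler_pM2r ?invr_gt0 ?exprn_gt0 // ler_nat.
rewrite (gridE (lower l)) (gridE (upper l)) -hc -card_pred_diff => [|e]; last first.
  by apply: lt_trans; rewrite ltr_pM2r //; exact: root_mono.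
congr (_%:R%:E); apply: eq_card => e; rewrite !inE.
apply/andP/idP => [[h1 h2]|/set_mem[h1 /negP h2]]; last by split.
by apply/mem_set; split=> //; exact/negP.
Qed.

End CountsOfEigenvalues.

Theorem theorem2 (R : realType) (alpha gamma : R)
  (halpha : 0 < alpha < 4) (hgamma : 1 <= gamma)
  (p : nat -> nat) (hp : (p n)%:R / n%:R @[n --> \oo] --> gamma)
  (mu : probability R R) (L : R -> R) (hL : slowly_varying L)
  (htail : forall x : R, 0 < x -> 1 - abs_cdf mu x = L x * x `^ (- alpha))
  (d : nat -> measure_display) (T : forall n : nat, measurableType (d n))
  (P : forall n : nat, probability (T n) R)
  (a : forall n : nat, 'I_n -> 'I_(p n) -> {RV (P n) >-> R})
  (hlaw : forall (n : nat) (i : 'I_n) (j : 'I_(p n)) (B : set R),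
     measurable B -> distribution (P n) (a n i j) B = mu B)
  (hindep : forall n : nat, mutually_independent (P n)
     (fun (ij : 'I_n * 'I_(p n)) (w : T n) => a n ij.1 ij.2 w))
  (hmean : 2 <= alpha -> forall (n : nat) (i : 'I_n) (j : 'I_(p n)),
     ('E_(P n)[a n i j] = 0)%E)
  (A : forall n : nat, T n -> 'M[R]_(n, p n))
  (hA : forall (n : nat) (w : T n), A n w = \matrix_(i, j) a n i j w)
  (lambda : forall n : nat, T n -> 'I_n -> R)
  (hlambda : forall (n : nat) (w : T n),
     ordered_eigenvalues (A n w *m (A n w)^T) (lambda n w))
  (b : nat -> R)
  (hb : forall n : nat, b n = tail_quantile (abs_cdf mu) (n * p n))
  (d' : measure_display) (T' : measurableType d') (Q : probability T' R)
  (eta : T' -> point_measure R)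
  (heta : poisson_point_process Q
     (intensity_measure (fun x : R => alpha / (2 * x `^ (1 + alpha / 2)))) eta) :
  cvg_in_distribution P
    (fun n w => point_measure_of (fun i : 'I_n => b n ^- 2 * lambda n w i))
    Q eta.
Proof.
have alpha0 : 0 < alpha by case/andP: halpha.
have hm := cvg_number_of_entries hgamma hp.
(* [lambda] is only known pointwise as a list of eigenvalues; the ordering makes it determined by
   the entries, hence measurable. *)
have mlam n i : measurable_fun [set: T n] (fun w => lambda n w i).
  apply: (measurable_ordered_eigenvalues (M := fun w => A n w *m (A n w)^T)) => [i' j'|w] //.
  rewrite (_ : (fun w => _) = (fun w => \sum_j a n i' j w * a n j' j w)).
    by apply: measurable_sum => j; apply: measurable_funM; exact: measurable_funPT.
  by apply/funext => w; rewrite mxE; apply: eq_bigr => j _; rewrite mxE hA !mxE.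
have mxi n m l : measurable_fun [set: T n]
    (fun w => point_measure_of (fun i : 'I_n => b n ^- 2 * lambda n w i) (grid_cell m l)).
  apply: measurable_point_measure_of; last exact: measurable_grid_cell.
  by move=> i; apply: measurable_funM; [exact: measurable_cst|exact: mlam].
have meta m l : measurable_fun [set: T'] (fun w => eta w (grid_cell m l)).
  by case: heta => h _ _ _; apply: h; exact: measurable_grid_cell.
apply: cvg_in_distribution_counts => // m c e e0.
have e2 : 0 < e / 2 by rewrite divr_gt0.
pose root (l : 'I_(4 ^ m).+1) : R := Num.sqrt (l.+1%:R / 2 ^+ m).
pose q n (l : 'I_(4 ^ m)) := fine (mu (entry_cell (b n) l)).
have cq l : (n * p n)%:R * q n l @[n --> \oo] --> cell_rate alpha m l.
  have c1 := cvg_tail_quantile alpha0 hL htail hm hb (grid_root_gt0 R (widen_ord (leqnSn _) l)).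
  have c2 := cvg_tail_quantile alpha0 hL htail hm hb (grid_root_gt0 R (lift ord0 l)).
  rewrite !powR_grid_root in c1 c2.
  apply: (cvg_near_eq (g := fun n => (n * p n)%:R * abs_tail mu (root (widen_ord (leqnSn _) l) * b n)
      - (n * p n)%:R * abs_tail mu (root (lift ord0 l) * b n))).
    by apply: cvgB.
  near=> n; rewrite /q law_entry_cell ?mulrBr //.
  apply: (@lt_le_trans _ _ 1) => //; near: n.
  exact: (near_tail_quantile_ge alpha0 hL htail hm hb).
have cw := cvg_multinomial_weight (m := c) hm cq.
have qE := poisson_counts c heta.
near=> n.
have b1 : 1 <= b n by near: n; exact: (near_tail_quantile_ge alpha0 hL htail hm hb).
have b0 : 0 < b n by exact: lt_le_trans b1.
have [Bad [mBad PBad good]] : exists Bad : set (T n), [/\ measurable Bad, fine (P n Bad) <= e / 2 &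
    forall w (lam : 'I_n -> R), ~ Bad w ->
      char_poly ((\matrix_(i, j) a n i j w) *m (\matrix_(i, j) a n i j w)^T) =
        \prod_(i < n) ('X - (lam i)%:P) ->
      forall l, #|[pred i | (root l * b n) ^+ 2 < lam i]| =
        #|[pred ij : 'I_n * 'I_(p n) | root l * b n < `|a n ij.1 ij.2 w|]|].
  near: n.
  exact: (near_good_event halpha hgamma hp hL htail hb hlaw hindep hmean (grid_root_gt0 R (m := m)) e2).
pose X (ij : 'I_n * 'I_(p n)) (w : T n) : R := a n ij.1 ij.2 w.
have mX ij : measurable_fun [set: T n] (X ij) by exact: measurable_funPT.
have mB l := @measurable_entry_cell R m (b n) l.
have tB := @trivIset_entry_cell R m (b n) b0.
have qX ij l : P n (X ij @^-1` entry_cell (b n) l) = (q n l)%:E.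
  rewrite -[LHS]/(distribution (P n) (a n ij.1 ij.2) (entry_cell (b n) l)) hlaw //.
  by rewrite /q fineK // fin_num_measure.
have mC : measurable (counts_event X (entry_cell (b n)) c) by exact: measurable_counts_event.
have PC := probability_counts_event c mX (hindep n) mB tB qX.
rewrite card_prod !card_ord in PC.
pose H := [set w | has_counts c (point_measure_of (fun i : 'I_n => b n ^- 2 * lambda n w i))].
have mH : measurable H by exact: measurable_has_counts.
have CH : counts_event X (entry_cell (b n)) c `<=` H `|` Bad.
  move=> w hw; have [|nb] := pselect (Bad w); [by right|left].
  apply: (has_counts_of_entry_cells (x := fun ij => X ij w)) => //.
  by apply: good => //; case: (hlambda n w); rewrite hA.
have PCH : fine (P n (counts_event X (entry_cell (b n)) c)) <= fine (P n H) + e / 2.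
  apply: le_trans (probability_le_sub (P n) mC (measurableU _ _ mH mBad) CH) _.
  apply: le_trans (probability_setU_le _ mH mBad) _.
  by rewrite lerD2l.
have w2 : \prod_(l < 4 ^ m) (expR (- cell_rate alpha m l) * cell_rate alpha m l ^+ c l / (c l)`!%:R) - e / 2
    < multinomial_weight (1 - \sum_l q n l) (q n) (n * p n) c.
  by near: n; apply: (cvgr_gt _ cw); rewrite gtrBl.
rewrite qE; rewrite PC in PCH; lra.
Unshelve. all: by end_near. Qed.
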